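(* The following two statements hold. (1) Let $q\ge2$ be an integer, and let $F\ne0$ be an element of the $q$-th free Poisson chaos. Then $F$ cannot have a free centered Poisson distribution (that is, there is no $\lambda>0$ such that $F$ has the law of $Z(\lambda)$). (2) Let $f\in L^2(\mathbb{R}_+)$ be such that $\|f\|_{L^2(\mathbb{R}_+)}^2=\lambda>0$. Then $I_1^{\hat N}(f)$ has the free centered Poisson distribution with parameter $\lambda$ if and only if $f$ takes values in $\{0,1\}$ ($\mu$-almost everywhere).
   Context: Setting. $(\mathscr A,\varphi)$ is a tracial non-commutative ($W^*$-)probability space: $\mathscr A$ is a von Neumann algebra and $\varphi$ a faithful normal tracial state. $L^2(\mathscr A,\varphi)$ is the completion of $\mathscr A$ for $\langle a,b\rangle=\varphi(b^*a)$. $\mu$ is Lebesgue measure on $\mathbb{R}_+$, and $L^2(\mathbb{R}_+^q)$ is the space of complex-valued functions on $\mathbb{R}_+^q$ square-integrable with respect to $\mu^q$. Mirror symmetry. $f\in L^2(\mathbb{R}_+^q)$ is mirror symmetric if $f(t_1,\dots,t_q)=\overline{f(t_q,\dots,t_1)}$ for almost every $(t_1,\dots,t_q)$. Free centered Poisson law. For $\lambda>0$, $Z(\lambda)$ is a self-adjoint random variable whose free cumulants are $\kappa_1=0$ and $\kappa_m=\lambda$ for all $m\ge2$. Free centered Poisson measure. $\{\hat N(B)\}$, indexed by Borel sets $B\subset\mathbb{R}_+$ with $\mu(B)<\infty$, is a family of self-adjoint elements of $\mathscr A$ such that: $\hat N(B)$ has the law of $Z(\mu(B))$ (and is $0$ if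 $\mu(B)=0$); $\hat N(B_1),\dots,\hat N(B_r)$ are freely independent if $B_1,\dots,B_r$ are pairwise disjoint; $\hat N(B_1\cup B_2)=\hat N(B_1)+\hat N(B_2)$ if $B_1\cap B_2=\emptyset$. Multiple integrals. For pairwise disjoint Borel sets $A_1,\dots,A_q$ of finite measure, $I_q^{\hat N}(\mathbf 1_{A_1}\otimes\cdots\otimes\mathbf 1_{A_q})=\hat N(A_1)\cdots\hat N(A_q)$; this is extended linearly and then to all of $L^2(\mathbb{R}_+^q)$, with values in $L^2(\mathscr A,\varphi)$, by the isometry $\varphi(I_q^{\hat N}(g)^*I_q^{\hat N}(f))=\langle f,g\rangle_{L^2(\mathbb{R}_+^q)}$. If $f$ is bounded with bounded support, $I_q^{\hat N}(f)$ is a bounded operator. $I_q^{\hat N}(f)$ is self-adjoint if and only if $f$ is mirror symmetric (for $q=1$: real-valued a.e.). Free Poisson chaos. The $q$-th free Poisson chaos is the collection of all $I_q^{\hat N}(f)$ with $f\in L^2(\mathbb{R}_+^q)$ mirror symmetric, bounded and with bounded support. Laws. ''$F$ has the law of $Z(\lambda)$'' means that $F$ is self-adjoint and its distribution with respect to $\varphi$ (its spectral distribution; elements of $L^2(\mathscr A,\varphi)$ being viewed as operators affiliated with $\mathscr A$) equals that of $Z(\lambda)$. *)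

(* Defs.v *)
From mathcomp Require Import all_boot all_order all_algebra.
From mathcomp Require Import sesquilinear.
From mathcomp Require Import complex.
From mathcomp Require Import all_classical all_reals all_analysis.

Set Implicit Arguments.
Unset Strict Implicit.
Unset Printing Implicit Defensive.

Import Order.TTheory GRing.Theory Num.Theory.
Import numFieldNormedType.Exports.

Local Open Scope classical_set_scope.
Local Open Scope complex_scope.
Local Open Scope ring_scope.

(* Inner products are linear in the first argument and conjugate-linear in the
   second one. *)
Definition hnorm (R : realType) (V : lmodType R[i])
    (form : {dot V for (@Num.conj R[i])}) (u : V) : R :=
  Num.sqrt (complex.Re (form u u)).

Record hilbertSpace (R : realType) := HilbertSpace {
  hcarrier :> lmodType R[i];
  hdot : {dot hcarrier for (@Num.conj R[i])};
  hcomplete : forall u : nat -> hcarrier,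
    (forall e : R, 0 < e -> exists N : nat, forall m n : nat,
       (N <= m)%N -> (N <= n)%N -> hnorm hdot (u m - u n) < e) ->
    exists l, (fun n => hnorm hdot (u n - l)) @ \oo --> (0 : R)
}.

Definition hcvg (R : realType) (H : hilbertSpace R) (u : nat -> H) (l : H) :=
  (fun n => hnorm (@hdot R H) (u n - l)) @ \oo --> (0 : R).

(* Bounded operators are represented by their underlying functions. *)
Definition op (R : realType) (H : hilbertSpace R) := H -> H.

Section Operators.
Context {R : realType} {H : hilbertSpace R}.
Implicit Types (a b : op H) (M : set (op H)).

Definition bounded_op a : Prop :=
  (forall (k : R[i]) (u v : H), a (k *: u + v) = k *: a u + a v) /\
  exists c : R, forall u, hnorm (@hdot R H) (a u) <= c * hnorm (@hdot R H) u.

Definition is_adjoint a b : Prop :=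
  forall u v, hdot H (a u) v = hdot H u (b v).

Definition self_adjoint a : Prop := is_adjoint a a.

Definition op_le a b : Prop := forall u, hdot H (a u) u <= hdot H (b u) u.

Definition opprod (s : seq (op H)) : op H := foldr (fun a b => a \o b) id s.

Definition commutant (S : set (op H)) : set (op H) :=
  [set b | bounded_op b /\ forall a, S a -> a \o b = b \o a].

Definition von_neumann_algebra M : Prop :=
  [/\ M `<=` bounded_op,
      forall a, M a -> exists2 b, M b & is_adjoint a b
    & commutant (commutant M) = M].

Definition is_state M (phi : op H -> R[i]) : Prop :=
  [/\ forall (k : R[i]) a b, M a -> M b ->
        phi ((k \*: a) \+ b) = k * phi a + phi b,
      phi id = 1
    & forall a b, M a -> is_adjoint a b -> 0 <= phi (b \o a)].

Definition faithful M (phi : op H -> R[i]) : Prop :=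
  forall a b, M a -> is_adjoint a b -> phi (b \o a) = 0 -> a = (fun=> 0).

Definition tracial M (phi : op H -> R[i]) : Prop :=
  forall a b, M a -> M b -> phi (a \o b) = phi (b \o a).

Definition sa_part M : set (op H) := [set a | M a /\ self_adjoint a].

(* [phi] preserves least upper bounds of upward directed families of
   self-adjoint elements. *)
Definition normal M (phi : op H -> R[i]) : Prop :=
  forall (D : set (op H)) (s : op H),
    D !=set0 -> D `<=` sa_part M ->
    (forall a b, D a -> D b -> exists c, [/\ D c, op_le a c & op_le b c]) ->
    sa_part M s -> (forall a, D a -> op_le a s) ->
    (forall b, sa_part M b -> (forall a, D a -> op_le a b) -> op_le s b) ->
    (forall a, D a -> phi a <= phi s) /\
    (forall c : R[i], (forall a, D a -> phi a <= c) -> phi s <= c).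

End Operators.

Record tracialWspace (R : realType) := TracialWspace {
  nc_hilbert : hilbertSpace R;
  nc_alg : set (op nc_hilbert);
  nc_state : op nc_hilbert -> R[i];
  nc_vN : von_neumann_algebra nc_alg;
  nc_isstate : is_state nc_alg nc_state;
  nc_faithful : faithful nc_alg nc_state;
  nc_normal : normal nc_alg nc_state;
  nc_tracial : tracial nc_alg nc_state
}.

Definition ncop (R : realType) (A : tracialWspace R) := op (nc_hilbert A).

(* A completion of the algebra for <a, b> = phi (b^* a). The left and right
   multiplications by elements of the algebra are bounded for this inner product
   (for the right ones because phi is a trace), and [lact], [ract] are their
   unique bounded extensions to the completion. *)
Record L2space (R : realType) (A : tracialWspace R) := MkL2space {
  L2hilbert :> hilbertSpace R;
  emb : ncop A -> L2hilbert;
  emb_linear : forall (k : R[i]) (a b : ncop A), nc_alg a -> nc_alg b ->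
    emb ((k \*: a) \+ b) = k *: emb a + emb b;
  emb_dot : forall a b b' : ncop A, nc_alg a -> nc_alg b -> is_adjoint b b' ->
    hdot L2hilbert (emb a) (emb b) = nc_state (b' \o a);
  emb_dense : forall u : L2hilbert, exists a : nat -> ncop A,
    (forall n, nc_alg (a n)) /\ hcvg (fun n => emb (a n)) u;
  lact : ncop A -> L2hilbert -> L2hilbert;
  ract : ncop A -> L2hilbert -> L2hilbert;
  lact_bounded : forall a, nc_alg a -> @bounded_op R L2hilbert (lact a);
  ract_bounded : forall a, nc_alg a -> @bounded_op R L2hilbert (ract a);
  lact_emb : forall a b, nc_alg a -> nc_alg b -> lact a (emb b) = emb (a \o b);
  ract_emb : forall a b, nc_alg a -> nc_alg b -> ract a (emb b) = emb (b \o a)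
}.

Section FreeIndependence.
Context {R : realType} {A : tracialWspace R}.

Inductive gen_star_alg (a : ncop A) : ncop A -> Prop :=
  | Gen_base : gen_star_alg a a
  | Gen_one : gen_star_alg a id
  | Gen_lin (k : R[i]) b c :
      gen_star_alg a b -> gen_star_alg a c -> gen_star_alg a ((k \*: b) \+ c)
  | Gen_mul b c : gen_star_alg a b -> gen_star_alg a c -> gen_star_alg a (b \o c)
  | Gen_adj b c : gen_star_alg a b -> is_adjoint b c -> gen_star_alg a c.

Definition freely_independent (r : nat) (a : 'I_r -> ncop A) : Prop :=
  forall (n : nat) (i : nat -> 'I_r) (b : nat -> ncop A), (0 < n)%N ->
    (forall k, (k < n)%N -> gen_star_alg (a (i k)) (b k) /\ nc_state (b k) = 0) ->
    (forall k, (k.+1 < n)%N -> i k <> i k.+1) ->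
    nc_state (opprod (mkseq b n)) = 0.

End FreeIndependence.

Section SpectralDistribution.
Context {R : realType} {A : tracialWspace R} {L : L2space A}.

(* Graph of the closed operator affiliated with the algebra defined by [xi]:
   the closure of [emb x |-> xi x]. *)
Definition affiliated (xi u v : L) : Prop :=
  exists x : nat -> ncop A,
    [/\ forall n, nc_alg (x n),
        hcvg (fun n => emb L (x n)) u
      & hcvg (fun n => ract (x n) xi) v].

Definition self_adjoint_graph (G : L -> L -> Prop) : Prop :=
  forall w z, G w z <-> forall u v, G u v -> hdot L v w = hdot L u z.

(* [E] is a projection-valued measure on the Borel sets of the line, [m u] is
   the measure B |-> <E(B) u, u>, and the operator with graph [G] is
   \int t dE(t): its domain is the set of all u such that t is
   square-integrable for [m u], and on it the operator has quadratic form
   \int t d(m u) (which determines it, by polarization). *)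
Definition spectral_resolution (G : L -> L -> Prop) (E : set R -> ncop A)
    (m : L -> {measure set (measurableTypeR R) -> \bar R}) : Prop :=
  [/\ forall B : set (measurableTypeR R), measurable B ->
        [/\ nc_alg (E B), self_adjoint (E B) & E B \o E B = E B],
      E setT = id /\
      (forall B C : set (measurableTypeR R), measurable B -> measurable C ->
         E (B `&` C) = E B \o E C),
      forall u (B : set (measurableTypeR R)), measurable B ->
        m u B = (complex.Re (hdot L (lact (E B) u) u))%:E,
      forall u, (exists v, G u v) <->
        (\int[m u]_t ((t : R) ^+ 2)%:E < +oo)%E
    & forall u v, G u v -> hdot L v u = (\int[m u]_t (t : R))%:C].

Definition spectral_distribution (xi : L)
    (nu : probability (measurableTypeR R) R) : Prop :=
  exists E m, spectral_resolution (affiliated xi) E m /\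
    forall B : set (measurableTypeR R), measurable B ->
      nc_state (E B) = (fine (nu B))%:C.

End SpectralDistribution.

Definition noncrossing (n : nat) (P : {set {set 'I_n}}) : bool :=
  [forall V in P, forall W in P,
    [forall i : 'I_n, forall j : 'I_n, forall k : 'I_n, forall l : 'I_n,
      [&& (i < j)%N, (j < k)%N, (k < l)%N,
          i \in V, k \in V, j \in W & l \in W] ==> (V == W)]].

(* Moment-cumulant formula: sum over the non-crossing partitions of the n
   indices. The value [kappa 0] is irrelevant. *)
Definition has_free_cumulants (R : realType)
    (nu : probability (measurableTypeR R) R) (kappa : nat -> R) : Prop :=
  forall n : nat,
    \int[nu]_t ((t : R) ^+ n) =
    \sum_(P : {set {set 'I_n}} | finset.partition P [set: 'I_n] && noncrossing P)
      \prod_(V in P) kappa #|V|.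

(* The law of Z(lambda). Compactness of the support expresses that Z(lambda) is
   a bounded operator, and makes the law determined by its moments. *)
Definition free_centered_poisson (R : realType) (lambda : R)
    (nu : probability (measurableTypeR R) R) : Prop :=
  (exists c : R, nu [set t | - c <= (t : R) <= c] = 1%E) /\
  has_free_cumulants nu (fun m => if (m <= 1)%N then 0 else lambda).

Definition has_law_Z (R : realType) (A : tracialWspace R) (L : L2space A)
    (xi : L) (lambda : R) : Prop :=
  self_adjoint_graph (affiliated xi) /\
  exists nu, spectral_distribution xi nu /\ free_centered_poisson lambda nu.

Section PowerLebesgue.
Variable R : realType.
Local Notation T := (measurableTypeR R).

Definition tcons (n : nat) (p : n.-tuple T * T) : n.+1.-tuple T :=
  [tuple of p.2 :: p.1].

Lemma measurable_tcons n : measurable_fun [set: n.-tuple T * T] (@tcons n).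
Proof. exact: measurable_cons. Qed.

Definition lebesgue_step (n : nat) (m : {measure set (n.-tuple T) -> \bar R}) :
    {measure set (n.+1.-tuple T) -> \bar R} :=
  measure_function_pushforward__canonical__measure_function_Measure
    (m \x @lebesgue_measure R)%E (@measurable_tcons n).

Fixpoint lebesgue_pow (q : nat) : {measure set (q.-tuple T) -> \bar R} :=
  match q return {measure set (q.-tuple T) -> \bar R} with
  | 0 => dirac ([tuple] : 0.-tuple T)
  | n.+1 => lebesgue_step (lebesgue_pow n)
  end.

Definition orthant (q : nat) : set (q.-tuple T) :=
  [set t | forall i, 0 <= (tnth t i : R)].

End PowerLebesgue.

(* Elements of L^2(R_+^q) are represented by functions on R^q, of which only the
   restriction to R_+^q matters. *)
Section SquareIntegrable.
Context {R : realType} {q : nat}.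
Local Notation T := (q.-tuple (measurableTypeR R)).
Local Notation muq := (@lebesgue_pow R q).
Local Notation Dq := (@orthant R q).

Definition norm2sq (f : T -> R[i]) : \bar R :=
  (\int[muq]_(t in Dq) (complex.Re (f t) ^+ 2 + complex.Im (f t) ^+ 2)%:E)%E.

Definition measurable_complex (f : T -> R[i]) : Prop :=
  measurable_fun Dq (fun t => complex.Re (f t) : R) /\
  measurable_fun Dq (fun t => complex.Im (f t) : R).

Definition in_L2 (f : T -> R[i]) : Prop :=
  measurable_complex f /\ (norm2sq f < +oo)%E.

Definition L2dot (f g : T -> R[i]) : R[i] :=
  (\int[muq]_(t in Dq) complex.Re (f t * Num.conj (g t))) +i*
  (\int[muq]_(t in Dq) complex.Im (f t * Num.conj (g t))).

Definition mirror_symmetric (f : T -> R[i]) : Prop :=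
  {ae muq, forall t, Dq t -> f t = Num.conj (f [tuple of rev t])}.

Definition bounded_bounded_support (f : T -> R[i]) : Prop :=
  exists c : R, {ae muq, forall t, Dq t ->
    `|f t| <= c%:C /\ ((exists i, c < (tnth t i : R)) -> f t = 0)}.

End SquareIntegrable.

Section FreePoissonMeasure.
Context {R : realType} {A : tracialWspace R} (L : L2space A).

Definition finite_borel (B : set (measurableTypeR R)) : Prop :=
  [/\ measurable B, B `<=` [set t | 0 <= (t : R)]
    & (lebesgue_measure B < +oo)%E].

Definition free_poisson_measure (N : set (measurableTypeR R) -> ncop A) : Prop :=
  [/\ forall B, finite_borel B -> nc_alg (N B) /\ self_adjoint (N B),
      forall B, finite_borel B -> (0 < lebesgue_measure B)%E ->
        has_law_Z (emb L (N B)) (fine (lebesgue_measure B)),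
      forall B, finite_borel B -> lebesgue_measure B = 0%E -> N B = (fun=> 0),
      forall (r : nat) (B : 'I_r -> set (measurableTypeR R)),
        (forall i, finite_borel (B i)) ->
        (forall i j, i != j -> B i `&` B j = set0) ->
        freely_independent (fun i => N (B i))
    & forall B C, finite_borel B -> finite_borel C -> B `&` C = set0 ->
        N (B `|` C) = N B \+ N C].

(* These conditions determine I on L^2(R_+^q), linear combinations of
   indicators of off-diagonal boxes being dense. *)
Definition multiple_integral (N : set (measurableTypeR R) -> ncop A) (q : nat)
    (I : (q.-tuple (measurableTypeR R) -> R[i]) -> L) : Prop :=
  [/\ forall (k : R[i]) f g, in_L2 f -> in_L2 g ->
        I (fun t => k * f t + g t) = k *: I f + I g,
      forall B : 'I_q -> set (measurableTypeR R),
        (forall i, finite_borel (B i)) ->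
        (forall i j, i != j -> B i `&` B j = set0) ->
        I (fun t => \prod_(i < q) \1_(B i) (tnth t i)) =
          emb L (opprod [seq N (B i) | i <- enum 'I_q])
    & forall f g, in_L2 f -> in_L2 g -> hdot L (I f) (I g) = L2dot f g].

Definition free_poisson_chaos (q : nat)
    (I : (q.-tuple (measurableTypeR R) -> R[i]) -> L) : set L :=
  [set F | exists f, [/\ in_L2 f, mirror_symmetric f,
                         bounded_bounded_support f & F = I f]].

End FreePoissonMeasure.

(* Main.v *)
Require Import Defs.
From mathcomp Require Import all_boot all_order all_algebra.
From mathcomp Require Import complex.
From mathcomp Require Import all_classical all_reals all_analysis.
From mathcomp Require Import measurable_realfun.
From mathcomp Require Import ring lra zify.

(** Let F = I_q(f) have the law of Z(lambda).  The spectral measure of the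
operator T affiliated with F is carried by a compact set, so T is bounded, and
w = T F stands for the square of F: <w, y> = <F, F y> for y in the algebra.  The
first four moments of Z(lambda), namely 0, lambda, lambda and
2 lambda^2 + lambda, give |F|^2 = lambda and |w - F|^2 = 2 lambda^2
(law_Z_square).

Two orthogonal components of v = w - F already have square norm lambda^2 each.
The first is the component along the vector Omega of the unit, since
<v, Omega> = |F|^2 = lambda.  The second lives in the chaos of order 2q, where the
top part of the square of F has the size of the tensor square of f.  To reach it
without a product formula, approximate f by a combination g of off-diagonal
boxes, cut g into slabs g_k according to the cell of a fine grid that contains
its first variable, and put Y = sum over k <> l of (I g_l)^* (I g_k).  Freeness
gives <w, Y> = sum over k <> l of <F, I g_k> <I g_l, F> and |Y| <= |I g|^2
(simple_tensor), while Y is orthogonal to F, to Omega and to every N(B).  By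
Bessel's inequality the missing diagonal terms are negligible when the grid is
fine, so <v, Y> is close to |<F, I g>|^2, hence to lambda^2, with |Y| close to
lambda at most (top_chaos_bound).

As |v|^2 = 2 lambda^2, nothing is left in the chaos of order one: <v, N(B)> = 0
for every bounded Borel set B.  Freeness and the third moments of the N(B) give
<w, N(B)> = <F, F N(B)> = int 1_B(t_q) |f|^2 (int_last), so that (law_Z_last)
   <F, N(B)> = int 1_B(t_q) |f(t_1, ..., t_q)|^2 dt.
For q >= 2 the left side vanishes, because chaoses of different orders are
orthogonal, and f = 0.  For q = 1 it is int_B f, so f = |f|^2 almost everywhere,
which says that f takes the values 0 and 1 only.  Conversely the integral of such
an f is N(B) with B = {f = 1}, which has the law of Z(lambda) by definition. *)

Set Implicit Arguments.
Unset Strict Implicit.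
Unset Printing Implicit Defensive.

Import Order.TTheory GRing.Theory Num.Theory.
Import numFieldNormedType.Exports.

Local Open Scope classical_set_scope.
Local Open Scope complex_scope.
Local Open Scope ring_scope.

Local Notation Re := complex.Re.
Local Notation Im := complex.Im.

(** * Hilbert spaces and von Neumann algebras *)

Section Hilbert.
Context {R : realType} {H : hilbertSpace R}.
Implicit Types (u v w : H) (k : R[i]).

Local Notation "''[' u , v ]" := (hdot H u v).
Local Notation nm := (hnorm (@hdot R H)).

Lemma hdotDl u v w : '[u + v, w] = '[u, w] + '[v, w].
Proof. exact: linearDl. Qed.
Lemma hdotBl u v w : '[u - v, w] = '[u, w] - '[v, w].
Proof. exact: linearBl. Qed.
Lemma hdotNl u w : '[- u, w] = - '[u, w].
Proof. exact: linearNl. Qed.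
Lemma hdot0l w : '[0, w] = 0.
Proof. exact: linear0l. Qed.
Lemma hdotZl k u w : '[k *: u, w] = k * '[u, w].
Proof. exact: linearZl_LR. Qed.
Lemma hdotC u v : '[u, v] = ('[v, u])^*.
Proof. by rewrite (hermC (hdot H)) expr0 mul1r. Qed.
Lemma hdotDr u v w : '[u, v + w] = '[u, v] + '[u, w].
Proof. exact: linearDr. Qed.
Lemma hdotBr u v w : '[u, v - w] = '[u, v] - '[u, w].
Proof. exact: linearBr. Qed.
Lemma hdotNr u w : '[u, - w] = - '[u, w].
Proof. exact: linearNr. Qed.
Lemma hdot0r w : '[w, 0] = 0.
Proof. exact: linear0r. Qed.
Lemma hdotZr k u w : '[u, k *: w] = k^* * '[u, w].
Proof. exact: linearZr_LR. Qed.

Lemma hdot_suml J (r : seq J) (P : pred J) (F : J -> H) w :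
  '[\sum_(i <- r | P i) F i, w] = \sum_(i <- r | P i) '[F i, w].
Proof. exact: linear_sumlz. Qed.
Lemma hdot_sumr J (r : seq J) (P : pred J) (F : J -> H) w :
  '[w, \sum_(i <- r | P i) F i] = \sum_(i <- r | P i) '[w, F i].
Proof. exact: linear_sumr. Qed.

Lemma hdot_ge0 u : 0 <= '[u, u].
Proof.
have [->|u0] := eqVneq u 0; first by rewrite hdot0l.
exact/ltW/neq0_dnorm_gt0.
Qed.

Lemma hdot_re u : '[u, u] = (Re '[u, u])%:C.
Proof.
have := hdot_ge0 u; case: ('[u, u]) => a b; rewrite lecE /= => /andP[/eqP-> _].
by [].
Qed.

Lemma hnorm_ge0 u : 0 <= nm u. Proof. exact: sqrtr_ge0. Qed.

Lemma hnorm_sqr u : nm u ^+ 2 = Re '[u, u].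
Proof.
rewrite sqr_sqrtr //; have := hdot_ge0 u.
by rewrite {1}hdot_re lecE /= eqxx.
Qed.

Lemma hdot_norm u : '[u, u] = (nm u ^+ 2)%:C.
Proof. by rewrite hdot_re hnorm_sqr. Qed.

Lemma hnorm0_eq0 u : nm u = 0 -> u = 0.
Proof.
move=> u0; apply/eqP; apply: contraT => /neq0_dnorm_gt0 - /(_ _ (hdot H)).
by rewrite hdot_norm u0 expr0n ltxx.
Qed.

Lemma hnorm0 : nm 0 = 0.
Proof. by rewrite /hnorm hdot0l /= sqrtr0. Qed.

Lemma hdot_eq0 u : (forall v, '[u, v] = 0) -> u = 0.
Proof. by move=> /(_ u) h; apply: hnorm0_eq0; rewrite /hnorm h /= sqrtr0. Qed.

Lemma hdot_injl u u' : (forall v, '[u, v] = '[u', v]) -> u = u'.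
Proof.
move=> h; apply/eqP; rewrite -subr_eq0; apply/eqP/hdot_eq0 => v.
by rewrite hdotBl h subrr.
Qed.

Lemma cauchy_schwarz u v : `|'[u, v]| <= (nm u * nm v)%:C.
Proof.
have [->|v0] := eqVneq v 0; first by rewrite hdot0r hnorm0 mulr0 normr0.
have vn0 : 0 < '[v, v] by exact: neq0_dnorm_gt0.
pose c := '[u, v] / '[v, v].
have := hdot_ge0 (u - c *: v).
rewrite hdotBl !hdotBr hdotZl hdotZr hdotZl hdotZr.
have dE : '[v, v]^* = '[v, v] by rewrite -hdotC.
have -> : c^* = '[u, v]^* / '[v, v] by rewrite /c rmorphM fmorphV; congr (_ / _).
rewrite mulfVK ?gt_eqF //.
rewrite (hdotC v u) subrr subr0 subr_ge0.
rewrite mulrAC ler_pdivrMr // mulrC -normCK !hdot_norm -rmorphM /= -exprMn.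
rewrite rmorphXn /= ler_sqr // ?nnegrE ?normr_ge0 //.
by rewrite ler0c mulr_ge0 ?hnorm_ge0.
Qed.

Lemma le_Re_abs (z : R[i]) (c : R) : `|z| <= c%:C -> `|Re z| <= c.
Proof. by move=> h; rewrite -(@lecR R); apply: le_trans h; exact: normc_ge_Re. Qed.

Lemma Re_hdot_le u v : `|Re '[u, v]| <= nm u * nm v.
Proof. exact/le_Re_abs/cauchy_schwarz. Qed.

Lemma Re_hdotC u v : Re '[u, v] = Re '[v, u].
Proof. by rewrite hdotC; case: ('[v, u]). Qed.

Lemma hnormD_sqr u v :
  nm (u + v) ^+ 2 = nm u ^+ 2 + 2 * Re '[u, v] + nm v ^+ 2.
Proof.
rewrite !hnorm_sqr hdotDl !hdotDr !raddfD /= (Re_hdotC v u); ring.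
Qed.

Lemma hnormD u v : nm (u + v) <= nm u + nm v.
Proof.
rewrite -ler_sqr ?nnegrE ?addr_ge0 ?hnorm_ge0 // hnormD_sqr sqrrD.
have := Re_hdot_le u v; rewrite ler_norml => /andP[_ h].
lra.
Qed.

Lemma hnormN u : nm (- u) = nm u.
Proof. by rewrite /hnorm hdotNl hdotNr opprK. Qed.

Lemma hnormB_sym u v : nm (u - v) = nm (v - u).
Proof. by rewrite -hnormN opprB. Qed.

Lemma hnormB_sqr u v :
  nm (u - v) ^+ 2 = nm u ^+ 2 - 2 * Re '[u, v] + nm v ^+ 2.
Proof. by rewrite hnormD_sqr hdotNr raddfN /= hnormN; ring. Qed.

Lemma hnormB u v : nm (u - v) <= nm u + nm v.
Proof. by rewrite -(hnormN v) hnormD. Qed.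

Lemma hnorm_triangle w u v : nm (u - v) <= nm (u - w) + nm (w - v).
Proof. by rewrite -{1}(subrK w u) -addrA hnormD. Qed.

Lemma hnormZ k u : nm (k *: u) = Re `|k| * nm u.
Proof.
have r0 : 0 <= Re `|k| by rewrite normc_def /= sqrtr_ge0.
apply/eqP; rewrite -(@eqrXn2 _ 2) ?mulr_ge0 ?hnorm_ge0 //; apply/eqP.
rewrite hnorm_sqr hdotZl hdotZr mulrA -normCK exprMn hdot_norm.
by rewrite normc_def -!rmorphXn -rmorphM.
Qed.

Lemma conjCr (r : R) : (r%:C)^* = r%:C.
Proof. by apply/eqP; rewrite eq_complex /= oppr0 !eqxx. Qed.

Lemma hnormZr (r : R) u : nm (r%:C *: u) = `|r| * nm u.
Proof. by rewrite hnormZ normc_def /= expr0n addr0 sqrtr_sqr. Qed.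

(** Error terms in the limit arguments below are multiples of an arbitrary e. *)
Lemma complex_small (z : R[i]) (C : R) :
  (forall e : R, 0 < e -> `|z| <= (C * e)%:C) -> z = 0.
Proof.
move=> h; apply/eqP; rewrite -normr_eq0 normc_def.
have {}h (e : R) : 0 < e -> Num.sqrt (Re z ^+ 2 + Im z ^+ 2) <= C * e.
  by move=> /h; rewrite normc_def lecR.
set x := Num.sqrt _ in h *; have x0 : 0 <= x by exact: sqrtr_ge0.
rewrite -[0]/(0%:C) (inj_eq (@complexI _)) eq_le x0 andbT.
have c0 : 0 < `|C| + 1 by rewrite ltr_wpDl.
apply/ler_addgt0Pl => e e0; rewrite addr0.
apply: le_trans (h (e / (`|C| + 1)) _) _; first by rewrite divr_gt0.
rewrite mulrCA ger_pMr // ler_pdivrMr // mul1r.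
by rewrite (le_trans (ler_norm C)) // lerDl.
Qed.

(** Lipschitz scalar functions: two of them that agree on a set agree at its
adherent points, which is how identities pass from the algebra to its
completion. *)
Definition hlip (f : H -> R[i]) : Prop :=
  exists C : R, forall u v, `|f u - f v| <= (C * nm (u - v))%:C.

Definition hadherent (D : set H) u : Prop :=
  forall e : R, 0 < e -> exists2 d, D d & nm (u - d) < e.

Definition hdense (D : set H) : Prop := forall u, hadherent D u.

Lemma hlip_eq_adherent (D : set H) (f g : H -> R[i]) u :
  hadherent D u -> hlip f -> hlip g ->
  (forall d, D d -> f d = g d) -> f u = g u.
Proof.
move=> dD [C hC] [C' hC'] fg; apply/eqP; rewrite -subr_eq0; apply/eqP.
apply: (@complex_small _ (`|C| + `|C'|)) => e e0.
have [d Dd ud] := dD e e0.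
have -> : f u - g u = (f u - f d) + (g d - g u) by rewrite (fg d Dd) addrA subrK.
apply: le_trans (ler_normD _ _) _.
apply: le_trans (lerD (hC _ _) (hC' _ _)) _.
rewrite -rmorphD lecR mulrDl (hnormB_sym d) lerD //.
  rewrite (le_trans (ler_wpM2r (hnorm_ge0 _) (ler_norm C))) //.
  by rewrite ler_wpM2l // ltW.
rewrite (le_trans (ler_wpM2r (hnorm_ge0 _) (ler_norm C'))) //.
by rewrite ler_wpM2l // ltW.
Qed.

Lemma hlip_eq (D : set H) (f g : H -> R[i]) : hdense D -> hlip f -> hlip g ->
  (forall d, D d -> f d = g d) -> forall u, f u = g u.
Proof. by move=> dD lf lg fg u; exact: hlip_eq_adherent (dD u) lf lg fg. Qed.

Lemma hcvg_dense (D : set H) :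
  (forall u, exists x : nat -> H, (forall n, D (x n)) /\ hcvg x u) -> hdense D.
Proof.
move=> h u e e0; have [x [Dx xu]] := h u.
have /cvgrPdist_lt/(_ e e0)[n _ /(_ n (leqnn n)) /=] := xu.
rewrite sub0r normrN ger0_norm ?hnorm_ge0 // => nu.
by exists (x n) => //; rewrite hnormB_sym.
Qed.

Lemma bounded_opP (a : op H) : bounded_op a ->
  exists2 c : R, 0 <= c & forall u, nm (a u) <= c * nm u.
Proof.
move=> [_ [c hc]]; exists `|c| => // u; apply: le_trans (hc u) _.
by rewrite ler_wpM2r ?hnorm_ge0 // ler_norm.
Qed.

Section BoundedOp.
Variables (a : op H) (ba : bounded_op a).

Lemma bopP k u v : a (k *: u + v) = k *: a u + a v. Proof. exact: ba.1. Qed.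

Lemma bopD u v : a (u + v) = a u + a v.
Proof. by have := bopP 1 u v; rewrite !scale1r. Qed.

Lemma bop0 : a 0 = 0.
Proof. by apply: (addrI (a 0)); rewrite -bopD !addr0. Qed.

Lemma bopZ k u : a (k *: u) = k *: a u.
Proof. by rewrite -[k *: u]addr0 bopP bop0 addr0. Qed.

Lemma bopN u : a (- u) = - a u.
Proof. by rewrite -scaleN1r bopZ scaleN1r. Qed.

Lemma bopB u v : a (u - v) = a u - a v.
Proof. by rewrite bopD bopN. Qed.

Lemma bop_sum I (r : seq I) (P : pred I) (F : I -> H) :
  a (\sum_(i <- r | P i) F i) = \sum_(i <- r | P i) a (F i).
Proof. exact: (big_morph _ bopD bop0). Qed.

Lemma hlip_opl w : hlip (fun u => hdot H (a u) w).
Proof.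
have [c c0 hc] := bounded_opP ba; exists (c * nm w) => u v.
rewrite -hdotBl -bopB; apply: le_trans (cauchy_schwarz _ _) _.
by rewrite lecR mulrAC ler_wpM2r ?hnorm_ge0.
Qed.

Lemma hlip_opr w : hlip (fun u => hdot H w (a u)).
Proof.
have [c c0 hc] := bounded_opP ba; exists (c * nm w) => u v.
rewrite -hdotBr -bopB; apply: le_trans (cauchy_schwarz _ _) _.
by rewrite lecR [leLHS]mulrC mulrAC ler_wpM2r ?hnorm_ge0.
Qed.

End BoundedOp.

Lemma bounded_op_id : bounded_op (id : op H).
Proof. by split=> //; exists 1 => u; rewrite mul1r. Qed.

Lemma hlip_dotl w : hlip (fun u => hdot H u w).
Proof. exact: (hlip_opl bounded_op_id). Qed.

Lemma hlip_dotr w : hlip (fun u => hdot H w u).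
Proof. exact: (hlip_opr bounded_op_id). Qed.

Lemma bounded_op0 : bounded_op (fun=> 0 : H).
Proof.
by split=> [k u v|]; [rewrite scaler0 addr0|exists 0 => u; rewrite hnorm0 mul0r].
Qed.

Lemma bounded_op_lin k (a b : op H) :
  bounded_op a -> bounded_op b -> bounded_op ((k \*: a) \+ b).
Proof.
move=> ba bb; split=> [l u v|] /=.
  rewrite !(bopP ba) !(bopP bb) !scalerDr !scalerA (mulrC k l) addrACA.
  by [].
have [c c0 hc] := bounded_opP ba; have [d d0 hd] := bounded_opP bb.
exists (Re `|k| * c + d) => u /=.
rewrite (le_trans (hnormD _ _)) // mulrDl lerD // hnormZ -mulrA ler_wpM2l //.
by rewrite normc_def /= sqrtr_ge0.
Qed.

Lemma bounded_op_comp (a b : op H) :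
  bounded_op a -> bounded_op b -> bounded_op (a \o b).
Proof.
move=> ba bb; split=> [l u v|] /=; first by rewrite (bopP bb) (bopP ba).
have [c c0 hc] := bounded_opP ba; have [d d0 hd] := bounded_opP bb.
exists (c * d) => u /=.
by rewrite (le_trans (hc _)) // -mulrA ler_wpM2l.
Qed.

Lemma is_adjointC (a b : op H) : is_adjoint a b -> is_adjoint b a.
Proof. by move=> h u v; rewrite hdotC -h -hdotC. Qed.

Lemma is_adjoint_id : is_adjoint (id : op H) id. Proof. by []. Qed.

Lemma is_adjoint_comp (a b a' b' : op H) :
  is_adjoint a a' -> is_adjoint b b' -> is_adjoint (a \o b) (b' \o a').
Proof. by move=> ha hb u v /=; rewrite ha hb. Qed.

Lemma is_adjoint_lin k (a b a' b' : op H) :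
  is_adjoint a a' -> is_adjoint b b' ->
  is_adjoint ((k \*: a) \+ b) ((k^* \*: a') \+ b').
Proof.
by move=> ha hb u v /=; rewrite hdotDl hdotDr hdotZl hdotZr ha hb conjCK.
Qed.

Lemma is_adjoint_uniq (a b b' : op H) :
  is_adjoint a b -> is_adjoint a b' -> b = b'.
Proof.
move=> h h'; apply/funext => v; apply: hdot_injl => u.
by rewrite hdotC -h h' -hdotC.
Qed.

Section VonNeumann.
Variables (M : set (op H)) (vM : von_neumann_algebra M).

Lemma vn_bounded a : M a -> bounded_op a.
Proof. by case: vM => h _ _; exact: h. Qed.

(** Bicommutant characterization: it turns every closure property of the algebra
into a property of commuting bounded operators. *)
Lemma vnP b : M b <-> bounded_op b /\ forall a, commutant M a -> a \o b = b \o a.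
Proof. by case: vM => _ _ {1}<-. Qed.

Lemma vn_adj a : M a -> exists2 b, M b & is_adjoint a b.
Proof. by case: vM => _ h _; exact: h. Qed.

Lemma vn_id : M id.
Proof. by apply/vnP; split=> //; exact: bounded_op_id. Qed.

Lemma vn_0 : M (fun=> 0).
Proof.
apply/vnP; split; first exact: bounded_op0.
by move=> a [ba _]; apply/funext => u /=; rewrite (bop0 ba).
Qed.

Lemma vn_lin k a b : M a -> M b -> M ((k \*: a) \+ b).
Proof.
move=> /vnP[ba ca] /vnP[bb cb]; apply/vnP; split; first exact: bounded_op_lin.
move=> c hc; apply/funext => u /=; rewrite (bopP hc.1).
by have := congr1 (@^~ u) (ca c hc); have := congr1 (@^~ u) (cb c hc) => /= -> ->.
Qed.

Lemma vn_comp a b : M a -> M b -> M (a \o b).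
Proof.
move=> /vnP[ba ca] /vnP[bb cb]; apply/vnP; split; first exact: bounded_op_comp.
move=> c hc; apply/funext => u /=.
have := congr1 (@^~ (b u)) (ca c hc); have := congr1 (@^~ u) (cb c hc).
by move=> /= -> ->.
Qed.

End VonNeumann.
End Hilbert.

(** * The completion of the algebra *)

Section NCSpace.
Context {R : realType} {A : tracialWspace R} (L : L2space A).
Local Notation M := (@nc_alg R A).
Local Notation phi := (@nc_state R A).
Local Notation "''[' u , v ]" := (hdot (L2hilbert L) u v).
Local Notation nm := (hnorm (@hdot R (L2hilbert L))).
Local Notation emb := (emb L).
Implicit Types (a b c : ncop A) (u v w : L).

Lemma op0E : (fun=> 0) = (((-1) \*: id) \+ id) :> ncop A.
Proof. by apply/funext => u /=; rewrite scaleN1r addNr. Qed.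

Lemma alg_bounded a : M a -> bounded_op a.
Proof. exact: vn_bounded (nc_vN A) _. Qed.
Lemma alg_adj a : M a -> exists2 b, M b & is_adjoint a b.
Proof. exact: vn_adj (nc_vN A) _. Qed.
Lemma alg_id : M id. Proof. exact: vn_id (nc_vN A). Qed.
Lemma alg_0 : M (fun=> 0). Proof. exact: vn_0 (nc_vN A). Qed.
Lemma alg_lin k a b : M a -> M b -> M ((k \*: a) \+ b).
Proof. exact: vn_lin (nc_vN A) _ _ _. Qed.
Lemma alg_comp a b : M a -> M b -> M (a \o b).
Proof. exact: vn_comp (nc_vN A) _ _. Qed.

Lemma phi_lin k a b : M a -> M b -> phi ((k \*: a) \+ b) = k * phi a + phi b.
Proof. by case: (nc_isstate A) => h _ _; exact: h. Qed.
Lemma phi_id : phi id = 1.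
Proof. by case: (nc_isstate A). Qed.
Lemma phi_0 : phi (fun=> 0) = 0.
Proof.
by rewrite op0E phi_lin ?phi_id ?mulr1 ?addNr //; exact: alg_id.
Qed.
Definition hembed : set L := [set emb a | a in M].

Lemma emb_hdense : hdense hembed.
Proof.
apply: hcvg_dense => u; have [a [Ma au]] := emb_dense u.
by exists (fun n => emb (a n)); split=> // n; exists (a n).
Qed.

Lemma emb_lin k a b : M a -> M b ->
  emb ((k \*: a) \+ b) = k *: emb a + emb b.
Proof. exact: emb_linear. Qed.

Lemma embdot a b b' : M a -> M b -> is_adjoint b b' ->
  '[emb a, emb b] = phi (b' \o a).
Proof. exact: emb_dot. Qed.

Lemma emb_0 : emb (fun=> 0) = 0.
Proof.
by rewrite op0E emb_lin ?scaleN1r ?addNr //; exact: alg_id.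
Qed.

(** Faithfulness of the state makes the algebra embed in its completion; a
multiple integral therefore determines the operator that represents it. *)
Lemma emb_inj a b : M a -> M b -> emb a = emb b -> a = b.
Proof.
move=> Ma Mb ab; pose c : ncop A := ((-1) \*: b) \+ a.
have Mc : M c by exact: alg_lin.
have [c' Mc' cc'] := alg_adj Mc.
have e0 : emb c = 0 by rewrite emb_lin // ab scaleN1r addNr.
have := @embdot c c c' Mc Mc cc'; rewrite e0 hdot0l => /esym h.
have := nc_faithful Mc cc' h => c0.
apply/funext => u; have := congr1 (@^~ u) c0; rewrite /c /= scaleN1r => /eqP.
by rewrite addrC subr_eq0 => /eqP.
Qed.

Lemma lact_id u : lact id u = u.
Proof.
apply: hdot_injl => v.
have h1 := hlip_opl (lact_bounded L alg_id) v.
have h2 := hlip_dotl v.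
apply: (hlip_eq emb_hdense h1 h2) => _ [a Ma <-].
by rewrite lact_emb //; exact: alg_id.
Qed.

Lemma ract_id u : ract id u = u.
Proof.
apply: hdot_injl => v.
have h1 := hlip_opl (ract_bounded L alg_id) v.
have h2 := hlip_dotl v.
apply: (hlip_eq emb_hdense h1 h2) => _ [a Ma <-].
by rewrite ract_emb //; exact: alg_id.
Qed.

Lemma lact_comp a b u : M a -> M b -> lact (a \o b) u = lact a (lact b u).
Proof.
move=> Ma Mb; apply: hdot_injl => v.
have Mab := alg_comp Ma Mb.
have h1 := hlip_opl (lact_bounded L Mab) v.
have h2 := hlip_opl (bounded_op_comp (lact_bounded L Ma) (lact_bounded L Mb)) v.
apply: (hlip_eq emb_hdense h1 h2) => _ [c Mc <-] /=.
by rewrite !lact_emb //; exact: alg_comp.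
Qed.

Lemma lact_adj a a' u v : M a -> M a' -> is_adjoint a a' ->
  '[lact a u, v] = '[u, lact a' v].
Proof.
move=> Ma Ma' aa'.
have h1 := hlip_opl (lact_bounded L Ma) v.
apply: (hlip_eq emb_hdense h1 (hlip_dotl _)) => _ [b Mb <-] {u h1} /=.
have h2 := hlip_opr (lact_bounded L Ma') (emb b).
apply: (hlip_eq emb_hdense (hlip_dotr _) h2) => _ [c Mc <-] {v h2} /=.
rewrite !lact_emb //; have [c' Mc' cc'] := alg_adj Mc.
rewrite (embdot _ _ cc') //; last exact: alg_comp.
rewrite (@embdot _ _ (c' \o a)) //; first exact: alg_comp.
exact: is_adjoint_comp (is_adjointC aa') cc'.
Qed.

Lemma lact_lin k a b u : M a -> M b ->
  lact ((k \*: a) \+ b) u = k *: lact a u + lact b u.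
Proof.
move=> Ma Mb; apply: hdot_injl => v; have Mab := alg_lin k Ma Mb.
have h1 := hlip_opl (lact_bounded L Mab) v.
have h2 := hlip_opl (bounded_op_lin k (lact_bounded L Ma) (lact_bounded L Mb)) v.
apply: (hlip_eq emb_hdense h1 h2) => _ [c Mc <-] /=.
by rewrite !lact_emb // -emb_lin //; exact: alg_comp.
Qed.

Lemma lact_0 u : lact (fun=> 0) u = 0 :> L.
Proof.
by rewrite op0E lact_lin ?scaleN1r ?addNr //; exact: alg_id.
Qed.

Lemma hnorm_emb_id : nm (emb id) = 1.
Proof.
have := hdot_norm (emb id); rewrite (@embdot id id id alg_id alg_id) ?phi_id //.
move=> /eqP; rewrite -[1]/(1%:C) (inj_eq (@complexI _)) eq_sym sqrf_eq1.
by case/orP => /eqP // h; have := hnorm_ge0 (emb id); rewrite h ler0N1.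
Qed.

(** Constant sequences are allowed in the closure, so the affiliated operator
extends emb y |-> ract y xi. *)
Lemma affiliated_emb xi y : M y -> affiliated xi (emb y) (ract y xi).
Proof.
move=> My; exists (fun=> y); split=> //.
  rewrite /hcvg subrr hnorm0; exact: cvg_cst.
rewrite /hcvg subrr hnorm0; exact: cvg_cst.
Qed.
End NCSpace.

(** * Moments of the centered free Poisson law *)

Local Close Scope classical_set_scope.
Section Moments.
Context {R : realType}.
Variable lambda : R.
Local Notation kappa := (fun m => if (m <= 1)%N then 0 else lambda : R).
Local Notation isP n := (fun P : {set {set 'I_n}} =>
  finset.partition P [set: 'I_n] && noncrossing P).
Local Notation wt P := (\prod_(V in P) kappa #|V|).

(** The first cumulant vanishes, so only the partitions without singletons
contribute to a moment. *)
Lemma wt_card n (P : {set {set 'I_n}}) : wt P != 0 ->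
  forall V, V \in P -> (2 <= #|V|)%N.
Proof.
by move=> /prodf_neq0 h V /h; case: leqP => // _; rewrite eqxx.
Qed.

Lemma partition_block0 n (P : {set {set 'I_n.+1}}) :
  finset.partition P [set: 'I_n.+1] -> exists2 V, V \in P & ord0 \in V.
Proof.
move=> pP; exists (finset.pblock P ord0); last by rewrite finset.mem_pblock (finset.cover_partition pP) inE.
by rewrite finset.pblock_mem // (finset.cover_partition pP) inE.
Qed.

Lemma partition_disj n (P : {set {set 'I_n}}) (V W : {set 'I_n}) :
  finset.partition P [set: 'I_n] -> V \in P -> W \in P -> V != W ->
  W \subset ~: V.
Proof.
move=> pP VP WP VW; rewrite -finset.disjoints_subset disjoint_sym.
by case/and3P: pP => _ /finset.trivIsetP + _; apply.
Qed.

Lemma partition_one n (P : {set {set 'I_n}}) V :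
  finset.partition P [set: 'I_n] -> V \in P ->
  (forall W, W \in P -> W = V) -> P = [set [set: 'I_n]].
Proof.
move=> pP VP h; have PE : P = [set V].
  by apply/setP => W; rewrite inE; apply/idP/eqP => [/h//|->].
by have := finset.cover_partition pP; rewrite PE /finset.cover big_set1 => ->.
Qed.

Lemma isP_one n : isP n.+1 [set [set: 'I_n.+1]].
Proof.
apply/andP; split.
  apply/and3P; split; first by rewrite /finset.cover big_set1.
    apply/finset.trivIsetP => A B; rewrite !inE => /eqP-> /eqP->; by rewrite eqxx.
  by rewrite inE eq_sym -card_gt0 cardsT card_ord.
apply/forall_inP => V; rewrite inE => /eqP ->.
apply/forall_inP => W; rewrite inE => /eqP ->.
by do 4! apply/forallP => ?; rewrite eqxx implybT.
Qed.

Lemma wt_one n : wt [set [set: 'I_n.+2]] = lambda.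
Proof. by rewrite big_set1 cardsT card_ord. Qed.

Lemma free_moment1 : \sum_(P : {set {set 'I_1}} | isP 1 P) wt P = 0.
Proof.
apply: big1 => P /andP[pP _]; apply/eqP; apply: contraT => /wt_card h.
have [V /h h2 _] := partition_block0 pP.
by have := max_card V; rewrite card_ord leqNgt h2.
Qed.

(** Two blocks of size at least two need four points: with two or three points
only the one-block partition is left. *)
Lemma free_moment23 n : (n <= 1)%N ->
  \sum_(P : {set {set 'I_n.+2}} | isP n.+2 P) wt P = lambda.
Proof.
move=> n1; rewrite (bigD1 [set [set: 'I_n.+2]]) ?isP_one //= wt_one.
rewrite big1 ?addr0 // => P /andP[/andP[pP _] /eqP PT].
apply/eqP; apply: contraT => /wt_card h; case: PT.
have [V VP _] := partition_block0 pP.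
apply: (partition_one pP VP) => W WP; apply/eqP; apply: contraT => WV.
have := partition_disj pP VP WP; rewrite eq_sym => /(_ WV) /subset_leq_card.
have cVC : (#|V| + #|~: V| = n.+2)%N by rewrite cardsC card_ord.
have := h _ VP; have := h _ WP; lia.
Qed.

Definition pairing (j : 'I_4) : {set {set 'I_4}} :=
  [set [set ord0; j]; ~: [set ord0; j]].

Lemma card_pairC (j : 'I_4) : j != ord0 -> #|~: [set ord0; j]| = 2.
Proof. by move=> j0; rewrite cardsCs finset.setCK card_ord cards2 eq_sym j0. Qed.

Lemma neq_pairC (j : 'I_4) : [set ord0; j] != ~: [set ord0; j].
Proof.
by apply/eqP => /setP/(_ ord0); rewrite !inE eqxx.
Qed.

Lemma partition_pairing (j : 'I_4) : j != ord0 ->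
  finset.partition (pairing j) [set: 'I_4].
Proof.
move=> j0; apply/and3P; split.
- rewrite /finset.cover finset.bigcup_setU !big_set1 finset.setUCr; exact: eqxx.
- apply/finset.trivIsetP => U W; rewrite !inE.
  by move=> /orP[] /eqP-> /orP[] /eqP->; rewrite ?eqxx // finset.disjoints_subset ?finset.setCK.
- rewrite !inE negb_or !(eq_sym finset.set0) -!card_gt0 card_pairC //.
  by rewrite cards2.
Qed.

Lemma wt_pairing (j : 'I_4) : j != ord0 -> wt (pairing j) = lambda ^+ 2.
Proof.
move=> j0; rewrite big_setU1 ?inE ?neq_pairC // big_set1 card_pairC //.
by rewrite cards2 eq_sym j0.
Qed.

Lemma pairing_inj (j k : 'I_4) : j != ord0 -> pairing j = pairing k -> j = k.
Proof.
move=> j0 /setP/(_ [set ord0; k]); rewrite !inE eqxx /= => /orP[]/eqP/setP h.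
  by have := h j; rewrite !inE eqxx orbT (negPf j0) => /eqP.
by have := h ord0; rewrite !inE eqxx.
Qed.

(** Pairing 0 with 2 in {0, 1, 2, 3} crosses the complementary pair {1, 3}, the
only crossing among the three pairings. *)
Lemma noncrossing_pairing (j : 'I_4) : j != ord0 ->
  noncrossing (pairing j) = (j != 2 :> nat).
Proof.
move=> j0; have jn0 : (j : nat) <> 0%N by move=> h; case/eqP: j0; exact: val_inj.
apply/idP/idP => [|j2].
  apply: contraTneq => /= j2; apply/negP.
  move=> /forall_inP/(_ [set ord0; j]); rewrite !inE eqxx => /(_ isT).
  move=> /forall_inP/(_ (~: [set ord0; j])); rewrite !inE eqxx orbT => /(_ isT).
  move=> /forallP/(_ ord0)/forallP/(_ (inord 1))/forallP/(_ j).
  move=> /forallP/(_ (inord 3)); rewrite (negPf (neq_pairC j)) !inE !eqxx orbT /=.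
  rewrite -!val_eqE /= !inordK // j2 //.
apply/forall_inP => V VP; apply/forall_inP => W WP.
apply/forallP => a; apply/forallP => b; apply/forallP => c; apply/forallP => d.
apply/implyP; move: VP WP; rewrite !inE => /orP[]/eqP-> /orP[]/eqP->; rewrite ?eqxx //;
  rewrite !inE -!val_eqE /=;
  have := ltn_ord j; have := ltn_ord a; have := ltn_ord b; have := ltn_ord c;
  have := ltn_ord d; lia.
Qed.

(** Without singletons, a partition of four points is the one-block partition or
a pairing; two of the three pairings are noncrossing. *)
Lemma free_moment4 :
  \sum_(P : {set {set 'I_4}} | isP 4 P) wt P = 2 * lambda ^+ 2 + lambda.
Proof.
pose j1 : 'I_4 := inord 1; pose j3 : 'I_4 := inord 3.
have j10 : j1 != ord0 by rewrite -val_eqE /= inordK.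
have j30 : j3 != ord0 by rewrite -val_eqE /= inordK.
rewrite (bigD1 [set [set: 'I_4]]) ?isP_one //= wt_one.
have not1 j : j != ord0 -> pairing j != [set [set: 'I_4]].
  move=> j0; apply/eqP => /setP/(_ (~: [set ord0; j])).
  rewrite !inE eqxx orbT => /esym/eqP/setP/(_ ord0).
  by rewrite !inE eqxx.
rewrite (bigD1 (pairing j1)) /=; last first.
  by rewrite partition_pairing // noncrossing_pairing // not1 // inordK.
rewrite (bigD1 (pairing j3)) /=; last first.
  rewrite partition_pairing // noncrossing_pairing // not1 // inordK //=.
  by apply/eqP => /pairing_inj => /(_ j30)/(congr1 val); rewrite /= !inordK.
rewrite !wt_pairing // big1 ?addr0; first ring.
move=> P /andP[/andP[/andP[/andP[pP nP] PT] P1] P3].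
apply/eqP; apply: contraT => /wt_card h.
have [V VP V0] := partition_block0 pP.
have [W WP WV] : exists2 W, W \in P & W != V.
  apply/exists_inP; apply: contraT; rewrite negb_exists_in => /forall_inP h1.
  case/eqP: PT; apply: (partition_one pP VP) => W /h1; rewrite negbK => /eqP//.
have WC : W \subset ~: V by apply: (partition_disj pP VP WP); rewrite eq_sym.
have cV := h _ VP; have cW := h _ WP.
have big_compl U : U \in P -> (#|~: V| <= #|U|)%N.
  by move=> /h cU; rewrite -(leq_add2l #|V|) cardsC card_ord (leq_add cV cU).
have WE : W = ~: V by apply/eqP; rewrite eqEcard WC big_compl.
have cV2 : #|V| = 2.
  apply/eqP; rewrite eqn_leq cV andbT -(leq_add2r #|~: V|) cardsC card_ord.
  by rewrite -WE (leq_add (leqnn 2) cW).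
have [j j0 VE] : exists2 j : 'I_4, j != ord0 & V = [set ord0; j].
  have : #|V| == 2%N by rewrite cV2.
  move=> /cards2P[x [y [xy VE]]].
  move: V0; rewrite VE !inE => /orP[]/eqP e; [exists y|exists x]; rewrite ?e //.
    by rewrite eq_sym.
  by rewrite finset.setUC.
have PE : P = pairing j.
  apply/setP => U; rewrite !inE -VE; apply/idP/orP => [UP|[]/eqP-> //]; last first.
    by rewrite -WE.
  have [->|UV] := eqVneq U V; first by left.
  right; have UC : U \subset ~: V by apply: (partition_disj pP VP UP); rewrite eq_sym.
  by rewrite eqEcard UC big_compl.
exfalso; move: nP P1 P3; rewrite PE noncrossing_pairing // => j2 n1 n3.
have jE : (j = 1 :> nat) \/ (j = 3 :> nat).
  have jn0 : (j : nat) <> 0%N by move=> e; case/eqP: j0; exact: val_inj.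
  by have := ltn_ord j; move: j2; lia.
case: jE => jE; [case/eqP: n1|case/eqP: n3]; congr pairing; apply: val_inj;
  by rewrite /= inordK.
Qed.

Lemma poisson_moments (nu : probability (measurableTypeR R) R) :
  has_free_cumulants nu kappa ->
  [/\ \int[nu]_t (t : R) ^+ 1 = 0, \int[nu]_t (t : R) ^+ 2 = lambda,
      \int[nu]_t (t : R) ^+ 3 = lambda
    & \int[nu]_t (t : R) ^+ 4 = 2 * lambda ^+ 2 + lambda].
Proof.
move=> h; split; rewrite h; [exact: free_moment1|exact: free_moment23|
  exact: free_moment23|exact: free_moment4].
Qed.
End Moments.

Local Open Scope classical_set_scope.
Local Open Scope ring_scope.

(** * Discretization of a measure carried by a bounded interval *)

Section Discretize.
Context {R : realType}.
Local Notation T := (measurableTypeR R).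
Variables (mu : {measure set T -> \bar R}) (c : R).
Let C : set T := [set t | - c <= (t : R) <= c].
Hypothesis mufin : (mu setT < +oo)%E.
Hypothesis muC : mu (~` C) = 0%E.

Lemma measurable_band : measurable C.
Proof.
rewrite (_ : C = `[- c, c]%classic) //.
Qed.

Lemma fin_num_sub (B : set T) : measurable B -> mu B \is a fin_num.
Proof.
move=> mB; rewrite ge0_fin_numE //; apply: le_lt_trans mufin.
by apply: le_measure; rewrite ?inE.
Qed.

(** A measure carried by [-c, c] ignores the size of p outside of that band. *)
Lemma band_ge0_integral_lty (p : T -> R) (P : R) : measurable_fun setT p ->
  (forall t, 0 <= p t) -> (forall t, C t -> p t <= P) ->
  (\int[mu]_t (p t)%:E < +oo)%E.
Proof.
move=> mp p0 pP; have mC := measurable_band.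
rewrite (@ge0_negligible_integral _ _ _ _ setT (~` C)) //.
- rewrite setTD setCK.
  have h : (\int[mu]_(t in C) (p t)%:E <= \int[mu]_(t in C) P%:E)%E.
    apply: ge0_le_integral => //.
    + by move=> t _; rewrite lee_fin.
    + by apply/measurable_EFinP; exact: measurable_funS mp.
  apply: le_lt_trans h _.
  rewrite integral_cst //; have := fin_num_sub mC.
  by case: (mu C) => // r _; rewrite -EFinM ltry.
- exact: measurableC.
- by apply/measurable_EFinP.
- by move=> t _; rewrite lee_fin.
Qed.

Lemma band_integrable (p : T -> R) (P : R) : measurable_fun setT p ->
  (forall t, C t -> `|p t| <= P) -> mu.-integrable setT (EFin \o p).
Proof.
move=> mp pP; apply/integrableP; split; first exact/measurable_EFinP.
apply: (@band_ge0_integral_lty (fun t => `|p t|) P) => //.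
exact: measurableT_comp.
Qed.

(** The cells are added one at a time; on each of them the integrand is within
eta of a constant. *)
Lemma discretize_rec (p : T -> R) (eta : R) (x : nat -> R) (J : nat -> set T) K :
  mu.-integrable setT (EFin \o p) ->
  (forall k, measurable (J k)) -> trivIset setT J ->
  (forall k t, J k t -> `|p t - x k| <= eta) ->
  `|\int[mu]_(t in \big[setU/set0]_(k < K) J k) p t
     - \sum_(k < K) x k * fine (mu (J k))|
  <= eta * \sum_(k < K) fine (mu (J k)).
Proof.
move=> ip mJ tJ pJ; elim: K => [|K ih].
  by rewrite !big_ord0 Rintegral_set0 subr0 normr0 mulr0.
rewrite !big_ord_recr /=.
have mU : measurable (\big[setU/set0]_(k < K) J k) by exact: bigsetU_measurable.
have dUJ : [disjoint \big[setU/set0]_(k < K) J k & J K].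
  apply/disj_set2P; rewrite big_distrl /= big1 // => k _.
  apply/eqP; apply: contraT => /set0P[t [tk tK]].
  by have /eqP := tJ k K I I (ex_intro _ t (conj tk tK)); rewrite ltn_eqF.
have mUJ := measurableU _ _ mU (mJ K).
rewrite Rintegral_setU //; last exact: integrableS ip.
rewrite opprD addrACA mulrDr (le_trans (ler_normD _ _)) // lerD //.
have ipJ : mu.-integrable (J K) (EFin \o p) by exact: integrableS ip.
have ix : forall y : R, mu.-integrable (J K) (EFin \o (fun=> y)).
  by move=> y; apply: integrableS (band_integrable (P := `|y|) _ _).
rewrite -(Rintegral_cst _ (mJ K)) -RintegralB //.
apply: le_trans (le_normr_Rintegral (mJ K) _) _.
  by apply: (@integrableB _ _ _ _ _ (mJ K) (EFin \o p) (EFin \o fun=> x K)).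
rewrite -(Rintegral_cst _ (mJ K)); apply: le_Rintegral => //.
  apply: integrable_norm.
  by apply: (@integrableB _ _ _ _ _ (mJ K) (EFin \o p) (EFin \o fun=> x K)).
by move=> t; exact: pJ.
Qed.

Definition cell (d : R) (k : nat) : set T :=
  C `&` `[- c + k%:R * d, - c + k.+1%:R * d[%classic.

Lemma measurable_cell d k : measurable (cell d k).
Proof. by apply: measurableI; [exact: measurable_band|exact: measurable_itv]. Qed.

Lemma trivIset_cell d : 0 < d -> trivIset setT (cell d).
Proof.
move=> d0; apply/trivIsetP => j k _ _ jk; apply/eqP; apply: contraT.
move=> /set0P[t [[_ /= tj] [_ /= tk]]]; exfalso; move: tj tk.
rewrite !in_itv /= => /andP[j1 j2] /andP[k1 k2].
have lt_k m n : - c + m%:R * d <= t -> t < - c + n.+1%:R * d -> (m <= n)%N.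
  move=> h1 h2; rewrite -ltnS -(ltr_nat R) -(ltr_pM2r d0).
  by have := le_lt_trans h1 h2; rewrite ltrD2l.
by move/eqP: jk; apply; apply/eqP; rewrite eqn_leq (lt_k j k) ?(lt_k k j).
Qed.

Definition ncell (d : R) : nat := (Num.trunc ((c + c) / d)).+1.

Lemma cell_cover d : 0 < d -> \big[setU/set0]_(k < ncell d) cell d k = C.
Proof.
move=> d0; rewrite -bigcup_mkord; apply/seteqP; split; first by move=> t [k _ []].
move=> t Ct; have /andP[t1 t2] := Ct.
have tc0 : 0 <= ((t : R) + c) / d.
  apply: divr_ge0; [by rewrite addrC -lerBlDl sub0r|exact: ltW].
have /andP[h1 h2] := truncn_itv tc0.
exists (Num.trunc (((t : R) + c) / d)).
  by rewrite /= ltnS; apply: le_truncn; rewrite ler_pM2r ?invr_gt0 // lerD2r.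
split=> //=; rewrite in_itv /=.
rewrite [- c + _]addrC lerBlDr -ler_pdivlMr // h1 /=.
by rewrite [- c + _]addrC ltrBrDr -ltr_pdivrMr.
Qed.

Lemma cell_band d k t : 0 < d -> cell d k t ->
  `|- c + k%:R * d| <= c /\ `|(t : R) - (- c + k%:R * d)| <= d.
Proof.
move=> d0 [/andP[t1 t2] /=]; rewrite in_itv /= => /andP[t3 t4].
have kd : 0 <= k%:R * d by rewrite mulr_ge0 // ltW.
move: t4; rewrite -natr1 mulrDl mul1r => t4.
by split; rewrite ler_norml; apply/andP; split; lra.
Qed.

Lemma sum_cell d : 0 < d ->
  \sum_(k < ncell d) fine (mu (cell d k)) = fine (mu setT).
Proof.
move=> d0; have -> : mu setT = mu C.
  have mC := measurable_band; have mC' := measurableC mC.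
  have h : mu (C `|` ~` C) = (mu C + mu (~` C))%E.
    by rewrite measureU // setICr.
  by rewrite -(setUv C) h muC adde0.
rewrite -(cell_cover d0) measure_bigsetU_ord //.
- by rewrite sum_fine // => k _; apply: fin_num_sub; exact: measurable_cell.
- by move=> k; exact: measurable_cell.
- move=> j k _ _ /(trivIset_cell d0 I I); exact: val_inj.
Qed.

Lemma discretize (p : T -> R) (P eta d : R) : 0 < d -> measurable_fun setT p ->
  (forall t, C t -> `|p t| <= P) ->
  (forall k t, cell d k t -> `|p t - p (- c + k%:R * d)| <= eta) ->
  `|\int[mu]_t p t - \sum_(k < ncell d) p (- c + k%:R * d) * fine (mu (cell d k))|
  <= eta * fine (mu setT).
Proof.
move=> d0 mp pP pJ; have ip := band_integrable mp pP.
rewrite -(sum_cell d0).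
have -> : \int[mu]_t p t = \int[mu]_(t in C) p t.
  rewrite /Rintegral (negligible_integral (measurableC measurable_band) _ ip muC) //.
  by rewrite setTD setCK.
rewrite -(cell_cover d0).
apply: (@discretize_rec p eta (fun k => p (- c + k%:R * d)) (cell d) _ ip) => //; last exact: trivIset_cell.
by move=> k; exact: measurable_cell.
Qed.

Lemma pow_lipschitz n : exists2 K : R, 0 <= K &
  forall s t : R, `|s| <= c -> `|t| <= c -> `|s ^+ n - t ^+ n| <= K * `|s - t|.
Proof.
elim: n => [|n [K K0 hK]]; first by exists 0 => // s t _ _; rewrite subrr normr0 mul0r.
exists (`|c| * K + `|c| ^+ n) => [|s t sc tc].
  by rewrite addr_ge0 ?mulr_ge0 ?exprn_ge0.
have -> : s ^+ n.+1 - t ^+ n.+1 = s * (s ^+ n - t ^+ n) + (s - t) * t ^+ n.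
  by rewrite !exprS; ring.
have cc : c <= `|c| by exact: ler_norm.
rewrite (le_trans (ler_normD _ _)) // !normrM mulrDl lerD //.
  by rewrite -mulrA ler_pM // ?hK // (le_trans sc).
by rewrite mulrC ler_wpM2r // normrX lerXn2r ?nnegrE // (le_trans tc).
Qed.

(** The moments of a measure carried by [-c, c] are Riemann sums up to O(d),
because powers are Lipschitz on a bounded set. *)
Lemma discretize_moment n : exists K : R, forall d, 0 < d ->
  `|\int[mu]_t (t : R) ^+ n
    - \sum_(k < ncell d) (- c + k%:R * d) ^+ n * fine (mu (cell d k))| <= K * d.
Proof.
have [K K0 hK] := pow_lipschitz n; exists (K * fine (mu setT)) => d d0.
rewrite mulrAC; apply: (@discretize (fun t => (t : R) ^+ n) (`|c| ^+ n)) => //.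
- move=> t /= tC; rewrite normrX lerXn2r ?nnegrE // (le_trans _ (ler_norm c)) //.
  by rewrite ler_norml.
move=> k t /[dup] ht /(cell_band d0) [h1 h2].
apply: le_trans (hK _ _ _ h1) _; last by rewrite ler_wpM2l.
by case: ht => tC _; rewrite ler_norml.
Qed.

End Discretize.

(** * Elements with a centered free Poisson law *)

(** A self-adjoint operator is bounded by its quadratic form: polarize at u and at
the multiple of a u that has the norm of u. *)
Lemma sym_bound (R : realType) (H : hilbertSpace R) (a : op H) (kap : R) :
  (forall k u v, a (k *: u + v) = k *: a u + a v) -> self_adjoint a ->
  (forall u, `|Re (hdot H (a u) u)| <= kap * hnorm (hdot H) u ^+ 2) ->
  forall u, hnorm (hdot H) (a u) <= kap * hnorm (hdot H) u.
Proof.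
move=> la sa ha u.
have aD v w : a (v + w) = a v + a w by have := la 1 v w; rewrite !scale1r.
have a0 : a 0 = 0 by apply: (addrI (a 0)); rewrite -aD !addr0.
have aN v : a (- v) = - a v by apply: (addrI (a v)); rewrite -aD !subrr.
have [->|u0] := eqVneq u 0; first by rewrite a0 hnorm0 mulr0.
set x := hnorm _ u; set y := hnorm _ (a u).
have x0 : 0 < x.
  by rewrite lt_def hnorm_ge0 andbT; apply: contra u0 => /eqP/hnorm0_eq0 ->.
suff : x * y <= kap * x ^+ 2 by rewrite expr2 mulrCA ler_pM2l.
have [y0|y0] := eqVneq y 0; first by rewrite y0 mulr0 (le_trans _ (ha u)).
pose v := (x / y)%:C *: a u.
have yp : 0 < y by rewrite lt_def y0 hnorm_ge0.
have nv : hnorm (hdot H) v = x.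
  by rewrite /v hnormZr -/y ger0_norm ?divfK // divr_ge0 ?ltW.
have Re_uv : Re (hdot H (a u) v) = x * y.
  rewrite /v hdotZr hdot_norm -/y conjCr -rmorphM /=; field.
  exact: y0.
have := ha (u + v); have := ha (u - v).
rewrite !aD !aN hnormB_sqr hnormD_sqr nv -/x !(hdotDl, hdotDr, hdotNl, hdotNr).
rewrite (sa v u) !(raddfD, raddfN) /= (Re_hdotC v (a u)) Re_uv.
rewrite !ler_norml => /andP[h1 h2] /andP[h3 h4]; lra.
Qed.

Section SpectralLaw.
Context {R : realType} {A : tracialWspace R} {L : L2space A}.
Local Notation T := (measurableTypeR R).
Local Notation M := (@nc_alg R A).
Local Notation phi := (@nc_state R A).
Local Notation "''[' u , v ]" := (hdot (L2hilbert L) u v).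
Local Notation nm := (hnorm (@hdot R (L2hilbert L))).
Local Notation emb := (emb L).
Variables (xi : L) (nu : probability T R) (E : set T -> ncop A)
  (m : L -> {measure set T -> \bar R}) (c : R).
Hypothesis hsa : self_adjoint_graph (affiliated xi).
Hypothesis hspec : spectral_resolution (affiliated xi) E m.
Hypothesis hphi : forall B : set T, measurable B -> phi (E B) = (fine (nu B))%:C.
Hypothesis hc : nu [set t | - c <= (t : R) <= c] = 1%E.
Local Notation C := ([set t | - c <= (t : R) <= c] : set T).
Local Notation omega := (emb id).
Local Notation Q B := (@lact R A L (E B)).

Lemma spec_alg (B : set T) : measurable B -> M (E B).
Proof. by case: hspec => h _ _ _ _ /h[]. Qed.

Lemma spec_adj (B : set T) u v : measurable B -> '[Q B u, v] = '[u, Q B v].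
Proof.
by move=> mB; case: hspec => h _ _ _ _; case: (h B mB) => h1 h2 _; exact: lact_adj.
Qed.

Lemma spec_cap (B B' : set T) u : measurable B -> measurable B' ->
  Q (B `&` B') u = Q B (Q B' u).
Proof.
move=> mB mB'; case: hspec => _ [_ h] _ _ _; rewrite h //.
by apply: lact_comp; exact: spec_alg.
Qed.

Lemma spec_T u : Q setT u = u.
Proof. by case: hspec => _ [-> _] _ _ _; exact: lact_id. Qed.

Lemma spec_measure u (B : set T) : measurable B -> m u B = (nm (Q B u) ^+ 2)%:E.
Proof.
move=> mB; case: hspec => _ _ h _ _; rewrite h //.
by rewrite -{1}(setIid B) spec_cap // spec_adj // hnorm_sqr.
Qed.

Lemma spec_measureT u : m u setT = (nm u ^+ 2)%:E.
Proof. by rewrite spec_measure // spec_T. Qed.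

Lemma spec_measure_fin u : (m u setT < +oo)%E.
Proof. by rewrite spec_measureT ltry. Qed.

Lemma spec_nu (B : set T) : measurable B -> m omega B = nu B.
Proof.
move=> mB; case: hspec => _ _ h _ _; rewrite h //.
have MB := spec_alg mB; have Mid := alg_id (A := A).
rewrite lact_emb // (@embdot _ _ _ _ id id) //=.
by rewrite hphi //= fineK // fin_num_measure.
Qed.

(** A projection of trace zero vanishes, by faithfulness: the whole spectral
measure is carried by [-c, c], not only its trace nu. *)
Lemma spec_band_C u : m u (~` C) = 0%E.
Proof.
have mC : measurable (~` C) by apply: measurableC; exact: measurable_band.
suff E0 : E (~` C) = (fun=> 0).
  rewrite spec_measure // E0 lact_0.
  by rewrite hnorm0 expr0n.
have [h1 h2 h3] : [/\ M (E (~` C)), self_adjoint (E (~` C))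
    & E (~` C) \o E (~` C) = E (~` C)] by case: hspec => h _ _ _ _; exact: h.
apply: (nc_faithful h1 h2); rewrite h3 hphi //.
rewrite probability_setC ?hc; last exact: measurable_band.
by rewrite subee.
Qed.

Lemma band_ge0 : 0 <= c.
Proof.
rewrite leNgt; apply/negP => c0; have : nu (set0 : set T) = 1%E.
  rewrite -hc; congr (nu _); apply/seteqP; split => // t /andP[t1 t2].
  by have := le_trans t1 t2; rewrite lerNl; lra.
by rewrite measure0 => /eqP; rewrite eq_sym onee_eq0.
Qed.

(** On a bounded spectrum t is square-integrable for every m u, so the affiliated
operator is everywhere defined. *)
Lemma spec_dom u : exists v, affiliated xi u v.
Proof.
case: hspec => _ _ _ h _; apply/h.
apply: (@band_ge0_integral_lty _ _ c _ _ (fun t => (t : R) ^+ 2) (c ^+ 2)).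
- exact: spec_measure_fin.
- exact: spec_band_C.
- exact: exprn_measurable.
- by move=> t; exact: sqr_ge0.
- move=> t /= tC; rewrite -ler_norml in tC.
  by rewrite -real_normK ?num_real // lerXn2r ?nnegrE // band_ge0.
Qed.

(** Self-adjointness of the graph makes it the graph of a linear self-adjoint
map: two values over u have the same inner product with every vector. *)
Lemma spec_op_ex : exists f : op L, [/\
  forall u, affiliated xi u (f u),
  forall k u v, f (k *: u + v) = k *: f u + f v,
  self_adjoint f
  & forall u v, affiliated xi u v -> v = f u].
Proof.
have [f Gf] := choice spec_dom; exists f.
have fs u v w : affiliated xi u w -> '[w, v] = '[u, f v].
  by move=> h; exact: ((hsa v (f v)).1 (Gf v)).
split=> //; last 2 first.
- by move=> u v; exact: fs.
- move=> u v Guv; apply: hdot_injl => z; rewrite (fs _ z _ Guv).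
  by rewrite -(fs _ z _ (Gf u)).
move=> k u v; apply: hdot_injl => z.
rewrite (fs _ z _ (Gf _)) !hdotDl !hdotZl.
by rewrite (fs _ z _ (Gf u)) (fs _ z _ (Gf v)).
Qed.

Section Operator.
Variable f : op L.
Hypotheses (Gf : forall u, affiliated xi u (f u))
  (fl : forall k u v, f (k *: u + v) = k *: f u + f v)
  (fs : self_adjoint f).

Lemma spec_form u : Re '[f u, u] = \int[m u]_t (t : R).
Proof. by case: hspec => _ _ _ _ h; rewrite (h _ _ (Gf u)). Qed.

Section Step.
Variables (d : R).
Hypothesis d0 : 0 < d.
Let x k : R := - c + k%:R * d.
Let J k : set T := cell c d k.
Let K := ncell c d.
Let mJ k : measurable (J k) := measurable_cell c d k.

Lemma cell_orth j k u v : j != k -> '[Q (J j) u, Q (J k) v] = 0.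
Proof.
move=> jk; rewrite -spec_adj // -spec_cap //.
have -> : J k `&` J j = set0.
  apply/eqP; apply: contraT => /set0P[t [tk tj]].
  by have := trivIset_cell d0 I I (ex_intro _ t (conj tj tk)) => e; rewrite e eqxx in jk.
suff -> : Q set0 u = 0 by rewrite hdot0l.
by apply: hnorm0_eq0; have := spec_measure u measurable0; rewrite measure0 => -[] /esym/eqP;
  rewrite sqrf_eq0 => /eqP.
Qed.

Lemma cell_comb (a b : nat -> R) u :
  Re '[\sum_(k < K) (a k)%:C *: Q (J k) u, \sum_(k < K) (b k)%:C *: Q (J k) u]
  = \sum_(k < K) a k * b k * fine (m u (J k)).
Proof.
rewrite hdot_suml raddf_sum /=; apply: eq_bigr => j _.
rewrite hdot_sumr (bigD1 j) //= big1 ?addr0; last first.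
  move=> k kj; rewrite hdotZl hdotZr cell_orth ?mulr0 //.
  by apply: contra kj => /eqP e; apply/eqP/val_inj.
rewrite hdotZl hdotZr conjCr hdot_norm -!rmorphM /= spec_measure //= mulrA.
by [].
Qed.

Lemma cell_sum u : \sum_(k < K) (1 : R)%:C *: Q (J k) u = u.
Proof.
apply/esym/eqP; rewrite -subr_eq0; apply/eqP/hnorm0_eq0/eqP; rewrite -sqrf_eq0.
rewrite hnormB_sqr [X in _ + X]hnorm_sqr; have /= -> := cell_comb (fun=> 1) (fun=> 1) u.
have -> : Re '[u, \sum_(k < K) (1 : R)%:C *: Q (J k) u]
          = \sum_(k < K) 1 * 1 * fine (m u (J k)).
  rewrite hdot_sumr raddf_sum /=; apply: eq_bigr => j _.
  rewrite hdotZr conjCr mul1r -{1}(setIid (J j)) spec_cap // -spec_adj //.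
  by rewrite hdot_norm spec_measure //= mul0r subr0.
under eq_bigr do rewrite !mul1r.
rewrite (sum_cell (spec_measure_fin u) (spec_band_C u) d0) spec_measureT /=.
by apply/eqP; ring.
Qed.

(** Step approximation of the integral of t against the spectral measure. *)
Definition riemann_op u : L := \sum_(k < K) (x k)%:C *: Q (J k) u.

Lemma riemann_op_comb (a : nat -> R) u :
  riemann_op (\sum_(k < K) (a k)%:C *: Q (J k) u)
  = \sum_(k < K) (x k * a k)%:C *: Q (J k) u.
Proof.
apply: eq_bigr => j _; rewrite rmorphM -scalerA; congr (_ *: _).
have bQ := lact_bounded L (spec_alg (mJ j)).
rewrite (bop_sum bQ) (bigD1 j) //= big1 ?addr0.
  by rewrite (bopZ bQ) -spec_cap // setIid.
move=> k kj; rewrite (bopZ bQ); apply: hdot_eq0 => v; rewrite hdotZl.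
rewrite spec_adj // cell_orth ?mulr0 //.
Qed.

(** The spectral projections of distinct cells are orthogonal, so powers of the
step operator are computed termwise. *)
Lemma riemann_op_iter n u :
  iter n riemann_op u = \sum_(k < K) (x k ^+ n)%:C *: Q (J k) u.
Proof.
elim: n => [|n ih] /=; first by rewrite -[LHS]cell_sum; apply: eq_bigr => k _; rewrite expr0.
by rewrite ih (riemann_op_comb (fun k => x k ^+ n)); apply: eq_bigr => k _; rewrite exprS.
Qed.

Lemma riemann_op_lin k u v :
  riemann_op (k *: u + v) = k *: riemann_op u + riemann_op v.
Proof.
rewrite /riemann_op scaler_sumr -big_split; apply: eq_bigr => j _ /=.
by rewrite (bopP (lact_bounded L (spec_alg (mJ j)))) scalerDr !scalerA (mulrC k).
Qed.

Lemma riemann_op_sa : self_adjoint riemann_op.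
Proof.
move=> u v; rewrite /riemann_op hdot_suml hdot_sumr; apply: eq_bigr => j _ /=.
by rewrite hdotZl hdotZr conjCr spec_adj.
Qed.

Lemma riemann_op_bound u : nm (riemann_op u) <= c * nm u.
Proof.
rewrite -ler_sqr ?nnegrE ?mulr_ge0 ?hnorm_ge0 ?band_ge0 // hnorm_sqr cell_comb.
have -> : (c * nm u) ^+ 2 = \sum_(k < K) c ^+ 2 * fine (m u (J k)).
  rewrite -mulr_sumr (sum_cell (spec_measure_fin u) (spec_band_C u) d0).
  by rewrite spec_measureT exprMn.
apply: ler_sum => k _.
have [->|/set0P[t tJ]] := eqVneq (J k) set0; first by rewrite measure0 !mulr0.
rewrite ler_wpM2r ?fine_ge0 //.
have [xc _] := cell_band d0 tJ.
by rewrite -expr2 -real_normK ?num_real // lerXn2r ?nnegrE // band_ge0.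
Qed.

(** The quadratic form of the difference is the error of a Riemann sum, at most
d |u|^2, and a self-adjoint operator is controlled by its quadratic form. *)
Lemma riemann_op_approx u : nm (f u - riemann_op u) <= d * nm u.
Proof.
apply: (@sym_bound _ _ (fun u => f u - riemann_op u) d) => [k v w|v w|v].
- by rewrite fl riemann_op_lin opprD addrACA -scalerBr.
- by rewrite hdotBl hdotBr fs riemann_op_sa.
rewrite hdotBl raddfB /= spec_form.
have -> : Re '[riemann_op v, v] = \sum_(k < K) x k * fine (m v (J k)).
  rewrite -[X in '[_, X]]cell_sum; have /= -> := cell_comb x (fun=> 1) v.
  by under eq_bigr do rewrite mulr1.
have := @discretize _ (m v) c (spec_measure_fin v) (spec_band_C v) id c d d d0.
rewrite spec_measureT /=; apply=> //.
  by move=> t tC; rewrite ler_norml.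
by move=> k t /(cell_band d0)[].
Qed.
End Step.

Lemma spec_op_bound u : nm (f u) <= (c + 1) * nm u.
Proof.
have := hnormD (f u - riemann_op 1 u) (riemann_op 1 u); rewrite subrK => h.
apply: (le_trans h); rewrite mulrDl addrC lerD //.
  exact: riemann_op_bound.
exact: riemann_op_approx.
Qed.

Lemma spec_op_iter_approx n : exists2 K : R, 0 <= K & forall d, 0 < d ->
  nm (iter n f omega - iter n (riemann_op d) omega) <= K * d.
Proof.
elim: n => [|n [K K0 hK]].
  by exists 0 => // d d0; rewrite /= subrr hnorm0 mul0r.
have c0 := band_ge0.
exists ((c + 1) * K + c ^+ n) => [|d d0 /=].
  by rewrite addr_ge0 ?mulr_ge0 ?addr_ge0 ?exprn_ge0.
set u := iter n f omega; set v := iter n (riemann_op d) omega.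
have fB a b : f (a - b) = f a - f b.
  by rewrite -scaleN1r addrC fl scaleN1r addrC.
have vn : nm v <= c ^+ n.
  rewrite /v; elim: (n) => [|k ih] /=; first by rewrite hnorm_emb_id.
  rewrite (le_trans (riemann_op_bound d0 _)) // exprS ler_wpM2l //.
apply: le_trans (hnorm_triangle (f v) _ _) _.
rewrite mulrDl lerD // -?fB.
  by rewrite (le_trans (spec_op_bound _)) // -mulrA ler_wpM2l ?addr_ge0 ?hK.
by rewrite (le_trans (riemann_op_approx d0 _)) // mulrC ler_wpM2r // ltW.
Qed.

(** Functional calculus at Omega, restricted to powers: replace the operator by a
step operator, whose moments are Riemann sums for nu, and let d tend to 0. *)
Lemma spec_moment i j :
  Re '[iter i f omega, iter j f omega] = \int[nu]_t (t : R) ^+ (i + j).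
Proof.
have -> : \int[nu]_t (t : R) ^+ (i + j) = \int[m omega]_t (t : R) ^+ (i + j).
  by rewrite /Rintegral; congr fine; apply: eq_measure_integral => B mB _;
    exact/esym/spec_nu.
have [K1 K10 h1] := spec_op_iter_approx i.
have [K2 K20 h2] := spec_op_iter_approx j.
have [K hK] := discretize_moment (spec_measure_fin omega) (spec_band_C omega) (i + j).
set u := iter i f omega in h1 *; set v := iter j f omega in h2 *.
apply: (@complexI R); apply/eqP; rewrite -subr_eq0 -rmorphB; apply/eqP.
pose C' := K1 * nm v + c ^+ i * K2 + K.
apply: (@complex_small _ _ C') => d d0.
rewrite normc_def /= expr0n addr0 sqrtr_sqr lecR.
set u' := iter i (riemann_op d) omega; set v' := iter j (riemann_op d) omega.
have un : nm u' <= c ^+ i.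
  rewrite /u'; elim: (i) => [|k ih] /=; first by rewrite hnorm_emb_id.
  by rewrite (le_trans (riemann_op_bound d0 _)) // exprS ler_wpM2l // band_ge0.
have -> : Re '[u, v] - \int[m omega]_t (t : R) ^+ (i + j)
   = Re '[u - u', v] + Re '[u', v - v']
     - (\int[m omega]_t (t : R) ^+ (i + j) - Re '[u', v']).
  by rewrite hdotBl hdotBr !raddfB /=; ring.
rewrite (le_trans (ler_normB _ _)) // /C' mulrDl lerD //; last first.
  have /= := hK d d0; rewrite /u' /v' !riemann_op_iter //.
  have /= -> := cell_comb d0 (fun k => (- c + k%:R * d) ^+ i)
    (fun k => (- c + k%:R * d) ^+ j) omega.
  by under eq_bigr do rewrite exprD.
rewrite (le_trans (ler_normD _ _)) // mulrDl lerD //.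
  rewrite (le_trans (Re_hdot_le _ _)) // mulrAC ler_wpM2r ?hnorm_ge0 //.
  exact: h1.
rewrite (le_trans (Re_hdot_le _ _)) // -mulrA ler_pM ?hnorm_ge0 //.
exact: h2.
Qed.

End Operator.
End SpectralLaw.

Section LawOfZ.
Context {R : realType} {A : tracialWspace R} {L : L2space A}.
Local Notation M := (@nc_alg R A).
Local Notation "''[' u , v ]" := (hdot (L2hilbert L) u v).
Local Notation nm := (hnorm (@hdot R (L2hilbert L))).

(** With T the bounded operator affiliated with xi one has xi = T Omega, and w is
T xi = T^2 Omega; each claim is then a moment of order at most four of the law. *)
Lemma law_Z_square (xi : L) (lambda : R) : has_law_Z xi lambda ->
  exists w : L, [/\
    forall y, M y -> '[w, emb L y] = '[xi, ract y xi],
    nm xi ^+ 2 = lambda, '[xi, emb L id] = 0,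
    '[w, xi] = lambda%:C & nm (w - xi) ^+ 2 = 2 * lambda ^+ 2].
Proof.
move=> [hsa [nu [[E [m [hspec hphi]]] [[c hc] hcum]]]].
have [m1 m2 m3 m4] := poisson_moments hcum.
have [f [Gf fl fs fE]] := spec_op_ex hsa hspec hphi hc.
have fxi : f (emb L id) = xi.
  rewrite -[RHS]ract_id; apply/esym/fE.
  by apply: affiliated_emb; exact: alg_id.
have mom := spec_moment hspec hphi hc Gf fl fs.
have real_form u : '[f u, u] = (Re '[f u, u])%:C.
  by case: hspec => _ _ _ _ h; rewrite (h _ _ (Gf u)).
exists (f xi); split.
- by move=> y My; rewrite fs -(fE _ _ (affiliated_emb xi My)).
- by rewrite hnorm_sqr -fxi; have /= -> := mom 1 1.
- by rewrite -fxi real_form; have /= -> := mom 1%N 0%N; rewrite m1.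
- by rewrite real_form -fxi; have /= -> := mom 2 1; rewrite m3.
rewrite hnormB_sqr !hnorm_sqr -fxi.
have /= -> := mom 2 2; have /= -> := mom 2 1; have /= -> := mom 1 1.
rewrite m2 m3 m4; ring.
Qed.
End LawOfZ.

(** * Words in free centered letters *)

Lemma opprod_cat (R : realType) (H : hilbertSpace R) (s t : seq (op H)) :
  opprod (s ++ t) = opprod s \o opprod t.
Proof. by elim: s => //= a s ->. Qed.

Section ReducedSeq.
Context {T : eqType}.
Implicit Types s t : seq T.

Definition reduced s := sorted (fun x y => x != y) s.

Definition heads_differ s t :=
  if s is x :: _ then if t is y :: _ then x != y else true else true.

(** [rev s ++ t] is the word of a product of an adjoint and a word: the only new
adjacent pair consists of the two heads. *)
Lemma reduced_catrev s t :
  reduced s -> reduced t -> heads_differ s t -> reduced (rev s ++ t).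
Proof.
elim: s t => [//|x s ih] t rs rt xt.
rewrite rev_cons cat_rcons; apply: ih.
- exact: path_sorted rs.
- by case: t rt xt => //= y t -> ->.
- by case: s rs {xt} => //= y s /andP[+ _]; rewrite eq_sym.
Qed.

Lemma reduced_rev s : reduced (rev s) = reduced s.
Proof.
rewrite /reduced rev_sorted; apply: eq_sorted => x y /=; congr (~~ _); exact: eq_sym.
Qed.

Lemma uniq_reduced s : uniq s -> reduced s.
Proof.
elim: s => // x [//|y s] ih /= /andP[xs us].
by move: xs; rewrite inE negb_or => /andP[-> _] /=; exact: ih.
Qed.
End ReducedSeq.

Section FreeWords.
Context {R : realType} {A : tracialWspace R}.
Local Notation M := (@nc_alg R A).
Local Notation phi := (@nc_state R A).
Context {r : nat} (a : 'I_r -> ncop A).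
Hypothesis Ma : forall k, M (a k).
Hypothesis hfree : freely_independent a.

Lemma gen_star_alg_alg k b : gen_star_alg (a k) b -> M b.
Proof.
elim=> [||l b1 b2 _ h1 _ h2|b1 b2 _ h1 _ h2|b1 b2 _ h1 h12].
- exact: Ma.
- exact: alg_id.
- exact: alg_lin.
- exact: alg_comp.
- by have [b' Mb' /(is_adjoint_uniq h12) ->] := alg_adj h1.
Qed.

Local Notation letter := ('I_r * ncop A)%type.
Implicit Types (s t x y : seq letter).

(** A letter carries its index and an element of the algebra generated by the
variable with that index; the trace of each letter must vanish. *)
Fixpoint centered s : Prop :=
  if s is p :: s' then [/\ gen_star_alg (a p.1) p.2, phi p.2 = 0 & centered s']
  else True.

Definition word s : ncop A := opprod [seq p.2 | p <- s].
Definition idx s : seq 'I_r := [seq p.1 | p <- s].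

Lemma centered_cat s t : centered (s ++ t) <-> centered s /\ centered t.
Proof.
elim: s => [|p s ih] /=; first by split=> [|[]].
by split=> [[h1 h2 /ih[]]//|[[h1 h2 h3] h4]]; split=> //; apply/ih.
Qed.

Lemma centered_rev s : centered (rev s) <-> centered s.
Proof.
elim: s => // p s ih; rewrite rev_cons -cats1.
by split=> [/centered_cat[/ih h []]//|[h1 h2 h3]]; apply/centered_cat; split=> //; apply/ih.
Qed.

Lemma centered_nth s p n : centered s -> (n < size s)%N ->
  gen_star_alg (a (nth p s n).1) (nth p s n).2 /\ phi (nth p s n).2 = 0.
Proof. by elim: s n => // q s ih [|n] /= [h1 h2 h3] //; exact: ih. Qed.

Lemma centered_alg s : centered s -> M (word s).
Proof.
elim: s => [_|p s ih [h1 _ /ih h3]]; first exact: alg_id.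
by apply: alg_comp => //; exact: gen_star_alg_alg h1.
Qed.

Lemma word_cat s t : word (s ++ t) = word s \o word t.
Proof. by rewrite /word map_cat opprod_cat. Qed.

Lemma idx_rev_cat s t : idx (rev s ++ t) = rev (idx s) ++ idx t.
Proof. by rewrite /idx map_cat map_rev. Qed.

Lemma phi_reduced s : centered s -> reduced (idx s) -> s != [::] -> phi (word s) = 0.
Proof.
case: s => // p s cs rs _.
have := hfree (n := size (p :: s)) (i := fun n => (nth p (p :: s) n).1)
  (b := fun n => (nth p (p :: s) n).2) isT.
have -> : mkseq (fun n => (nth p (p :: s) n).2) (size (p :: s)) = [seq q.2 | q <- p :: s].
  by rewrite -[in RHS](mkseq_nth p (p :: s)) /mkseq -map_comp.
apply=> [k kn|k kn]; first exact: centered_nth.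
move: rs; rewrite /reduced /idx /= => /(pathP p.1)/(_ k).
rewrite size_map => /(_ kn) /eqP h e; apply: h.
by rewrite /= (nth_map p) // -e; case: k kn e => //= k kn e; rewrite (nth_map p) // ltnW.
Qed.

(** Peel off the two middle letters b and c.  When their indices differ the whole
word is reduced and has trace zero.  Otherwise b c is its trace plus a centered
letter; the latter gives a reduced word, the former shorter words. *)
Lemma phi_pair s t : centered s -> centered t -> reduced (idx s) -> reduced (idx t) ->
  phi (word (rev s) \o word t) =
  if idx s == idx t then \prod_(p <- zip s t) phi (p.1.2 \o p.2.2) else 0.
Proof.
have cat0 s' t' : centered s' -> centered t' -> reduced (idx s') -> reduced (idx t') ->
    heads_differ (idx s') (idx t') -> s' ++ t' != [::] ->
    phi (word (rev s') \o word t') = 0.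
  move=> cs ct rs rt d n; rewrite -word_cat; apply: phi_reduced.
  - by apply/centered_cat; split=> //; apply/centered_rev.
  - by rewrite idx_rev_cat; exact: reduced_catrev.
  - by rewrite -size_eq0 size_cat size_rev -size_cat size_eq0.
elim: s t => [|[k b] s ih] [|[l c] t] cs ct rs rt.
- by rewrite /= big_nil phi_id.
- by rewrite cat0.
- by rewrite cat0.
have [kl|kl] := eqVneq k l; last first.
  by rewrite cat0 //= -[_ == _]/((k == l) && _) (negPf kl).
subst l; case: cs => /= gb _ cs; case: ct => /= gc _ ct.
have ggc := Gen_mul gb gc; have Mbc := gen_star_alg_alg ggc.
set p := phi (b \o c).
pose e : ncop A := ((- p) \*: id) \+ (b \o c).
have ge : gen_star_alg (a k) e by apply: Gen_lin => //; exact: Gen_one.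
have e0 : phi e = 0 by rewrite /e phi_lin ?phi_id ?mulr1 ?addNr //; exact: alg_id.
have Ms : M (word (rev s)) by apply: centered_alg; apply/centered_rev.
have Mt := centered_alg ct.
have bs : forall u v k', word (rev s) (k' *: u + v) = k' *: word (rev s) u + word (rev s) v.
  by move=> u v k'; exact: (bopP (alg_bounded Ms)).
have -> : word (rev ((k, b) :: s)) \o word ((k, c) :: t)
    = (p \*: (word (rev s) \o word t)) \+ (word (rev s) \o word ((k, e) :: t)).
  rewrite rev_cons -cats1 word_cat; apply/funext => u.
  rewrite /word /e /= -[RHS]bs; congr (word (rev s) _).
  by rewrite addrA scaleNr addrN add0r.
have cet : centered ((k, e) :: t) by [].
rewrite phi_lin; [|exact: alg_comp|by apply: alg_comp => //; exact: centered_alg cet].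
rewrite (cat0 s ((k, e) :: t)) // ?addr0; last 3 first.
- exact: path_sorted rs.
- by case: (s) rs => //= -[m f] s' /= /andP[]; rewrite eq_sym.
- by rewrite -size_eq0 size_cat addnS.
rewrite ih //; last 2 first.
- exact: path_sorted rs.
- exact: path_sorted rt.
rewrite /= eqseq_cons eqxx /= big_cons.
by case: ifP => _; rewrite ?mulr0.
Qed.

Lemma size_idx s : size (idx s) = size s. Proof. exact: size_map. Qed.

Lemma phi_pair_size s t : centered s -> centered t ->
  reduced (idx s) -> reduced (idx t) -> size s <> size t ->
  phi (word (rev s) \o word t) = 0.
Proof.
move=> cs ct rs rt st; rewrite phi_pair //; case: eqP => // e.
by case: st; rewrite -!size_idx e.
Qed.

(** Reducing [rev x ++ y] letter by letter produces words of length at most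
[size x + size y], and strictly less when the heads merge; a reduced word of a
different length is orthogonal to [s]. *)
Lemma phi_triple_short x y s : centered s -> centered x -> centered y ->
  reduced (idx s) -> reduced (idx x) -> reduced (idx y) ->
  (size x + size y <= size s)%N ->
  (size x + size y < size s)%N || ~~ heads_differ (idx x) (idx y) ->
  phi (word (rev s) \o (word (rev x) \o word y)) = 0.
Proof.
have differ x' y' : centered s -> centered x' -> centered y' ->
  reduced (idx s) -> reduced (idx x') -> reduced (idx y') ->
  (size x' + size y' < size s)%N -> heads_differ (idx x') (idx y') ->
  phi (word (rev s) \o (word (rev x') \o word y')) = 0.
  move=> cs cx cy rs rx ry lt d; rewrite -word_cat; apply: phi_pair_size => //.
  - by apply/centered_cat; split=> //; apply/centered_rev.
  - by rewrite idx_rev_cat; exact: reduced_catrev.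
  - by move=> e; move: lt; rewrite e size_cat size_rev ltnn.
move=> cs; elim: x y => [|[k b] x ih] y cx cy rs rx ry le lt.
  by apply: differ => //; move: lt; rewrite orbF.
case: y cy ry le lt => [|[l c] y] cy ry le lt.
  by apply: differ => //; move: lt; rewrite orbF.
have [kl|kl] := eqVneq k l; last first.
  by apply: differ => //; move: lt; rewrite /= kl orbF.
subst l; case: cx => /= gb _ cx; case: cy => /= gc _ cy.
have ggc := Gen_mul gb gc; have Mbc := gen_star_alg_alg ggc.
set p := phi (b \o c).
pose e : ncop A := ((- p) \*: id) \+ (b \o c).
have ge : gen_star_alg (a k) e by apply: Gen_lin => //; exact: Gen_one.
have e0 : phi e = 0 by rewrite /e phi_lin ?phi_id ?mulr1 ?addNr //; exact: alg_id.
have Ms : M (word (rev s)) by apply: centered_alg; apply/centered_rev.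
have Mx : M (word (rev x)) by apply: centered_alg; apply/centered_rev.
have My := centered_alg cy.
have Msx := alg_comp Ms Mx.
have bs : forall u v k', (word (rev s) \o word (rev x)) (k' *: u + v) =
    k' *: (word (rev s) \o word (rev x)) u + (word (rev s) \o word (rev x)) v.
  by move=> u v k'; exact: (bopP (alg_bounded Msx)).
have -> : word (rev s) \o (word (rev ((k, b) :: x)) \o word ((k, c) :: y))
    = (p \*: (word (rev s) \o (word (rev x) \o word y)))
      \+ (word (rev s) \o (word (rev x ++ (k, e) :: y))).
  rewrite rev_cons -cats1 !word_cat; apply/funext => u.
  rewrite /word /e /= -[RHS]bs /=; congr (word (rev s) (word (rev x) _)).
  by rewrite addrA scaleNr addrN add0r.
have cey : centered (rev x ++ (k, e) :: y).
  by apply/centered_cat; split=> //; apply/centered_rev.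
have rx' : reduced (idx x) by exact: path_sorted rx.
have ry' : reduced (idx y) by exact: path_sorted ry.
have le' : (size x + size y < size s)%N.
  by rewrite /= addSn addnS in le; exact: ltnW.
rewrite phi_lin; [|exact: alg_comp (alg_comp _ _)|by apply: alg_comp => //; exact: centered_alg cey].
rewrite ih ?mulr0 ?add0r //; [|exact: ltnW|by rewrite le'].
apply: phi_pair_size => //.
  rewrite idx_rev_cat; apply: reduced_catrev => //.
  by case: (x) rx => //= -[m f] s' /= /andP[]; rewrite eq_sym.
move=> e'; move: le; rewrite e' size_cat size_rev /= addSn addnS.
by rewrite ltnn.
Qed.

Section Letters.
Variable mu : 'I_r -> R[i].
Hypotheses (asa : forall k, self_adjoint (a k)) (phi1 : forall k, phi (a k) = 0)
  (phi2 : forall k, phi (a k \o a k) = mu k)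
  (phi3 : forall k, phi (a k \o (a k \o a k)) = mu k).
Implicit Types (u v w : seq 'I_r) (k : 'I_r).

Definition monom w : ncop A := opprod [seq a k | k <- w].
Definition letters w : seq letter := [seq (k, a k) | k <- w].

Lemma word_letters w : word (letters w) = monom w.
Proof. by rewrite /word /letters -map_comp. Qed.

Lemma idx_letters w : idx (letters w) = w.
Proof. by rewrite /idx /letters -map_comp map_id. Qed.

Lemma size_letters w : size (letters w) = size w.
Proof. exact: size_map. Qed.

Lemma rev_letters w : rev (letters w) = letters (rev w).
Proof. by rewrite /letters map_rev. Qed.

Lemma centered_letters w : centered (letters w).
Proof. by elim: w => //= k w ih; split=> //; exact: Gen_base. Qed.

Lemma monom_alg w : M (monom w).
Proof. by rewrite -word_letters; apply: centered_alg; exact: centered_letters. Qed.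

Lemma monom_cat u v : monom (u ++ v) = monom u \o monom v.
Proof. by rewrite /monom map_cat opprod_cat. Qed.

Lemma monom_adj w : is_adjoint (monom w) (monom (rev w)).
Proof.
elim: w => [|k w ih]; first exact: is_adjoint_id.
rewrite rev_cons -cats1 monom_cat; exact: is_adjoint_comp (asa k) ih.
Qed.

(** Distinct reduced words in the variables are orthogonal, and a word has the
mass of the box it indexes. *)
Lemma phi_monom2 u v : reduced u -> reduced v ->
  phi (monom (rev u) \o monom v) = if u == v then \prod_(k <- u) mu k else 0.
Proof.
move=> ru rv; rewrite -!word_letters -rev_letters phi_pair ?idx_letters //;
  [|exact: centered_letters..].
case: eqP => // <-; rewrite /letters.
elim: u {ru} => [|k u ih] /=; first by rewrite !big_nil.
by rewrite !big_cons ih phi2.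
Qed.

(** With differing heads the product of two words is a reduced word of their total
length; when all the words have the same length q > 0 this says that (I g_l)^* (I g_k) has no
component in the chaos of order q. *)
Lemma phi_monom3 u v w : reduced u -> reduced v -> reduced w ->
  heads_differ v w -> (size v + size w <> size u)%N ->
  phi (monom (rev u) \o (monom (rev v) \o monom w)) = 0.
Proof.
move=> ru rv rw vw /eqP s; rewrite -monom_cat phi_monom2 //; last exact: reduced_catrev.
case: eqP => // e; move: s.
by rewrite e size_cat size_rev eqxx.
Qed.

(** The products u^* u' with differing heads behave as tensors: words of length
2q without cancellation.  On the right the heads may coincide, in which case the
product consists of words shorter than 2q and both sides vanish. *)
Lemma phi_monom4 q u u' v v' :
  [/\ reduced u, reduced u', reduced v & reduced v'] ->
  [/\ size u = q, size u' = q, size v = q & size v' = q] -> (0 < q)%N ->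
  heads_differ u u' ->
  phi ((monom (rev u) \o monom u') \o (monom (rev v') \o monom v)) =
  (if u == v then \prod_(k <- u) mu k else 0) *
  (if u' == v' then \prod_(k <- u') mu k else 0).
Proof.
move=> [ru ru' rv rv'] [su su' sv sv'] q0 d.
have d' : heads_differ u' u.
  by case: (u) (u') d => [|x s] [|y t] //=; rewrite eq_sym.
have e : monom (rev u) \o monom u' = monom (rev (rev u' ++ u)).
  by rewrite rev_cat revK monom_cat.
have rr := reduced_catrev ru' ru d'.
rewrite e; have [vv|vv] := boolP (heads_differ v' v).
  rewrite -[monom (rev v') \o _]monom_cat phi_monom2 ?reduced_catrev //.
  rewrite eqseq_cat ?size_rev ?su' ?sv' // (can_eq revK) andbC.
  case: ifP => [/andP[-> ->]|].
    by rewrite big_cat /= mulrC; congr (_ * _); apply: perm_big; rewrite perm_rev.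
  by case: (u == v); case: (u' == v'); rewrite ?mulr0 ?mul0r.
have -> : (if u == v then \prod_(k <- u) mu k else 0) *
  (if u' == v' then \prod_(k <- u') mu k else 0) = 0.
  case: eqP => [uv|_]; last by rewrite mul0r.
  case: eqP => [uv'|_]; last by rewrite mulr0.
  by move: vv; rewrite -uv -uv' d'.
rewrite -!word_letters -!rev_letters.
apply: phi_triple_short; rewrite ?idx_letters //; try exact: centered_letters.
  by rewrite !size_letters size_cat size_rev su su' sv sv'.
by rewrite vv orbT.
Qed.

(** The only place where the third moment of a letter enters: the last letter of
the word meets the same letter twice and leaves its mass.  Summed over the
atoms of B this restricts the last variable to B. *)
Lemma phi_monom_last q k u v : reduced u -> reduced v -> size u = q -> size v = q ->
  (0 < q)%N ->
  phi (a k \o (monom (rev u) \o monom v)) =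
  if (u == v) && (last k u == k) then \prod_(l <- u) mu l else 0.
Proof.
move=> ru rv su sv q0; case: q q0 su sv => // q _ su sv.
case/lastP: u ru su => // u l ru; rewrite size_rcons => -[su].
rewrite last_rcons.
have [e|lk] := eqVneq l k; last first.
  rewrite andbF.
  have -> : a k \o (monom (rev (rcons u l)) \o monom v)
      = monom (rev (rcons (rcons u l) k)) \o monom v.
    by rewrite (rev_rcons (rcons u l)) /= /monom /=.
  rewrite phi_monom2 //; last first.
    have -> : rcons (rcons u l) k = rev (rev (rcons u l)) ++ [:: k].
      by rewrite revK cats1.
    apply: reduced_catrev; rewrite ?reduced_rev // rev_rcons /=.
    by [].
  case: eqP => // e; move: sv; rewrite -e !size_rcons su => /eqP.
  by rewrite -[X in _ == X]addn0 -addn1 eqn_add2l.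
subst l; rewrite andbT.
(* a k \o a k is its trace plus the centered letter e; the scalar part leaves
   words of lengths q - 1 and q, which are orthogonal *)
pose e : ncop A := ((- mu k) \*: id) \+ (a k \o a k).
have ge : gen_star_alg (a k) e.
  by apply: Gen_lin; [exact: Gen_one|apply: Gen_mul; exact: Gen_base].
have Me := gen_star_alg_alg ge.
have e0 : phi e = 0.
  by rewrite /e phi_lin ?phi_id ?mulr1 ?phi2 ?addNr //; [exact: alg_id|exact: alg_comp].
have ru' : reduced u.
  by move: ru; rewrite -reduced_rev rev_rcons => /path_sorted; rewrite -/(reduced _) reduced_rev.
have Mu := monom_alg (rev u); have Mv := monom_alg v.
have -> : a k \o (monom (rev (rcons u k)) \o monom v)
    = (mu k \*: (monom (rev u) \o monom v)) \+ (e \o (monom (rev u) \o monom v)).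
  rewrite rev_rcons; apply/funext => z; rewrite /e /monom /=.
  by rewrite addrA scaleNr addrN add0r.
rewrite phi_lin; [|exact: alg_comp|by apply: alg_comp => //; exact: alg_comp].
rewrite phi_monom2 //.
have -> : (u == v) = false.
  by apply/eqP => uv; move/eqP: sv; rewrite -uv su -[X in X == _]addn0 -addn1 eqn_add2l.
rewrite mulr0 add0r.
pose s := rcons (letters u) (k, e).
have cs : centered s.
  by rewrite /s -cats1; apply/centered_cat; split; [exact: centered_letters|].
have idxs : idx s = rcons u k by rewrite /idx /s map_rcons -/(idx _) idx_letters.
have -> : e \o (monom (rev u) \o monom v) = word (rev s) \o word (letters v).
  by rewrite /s rev_rcons rev_letters -!word_letters.
rewrite phi_pair ?idxs ?idx_letters //; last exact: centered_letters.
case: eqP => // <-.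
rewrite /letters map_rcons /s zip_rcons ?size_letters //.
rewrite -!cats1 !big_cat !big_seq1 /=; congr (_ * _).
  elim: (u) => [|l w ih] /=; first by rewrite !big_nil.
  by rewrite !big_cons ih phi2.
have -> : e \o a k = ((- mu k) \*: a k) \+ (a k \o (a k \o a k)).
  by apply/funext.
rewrite phi_lin // ?phi1 ?mulr0 ?add0r ?phi3 //.
by apply: alg_comp => //; exact: alg_comp.
Qed.

End Letters.
End FreeWords.

(** * Lebesgue measure on powers of the line *)

Section PowerMeasure.
Context {R : realType}.
Local Notation T := (measurableTypeR R).
Local Notation mu := (@lebesgue_measure R).

Lemma measurable_coord q (i : 'I_q) (B : set T) : measurable B ->
  measurable [set t : q.-tuple T | B (tnth t i)].
Proof. by move=> mB; rewrite -[X in measurable X]setTI; exact: measurable_tnth. Qed.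

Lemma measurable_tuple_forall q (B : 'I_q -> set T) :
  (forall i, measurable (B i)) ->
  measurable [set t : q.-tuple T | forall i, B i (tnth t i)].
Proof.
move=> mB.
have -> : [set t : q.-tuple T | forall i, B i (tnth t i)]
    = \bigcap_(i in [set: 'I_q]) [set t : q.-tuple T | B i (tnth t i)].
  by apply/seteqP; split=> [t h i _|t h i]; exact: h.
apply: fin_bigcap_measurable => // i _; exact: measurable_coord.
Qed.

Lemma orthant_measurable q : measurable (@orthant R q).
Proof.
apply: (@measurable_tuple_forall q (fun=> [set t | 0 <= (t : R)])) => _.
have -> : [set t : T | 0 <= (t : R)] = `[0, +oo[%classic.
  by apply/seteqP; split=> t /=; rewrite in_itv /= andbT.
exact: measurable_itv.
Qed.

Lemma lebesgue_powS q (X : set (q.+1.-tuple T)) :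
  lebesgue_pow R q.+1 X = (lebesgue_pow R q \x mu)%E (@tcons R q @^-1` X).
Proof. by []. Qed.

Lemma lebesgue_pow_cons q (A : set T) (B : set (q.-tuple T)) :
  measurable A -> measurable B ->
  lebesgue_pow R q.+1 [set t | A (thead t) /\ B [tuple of behead t]] =
  (lebesgue_pow R q B * mu A)%E.
Proof.
move=> mA mB; rewrite lebesgue_powS -product_measure1E //; congr (_ _).
apply/seteqP; split=> -[t x] /=; rewrite /tcons theadE /=.
  by move=> [h1]; split=> //; move: b; congr B; apply: val_inj.
by move=> [h1 h2]; split=> //; move: h1; congr B; apply: val_inj.
Qed.

Definition cube q (n : nat) : set (q.-tuple T) :=
  [set t | forall i, 0 <= (tnth t i : R) < n%:R].

Lemma side_measurable (n : nat) : measurable [set x : T | 0 <= (x : R) < n%:R].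
Proof.
have -> : [set x : T | 0 <= (x : R) < n%:R] = `[0, n%:R[%classic.
  by apply/seteqP; split=> t /=; rewrite in_itv.
exact: measurable_itv.
Qed.

Lemma cube_measurable q n : measurable (@cube q n).
Proof.
apply: (@measurable_tuple_forall q (fun=> [set x | 0 <= (x : R) < n%:R])) => _.
exact: side_measurable.
Qed.

Lemma cube_consE q n : @cube q.+1 n =
  [set t | [set x : T | 0 <= (x : R) < n%:R] (thead t) /\ @cube q n [tuple of behead t]].
Proof.
apply/seteqP; split=> t /=.
  move=> h; split; first exact: h.
  by move=> i; rewrite tnth_behead; exact: h.
move=> [h0 h] i; case: (unliftP ord0 i) => [j ->|-> //].
have := h j; rewrite tnth_behead.
suff -> : inord j.+1 = lift ord0 j :> 'I_q.+1 by [].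
by apply: val_inj; rewrite /= inordK // ltnS.
Qed.

Lemma lebesgue_side (n : nat) : mu [set x : T | 0 <= (x : R) < n%:R] = n%:R%:E.
Proof.
have -> : [set x : T | 0 <= (x : R) < n%:R] = `[0, n%:R[%classic.
  by apply/seteqP; split=> t /=; rewrite in_itv.
rewrite lebesgue_measure_itv /= lte_fin.
by case: ltP => // n0; rewrite ?oppr0 ?adde0 ?sube0 //; apply/eqP;
  rewrite eqe eq_le n0 ler0n.
Qed.

Lemma lebesgue_pow_cube q n : lebesgue_pow R q (@cube q n) = (n%:R ^+ q)%:E.
Proof.
elim: q => [|q ih].
  have -> : cube n = [set: 0.-tuple T] by apply/seteqP; split=> // t _ [].
  by rewrite /= diracT.
rewrite cube_consE lebesgue_pow_cons; [|exact: side_measurable|exact: cube_measurable].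
by rewrite ih lebesgue_side -EFinM exprSr.
Qed.

Lemma lebesgue_pow_slab q n (A : set T) : measurable A ->
  lebesgue_pow R q.+1 [set t | A (thead t) /\ @cube q n [tuple of behead t]]
  = ((n%:R ^+ q)%:E * mu A)%E.
Proof.
by move=> mA; rewrite lebesgue_pow_cons ?lebesgue_pow_cube //; exact: cube_measurable.
Qed.

Lemma uniq_measurable q : measurable [set t : q.-tuple T | uniq t].
Proof.
have -> : [set t : q.-tuple T | uniq t] =
    \bigcap_(i in [set: 'I_q]) \bigcap_(j in [set j : 'I_q | i != j])
      [set t : q.-tuple T | (tnth t i - tnth t j : R) != 0].
  apply/seteqP; split=> t /=.
    move=> /tuple_uniqP ut i _ j /= ij; rewrite subr_eq0.
    by apply: contra ij => /eqP/ut ->.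
  move=> h; apply/tuple_uniqP => i j tij; apply/eqP; apply: contraT => ij.
  by have := h i I j ij; rewrite /= tij subrr eqxx.
apply: fin_bigcap_measurable => // i _; apply: fin_bigcap_measurable => // j _.
have mf : measurable_fun setT (fun t : q.-tuple T => (tnth t i - tnth t j : R)).
  by apply: measurable_funB; exact: measurable_tnth.
rewrite -[X in measurable X]setTI.
apply: (mf measurableT [set x : R | x != 0]).
have -> : [set x : R | x != 0] = ~` [set 0].
  by apply/seteqP; split=> x /= /eqP.
by apply: measurableC; exact: measurable_set1.
Qed.

(** For fixed other coordinates, only finitely many values of the new one
create a repetition; hence off-diagonal boxes see almost every point. *)
Lemma lebesgue_pow_not_uniq q :
  lebesgue_pow R q (~` [set t : q.-tuple T | uniq t]) = 0%E.
Proof.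
elim: q => [|q ih].
  have -> : ~` [set t : 0.-tuple T | uniq t] = set0.
    by apply/seteqP; split=> // t; rewrite (tuple0 t) /=.
  exact: measure0.
have mU := @uniq_measurable q; have mU1 := @uniq_measurable q.+1.
have mX : measurable (@tcons R q @^-1` (~` [set t | uniq t])).
  rewrite -[X in measurable X]setTI; apply: (@measurable_tcons R q) => //.
  exact: measurableC.
rewrite lebesgue_powS /= /product_measure1.
rewrite (ge0_negligible_integral (N := ~` [set t : q.-tuple T | uniq t])) //.
- rewrite setTD setCK; apply: integral0_eq => t /= ut.
  apply: (@countable_lebesgue_measure0 R); apply: finite_set_countable.
  apply: (sub_finite_set _ (finite_seq (t : seq R))) => y.
  rewrite /xsection /= inE /= => /negP; rewrite ut andbT negbK.
  by [].
- exact: measurableC.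
- exact: measurable_fun_xsection.
Qed.
End PowerMeasure.

Section SquareIntegrableFunctions.
Context {R : realType} {q : nat}.
Local Notation T := (q.-tuple (measurableTypeR R)).
Local Notation muq := (@lebesgue_pow R q).
Local Notation Dq := (@orthant R q).
Implicit Types (f g : T -> R[i]) (z : R[i]).

Definition normsq z : R := Re z ^+ 2 + Im z ^+ 2.

Lemma normsq_ge0 z : 0 <= normsq z.
Proof. by rewrite addr_ge0 ?sqr_ge0. Qed.

Lemma normsq_eq0 z : (normsq z == 0) = (z == 0).
Proof. by rewrite eq_complex /normsq paddr_eq0 ?sqr_ge0 // !sqrf_eq0. Qed.

Lemma normsqM z z' : normsq (z * z') = normsq z * normsq z'.
Proof. by case: z => a b; case: z' => c d; rewrite /normsq /=; ring. Qed.

Lemma normsqD z z' : normsq (z + z') <= 2 * normsq z + 2 * normsq z'.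
Proof.
case: z => a b; case: z' => c d; rewrite /normsq /= -subr_ge0.
have -> : 2 * (a ^+ 2 + b ^+ 2) + 2 * (c ^+ 2 + d ^+ 2)
   - ((a + c) ^+ 2 + (b + d) ^+ 2) = (a - c) ^+ 2 + (b - d) ^+ 2 by ring.
by rewrite addr_ge0 ?sqr_ge0.
Qed.

Lemma normsq_bool (b : bool) : normsq (b%:R : R[i]) = b%:R.
Proof. by case: b; rewrite /normsq /=; ring. Qed.

Lemma Re_mul_conj z : Re (z * z^*) = normsq z.
Proof. by case: z => a b; rewrite /normsq /=; ring. Qed.

Lemma measurable_normsq f : measurable_complex f ->
  measurable_fun Dq (fun t => (normsq (f t))%:E).
Proof.
move=> [mr mi]; apply/measurable_EFinP.
by apply: measurable_funD; apply: measurable_funX.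
Qed.

Lemma measurable_complex_lin k f g : measurable_complex f -> measurable_complex g ->
  measurable_complex (fun t => k * f t + g t).
Proof.
move=> [fr fi] [gr gi]; split.
- have -> : (fun t => Re (k * f t + g t)) =
      (fun t => Re k * Re (f t) - Im k * Im (f t) + Re (g t)).
    by apply/funext => t; case: k (f t) (g t) => [a b] [c d] [e h] /=.
  by apply: measurable_funD => //; apply: measurable_funB; apply: measurable_funM.
- have -> : (fun t => Im (k * f t + g t)) =
      (fun t => Re k * Im (f t) + Im k * Re (f t) + Im (g t)).
    by apply/funext => t; case: k (f t) (g t) => [a b] [c d] [e h] /=.
  by apply: measurable_funD => //; apply: measurable_funD; apply: measurable_funM.
Qed.

Lemma norm2sqE f : norm2sq f = (\int[muq]_(t in Dq) (normsq (f t))%:E)%E.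
Proof. by []. Qed.

Lemma norm2sq_le f g : measurable_complex f -> measurable_complex g ->
  (forall t, Dq t -> normsq (f t) <= normsq (g t)) ->
  (norm2sq f <= norm2sq g)%E.
Proof.
move=> mf mg fg; apply: ge0_le_integral => //.
- exact: orthant_measurable.
- by move=> t _; rewrite lee_fin normsq_ge0.
- exact: measurable_normsq.
- exact: measurable_normsq.
Qed.

Lemma in_L2_lin k f g : in_L2 f -> in_L2 g -> in_L2 (fun t => k * f t + g t).
Proof.
move=> [mf f2] [mg g2]; split; first exact: measurable_complex_lin.
have mD := @orthant_measurable R q.
pose h t : \bar R := ((2 * normsq k)%:E * (normsq (f t))%:E
   + 2%:E * (normsq (g t))%:E)%E.
have mh1 : measurable_fun Dq (fun t => (2 * normsq k)%:E * (normsq (f t))%:E)%E.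
  by apply: emeasurable_funM => //; exact: measurable_normsq.
have mh2 : measurable_fun Dq (fun t => 2%:E * (normsq (g t))%:E)%E.
  by apply: emeasurable_funM => //; exact: measurable_normsq.
apply: (@le_lt_trans _ _ (\int[muq]_(t in Dq) h t)%E).
  apply: ge0_le_integral => //.
  - by move=> t _; rewrite lee_fin normsq_ge0.
  - by apply: measurable_normsq; exact: measurable_complex_lin.
  - exact: emeasurable_funD.
  move=> t Dt; rewrite /h -!EFinM -EFinD lee_fin.
  by apply: le_trans (normsqD _ _) _; rewrite normsqM mulrA.
rewrite ge0_integralD //; last 2 first.
- by move=> t _; rewrite -EFinM lee_fin !mulr_ge0 ?normsq_ge0.
- by move=> t _; rewrite -EFinM lee_fin !mulr_ge0 ?normsq_ge0.
rewrite !ge0_integralZl //; try exact: measurable_normsq;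
  try by move=> t _; rewrite lee_fin normsq_ge0.
- by rewrite lte_add_pinfty // lte_mul_pinfty // ?lee_fin ?mulr_ge0 ?normsq_ge0.
- by rewrite lee_fin mulr_ge0 ?normsq_ge0.
Qed.

Lemma norm2sq_cube f (C : R) n : measurable_complex f -> 0 <= C ->
  (forall t, Dq t -> normsq (f t) <= C * \1_(@cube R q n) t) ->
  (norm2sq f < +oo)%E.
Proof.
move=> mf C0 fC; have mD := @orthant_measurable R q.
have mc := @cube_measurable R q n.
apply: (@le_lt_trans _ _ (\int[muq]_(t in Dq) (C * \1_(@cube R q n) t)%:E)%E).
  apply: ge0_le_integral => //.
  - by move=> t _; rewrite lee_fin normsq_ge0.
  - exact: measurable_normsq.
  - by apply/measurable_EFinP; apply: measurable_funM => //; exact: measurable_indic.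
under eq_integral do rewrite EFinM.
rewrite ge0_integralZl //; last first.
  by apply/measurable_EFinP; exact: measurable_indic.
rewrite integral_indic // lte_mul_pinfty // ?lee_fin //.
apply: (@le_lt_trans _ _ (muq (@cube R q n))).
  by apply: le_measure; rewrite ?inE //; exact: measurableI.
by rewrite lebesgue_pow_cube ltry.
Qed.

Lemma in_L2_le f g : measurable_complex f -> in_L2 g ->
  (forall t, Dq t -> normsq (f t) <= normsq (g t)) -> in_L2 f.
Proof.
by move=> mf [mg g2] fg; split=> //; apply: le_lt_trans g2; exact: norm2sq_le.
Qed.

Lemma in_L2_0 : in_L2 (fun _ : T => 0 : R[i]).
Proof.
split; first by split; exact: measurable_cst.
rewrite norm2sqE integral0_eq // => t _; rewrite /normsq /=.
by rewrite !expr0n addr0.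
Qed.

Lemma indicC (E : set T) t : \1_E t = (t \in E)%:R :> R[i].
Proof. by []. Qed.

Lemma measurable_complex_indic (E : set T) f : measurable E ->
  measurable_complex f -> measurable_complex (fun t => \1_E t * f t).
Proof.
move=> mE [mr mi]; split.
- have -> : (fun t => Re (\1_E t * f t)) = (fun t => \1_E t * Re (f t)).
    by apply/funext => t; rewrite !indicE; case: (f t) => a b; case: (t \in E) => /=; ring.
  by apply: measurable_funM => //; exact: measurable_indic.
- have -> : (fun t => Im (\1_E t * f t)) = (fun t => \1_E t * Im (f t)).
    by apply/funext => t; rewrite !indicE; case: (f t) => a b; case: (t \in E) => /=; ring.
  by apply: measurable_funM => //; exact: measurable_indic.
Qed.

Lemma measurable_complex_indicator (E : set T) : measurable E ->
  measurable_complex (\1_E : T -> R[i]).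
Proof.
move=> mE; have -> : \1_E = (fun t => \1_E t * 1) :> (T -> R[i]).
  by apply/funext => t; rewrite mulr1.
by apply: measurable_complex_indic => //; split; exact: measurable_cst.
Qed.

Lemma in_L2_indicator (E : set T) n : measurable E -> E `<=` @cube R q n ->
  in_L2 (\1_E : T -> R[i]).
Proof.
move=> mE En; have mf := measurable_complex_indicator mE.
split=> //; apply: (norm2sq_cube (n := n) mf ler01) => t _.
rewrite indicE normsq_bool mul1r indicE; case: (boolP (t \in E)) => // /set_mem/En tn.
by rewrite mem_set.
Qed.

Lemma normsq_indic_le (E : set T) f t : normsq (\1_E t * f t) <= normsq (f t).
Proof.
rewrite indicC normsqM normsq_bool; case: (t \in E); rewrite ?mul1r ?mul0r //.
exact: normsq_ge0.
Qed.

Lemma in_L2_indic (E : set T) f : measurable E -> in_L2 f ->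
  in_L2 (fun t => \1_E t * f t).
Proof.
move=> mE f2; apply: (in_L2_le _ f2) => [|t _]; last exact: normsq_indic_le.
by apply: measurable_complex_indic => //; case: f2.
Qed.

End SquareIntegrableFunctions.

Section Isometry.
Context {R : realType} {A : tracialWspace R} {L : L2space A}.
Variables (N : set (measurableTypeR R) -> ncop A) (q : nat)
  (I : (q.-tuple (measurableTypeR R) -> R[i]) -> L).
Hypothesis hI : multiple_integral N I.
Local Notation T := (q.-tuple (measurableTypeR R)).
Local Notation nm := (hnorm (@hdot R (L2hilbert L))).
Implicit Types f g : T -> R[i].

Lemma int_lin k f g : in_L2 f -> in_L2 g ->
  I (fun t => k * f t + g t) = k *: I f + I g.
Proof. by case: hI => h _ _; exact: h. Qed.

Lemma int_dot f g : in_L2 f -> in_L2 g -> hdot L (I f) (I g) = L2dot f g.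
Proof. by case: hI => _ _; exact. Qed.

Lemma int_0 : I (fun=> 0) = 0.
Proof.
have := int_lin (-1) in_L2_0 in_L2_0.
have -> : (fun t : T => -1 * 0 + 0 : R[i]) = fun=> 0.
  by apply/funext => t; rewrite mulr0 addr0.
by rewrite scaleN1r addNr.
Qed.

Lemma int_B f g : in_L2 f -> in_L2 g -> I (fun t => f t - g t) = I f - I g.
Proof.
move=> f2 g2; have -> : (fun t => f t - g t) = (fun t => -1 * g t + f t).
  by apply/funext => t; rewrite mulN1r addrC.
by rewrite int_lin // scaleN1r addrC.
Qed.

Lemma in_L2_B f g : in_L2 f -> in_L2 g -> in_L2 (fun t => f t - g t).
Proof.
move=> f2 g2; have -> : (fun t => f t - g t) = (fun t => -1 * g t + f t).
  by apply/funext => t; rewrite mulN1r addrC.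
exact: in_L2_lin.
Qed.

Lemma int_norm f : in_L2 f -> (nm (I f) ^+ 2)%:E = norm2sq f.
Proof.
move=> f2; rewrite hnorm_sqr int_dot //= norm2sqE.
under eq_Rintegral do rewrite Re_mul_conj.
rewrite /Rintegral fineK // ge0_fin_numE; first by case: f2.
by apply: integral_ge0 => t _; rewrite lee_fin normsq_ge0.
Qed.

Lemma int_norm_le f g : in_L2 f -> in_L2 g ->
  (forall t, orthant t -> normsq (f t) <= normsq (g t)) ->
  nm (I f) <= nm (I g).
Proof.
move=> f2 g2 fg; rewrite -ler_sqr ?nnegrE ?hnorm_ge0 // -lee_fin !int_norm //.
by apply: norm2sq_le fg; [case: f2|case: g2].
Qed.

End Isometry.

(** * Dyadic grids adapted to a Borel set *)

Section Grid.
Context {R : realType}.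
Local Notation T := (measurableTypeR R).
Local Notation mu := (@lebesgue_measure R).
Variable B : set T.
Hypothesis fB : finite_borel B.

(** The half of the code is the index of the dyadic interval of length 2^-n that
contains t, and its parity tells whether t lies in B; so B is a union of atoms at
every level. *)
Definition code (n : nat) (t : T) : nat :=
  ((Num.trunc (2 ^+ n * (t : R))).*2 + (t \in B))%N.

Definition atom (n k : nat) : set T := [set t | 0 <= (t : R) /\ code n t = k].

(** The codes below this number are those of the points of [0, n[. *)
Definition natoms (n : nat) : nat := (n * 2 ^ n).*2.

(** Passage from a code of level n.+1 to the code of level n of the same point. *)
Definition coarser (k : nat) : nat := ((k./2)./2.*2 + odd k)%N.

Lemma half_code n t : (code n t)./2 = Num.trunc (2 ^+ n * (t : R)).
Proof. by rewrite /code addnC; case: (t \in B); rewrite ?half_bit_double. Qed.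

Lemma odd_code n t : odd (code n t) = (t \in B).
Proof. by rewrite /code oddD odd_double oddb. Qed.

Lemma code_coarser n t : 0 <= (t : R) -> code n t = coarser (code n.+1 t).
Proof.
move=> t0; rewrite /coarser odd_code half_code; congr (_.*2 + _)%N.
set x : R := 2 ^+ n * (t : R).
have x0 : 0 <= x by rewrite mulr_ge0 ?exprn_ge0.
have -> : 2 ^+ n.+1 * (t : R) = 2 * x by rewrite exprS mulrA.
have y0 : 0 <= 2 * x by rewrite mulr_ge0.
have /andP[h1 h2] := truncn_itv y0.
set m := Num.trunc (2 * x) in h1 h2 *.
apply: truncn_def; apply/andP; split.
  have : (m./2.*2)%:R <= 2 * x.
    by apply: le_trans h1; rewrite ler_nat -[leqRHS]odd_double_half leq_addl.
  rewrite -muln2 natrM; lra.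
have : 2 * x < (m./2.+1.*2)%:R.
  apply: lt_le_trans h2 _; rewrite ler_nat -[m in leqLHS]odd_double_half.
  by case: (odd m); rewrite doubleS ?add1n ?add0n // ltnW.
rewrite -muln2 natrM; lra.
Qed.

Lemma code_lt n t : 0 <= (t : R) -> (code n t < natoms n)%N = ((t : R) < n%:R).
Proof.
move=> t0; have x0 : 0 <= 2 ^+ n * (t : R) by rewrite mulr_ge0 ?exprn_ge0.
have -> : (code n t < natoms n)%N = (Num.trunc (2 ^+ n * (t : R)) < n * 2 ^ n)%N.
  rewrite /code /natoms; case: (t \in B); rewrite ?addn0 ?ltn_double //.
  by rewrite addn1 -ltn_double; apply/idP/idP; lia.
rewrite truncn_lt_nat // natrM natrX mulrC ltr_pM2r ?exprn_gt0 //.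
Qed.

Lemma atomE n k : atom n k =
  `[(k./2)%:R / 2 ^+ n, (k./2).+1%:R / 2 ^+ n[%classic `&` (if odd k then B else ~` B).
Proof.
have p0 : 0 < 2 ^+ n :> R by rewrite exprn_gt0.
apply/seteqP; split=> t.
  move=> [t0 ck]; have x0 : 0 <= 2 ^+ n * (t : R) by rewrite mulr_ge0 ?exprn_ge0.
  split.
    rewrite /= in_itv /= ler_pdivrMr // ltr_pdivlMr // mulrC -ck half_code.
    exact: truncn_itv.
  rewrite -ck odd_code; case: ifPn => [|]; first by rewrite inE.
  by rewrite notin_setE.
move=> [/=]; rewrite in_itv /= ler_pdivrMr // ltr_pdivlMr // => /andP[h1 h2] tB.
have t0 : 0 <= (t : R) by rewrite -(pmulr_lge0 _ p0) (le_trans _ h1).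
split=> //; rewrite /code (_ : Num.trunc _ = k./2); last first.
  by apply: truncn_def; rewrite mulrC h1.
rewrite -[RHS]odd_double_half addnC; congr (_ + _)%N.
by move: tB; case: (odd k) => tB; [rewrite mem_set|rewrite memNset].
Qed.

Lemma atom_measurable n k : measurable (atom n k).
Proof.
rewrite atomE; apply: measurableI; first exact: measurable_itv.
by case: fB => mB _ _; case: ifP => // _; exact: measurableC.
Qed.

Lemma atom_le n k : (mu (atom n k) <= ((2 ^+ n)^-1)%:E)%E.
Proof.
apply: (@le_trans _ _ (mu `[(k./2)%:R / 2 ^+ n, (k./2).+1%:R / 2 ^+ n[%classic)).
  apply: le_measure; rewrite ?inE; first exact: atom_measurable.
    exact: measurable_itv.
  by rewrite atomE; exact: subIsetl.
rewrite lebesgue_measure_itv /= lte_fin.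
have p0 : 0 < (2 ^+ n)^-1 :> R by rewrite invr_gt0 exprn_gt0.
case: ifP => _; last by rewrite lee_fin ltW.
by rewrite -EFinB lee_fin -mulrBl -natr1 addrAC subrr add0r mul1r.
Qed.

Lemma atom_finite n k : finite_borel (atom n k).
Proof.
split; first exact: atom_measurable; first by move=> t [].
by apply: le_lt_trans (atom_le n k) _; rewrite ltry.
Qed.

Lemma atom_disj n k l : k != l -> atom n k `&` atom n l = set0.
Proof.
move=> /eqP kl; apply/eqP; apply: contraT => /set0P[t [[_ h] [_ h']]].
by case: kl; rewrite -h.
Qed.

End Grid.

Section PoissonLetters.
Context {R : realType} {A : tracialWspace R} (L : L2space A).
Local Notation T := (measurableTypeR R).
Local Notation phi := (@nc_state R A).
Variables (N : set T -> ncop A).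
Hypothesis hN : free_poisson_measure L N.

Lemma fpm_alg C : finite_borel C -> nc_alg (N C).
Proof. by case: hN => h _ _ _ _ /h[]. Qed.

Lemma fpm_sa C : finite_borel C -> self_adjoint (N C).
Proof. by case: hN => h _ _ _ _ /h[]. Qed.

(** The second and the third moment of a centered Poisson variable are both its
parameter; for a null set the variable is zero. *)
Lemma fpm_moments C : finite_borel C ->
  [/\ phi (N C) = 0, phi (N C \o N C) = (fine (lebesgue_measure C))%:C
    & phi (N C \o (N C \o N C)) = (fine (lebesgue_measure C))%:C].
Proof.
move=> fC; have Mid := @alg_id R A; have MC := fpm_alg fC; have sC := fpm_sa fC.
case: (hN) => _ law null _ _.
have [C0|C0] := eqVneq (lebesgue_measure C) 0%E.
  by rewrite null // C0 /=; split; exact: phi_0.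
have C1 : (0 < lebesgue_measure C)%E by rewrite lt0e C0 measure_ge0.
have [w [hw h2 h1 h3 _]] := law_Z_square (law C fC C1).
have p1 : phi (N C) = 0.
  by have := embdot L MC Mid (@is_adjoint_id _ _); rewrite h1 => <-.
have p2 : phi (N C \o N C) = (fine (lebesgue_measure C))%:C.
  by rewrite -(embdot L MC MC sC) hdot_norm h2.
split=> //; rewrite -h3 hw // ract_emb //.
rewrite (embdot L MC (alg_comp MC MC) (is_adjoint_comp sC sC)).
by [].
Qed.
End PoissonLetters.

(** * Simple functions off the diagonals *)

Section Simple.
Context {R : realType} {A : tracialWspace R} {L : L2space A}.
Local Notation T := (measurableTypeR R).
Local Notation M := (@nc_alg R A).
Local Notation phi := (@nc_state R A).
Local Notation "''[' u , v ]" := (hdot (L2hilbert L) u v).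
Local Notation nm := (hnorm (@hdot R (L2hilbert L))).
Local Notation emb := (emb L).
Variables (N : set T -> ncop A) (hN : free_poisson_measure L N).
Variables (p : nat) (I : (p.+1.-tuple T -> R[i]) -> L) (hI : multiple_integral N I).
Variables (B : set T) (fB : finite_borel B).
Local Notation q := p.+1.
Local Notation tup := (q.-tuple T).
Implicit Types (f g : tup -> R[i]) (a b c : ncop A) (P : pred nat).

Definition aop n (k : 'I_(natoms n)) : ncop A := N (atom B n k).
Definition amass n (k : 'I_(natoms n)) : R[i] :=
  (fine (lebesgue_measure (atom B n k)))%:C.

Definition mon n (w : seq 'I_(natoms n)) : ncop A := monom (@aop n) w.

Let aop_alg n k : M (@aop n k) := fpm_alg hN (atom_finite fB n k).
Let aop_sa n k : self_adjoint (@aop n k) := fpm_sa hN (atom_finite fB n k).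
Let aop_free n : freely_independent (@aop n).
Proof.
case: hN => _ _ _ h _; apply: h => [k|k l kl]; first exact: atom_finite.
exact: atom_disj.
Qed.
Let aop1 n k : phi (@aop n k) = 0.
Proof. by case: (fpm_moments hN (atom_finite fB n k)). Qed.
Let aop2 n k : phi (@aop n k \o @aop n k) = amass k.
Proof. by case: (fpm_moments hN (atom_finite fB n k)). Qed.
Let aop3 n k : phi (@aop n k \o (@aop n k \o @aop n k)) = amass k.
Proof. by case: (fpm_moments hN (atom_finite fB n k)). Qed.

Let mon_alg n (w : seq 'I_(natoms n)) : M (mon w).
Proof. exact: (monom_alg (@aop_alg n)). Qed.
Let mon_adj n (w : seq 'I_(natoms n)) : is_adjoint (mon w) (mon (rev w)).
Proof. exact: (monom_adj (@aop_sa n)). Qed.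

Definition box n (w : q.-tuple 'I_(natoms n)) : tup -> R[i] :=
  fun t => \prod_(i < q) \1_(atom B n (tnth w i)) (tnth t i).

(** A combination of off-diagonal grid boxes is carried together with the
combination of products of the N (atom) that its integral is, and with the
adjoint of that operator, so that traces can be computed by induction.  The
predicate P constrains the code of the first variable: disjoint predicates
guarantee that no cancellation occurs between first letters. *)
Inductive simple (n : nat) P : (tup -> R[i]) -> ncop A -> ncop A -> Prop :=
| simple_0 : simple n P (fun=> 0) (fun=> 0) (fun=> 0)
| simple_box (w : q.-tuple 'I_(natoms n)) : uniq w -> P (thead w) ->
    simple n P (box w) (mon w) (mon (rev w))
| simple_lin (k : R[i]) f g a a' b b' : simple n P f a a' -> simple n P g b b' ->
    simple n P (fun t => k * f t + g t) ((k \*: a) \+ b) ((k^* \*: a') \+ b').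

Definition simplef n P f := exists a a', simple n P f a a'.

Definition boxset n (w : q.-tuple 'I_(natoms n)) : set tup :=
  [set t | forall i, atom B n (tnth w i) (tnth t i)].

Lemma boxE n (w : q.-tuple 'I_(natoms n)) t : box w t = \1_(boxset w) t.
Proof.
rewrite /box indicE; case: (boolP (t \in boxset w)) => [|tw].
  rewrite inE => tw; apply: big1 => i _; rewrite indicE mem_set //; exact: tw.
apply/eqP; rewrite prodf_seq_eq0; apply/hasP.
have [i ti] : exists i, ~ atom B n (tnth w i) (tnth t i).
  apply/existsNP => h; move: tw; rewrite notin_setE; apply; exact: h.
exists i; first exact: mem_index_enum.
by rewrite /= indicE memNset.
Qed.

Lemma box_eq1 n (w : q.-tuple 'I_(natoms n)) t : boxset w t -> box w t = 1.
Proof. by move=> h; rewrite boxE indicE mem_set. Qed.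

Lemma box_eq0 n (w : q.-tuple 'I_(natoms n)) t : ~ boxset w t -> box w t = 0.
Proof. by move=> h; rewrite boxE indicE memNset. Qed.

Lemma boxset_measurable n (w : q.-tuple 'I_(natoms n)) : measurable (boxset w).
Proof.
apply: (@measurable_tuple_forall _ _ (fun i => atom B n (tnth w i))) => i.
exact: atom_measurable.
Qed.

Lemma boxset_cube n (w : q.-tuple 'I_(natoms n)) : boxset w `<=` @cube R q n.
Proof.
move=> t tw i; have [t0 tc] := tw i; rewrite t0 /= -(code_lt B) // tc.
exact: ltn_ord.
Qed.

Lemma simple_bound n P f a a' : simple n P f a a' ->
  exists2 C : R, 0 <= C & forall t, normsq (f t) <= C * \1_(@cube R q n) t.
Proof.
elim=> [|w uw Pw|k f1 g1 a1 a1' b1 b1' _ [C C0 hC] _ [D D0 hD]].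
- by exists 0 => // t; rewrite mul0r /normsq /= expr0n addr0.
- exists 1 => // t; rewrite boxE mul1r indicC normsq_bool indicE.
  case: (boolP (t \in boxset w)) => // /set_mem/boxset_cube tw.
  by rewrite mem_set.
exists (2 * normsq k * C + 2 * D) => [|t].
  by rewrite addr_ge0 ?mulr_ge0 ?normsq_ge0.
apply: le_trans (normsqD _ _) _; rewrite normsqM [leRHS]mulrDl; apply: lerD.
  by rewrite -!mulrA !ler_wpM2l ?normsq_ge0.
by rewrite -mulrA ler_wpM2l.
Qed.

Lemma simple_L2 n P f a a' : simple n P f a a' -> in_L2 f.
Proof.
move=> sf; have [C C0 hC] := simple_bound sf.
have mf : measurable_complex f.
  elim: sf => [|w uw Pw|k f1 g1 a1 a1' b1 b1' _ h _ h'].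
  - by split; exact: measurable_cst.
  - have -> : box w = \1_(boxset w) by apply/funext => t; exact: boxE.
    exact: measurable_complex_indicator (boxset_measurable w).
  - exact: measurable_complex_lin.
by split=> //; apply: (norm2sq_cube mf C0) => t _; exact: hC.
Qed.

Lemma simple_alg n P f a a' : simple n P f a a' -> [/\ M a, M a' & is_adjoint a a'].
Proof.
elim=> [|w uw Pw|k f1 g1 a1 a1' b1 b1' _ [h1 h2 h3] _ [h4 h5 h6]].
- by split; [exact: alg_0|exact: alg_0|move=> u v; rewrite hdot0l hdot0r].
- by split; [exact: mon_alg|exact: mon_alg|exact: mon_adj].
- by split; [exact: alg_lin|exact: alg_lin|exact: is_adjoint_lin].
Qed.

Lemma simple_emb n P f a a' : simple n P f a a' -> I f = emb a.
Proof.
elim=> [|w uw Pw|k f1 g1 a1 a1' b1 b1' s1 h1 s2 h2].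
- by rewrite (int_0 hI) emb_0.
- have fa i : finite_borel (atom B n (tnth w i)) by exact: atom_finite.
  have da (i j : 'I_q) : i != j ->
      atom B n (tnth w i) `&` atom B n (tnth w j) = set0.
    move=> ij; apply: atom_disj; apply: contra ij => /eqP e.
    by apply/eqP; move/tuple_uniqP: uw; apply; exact: val_inj.
  case: (hI) => _ h _; rewrite -[LHS]/(I (box w)) /box (h _ fa da); congr (emb _).
  by rewrite /mon /monom -[in RHS](map_tnth_enum w) -map_comp.
- by rewrite (int_lin hI) ?h1 ?h2 ?emb_lin //; [case: (simple_alg s1)|case: (simple_alg s2)|
    exact: simple_L2 s1|exact: simple_L2 s2].
Qed.

(** The operator is determined by the function, although the decomposition into
boxes is not; this frees the induction from a choice of decomposition. *)
Lemma simple_uniq n P n' P' f a a' b b' :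
  simple n P f a a' -> simple n' P' f b b' -> a = b /\ a' = b'.
Proof.
move=> s1 s2; have [Ma Ma' aa'] := simple_alg s1; have [Mb Mb' bb'] := simple_alg s2.
have ab : a = b by apply: (emb_inj (L := L)) => //; rewrite -(simple_emb s1) -(simple_emb s2).
by split=> //; subst b; exact: is_adjoint_uniq aa' bb'.
Qed.

Lemma simplef_simple n P n' P' f a a' :
  simple n P f a a' -> simplef n' P' f -> simple n' P' f a a'.
Proof. by move=> s [b [b' s']]; have [-> ->] := simple_uniq s s'. Qed.

Lemma simplef_0 n P : simplef n P (fun=> 0).
Proof. by exists (fun=> 0), (fun=> 0); exact: simple_0. Qed.

Lemma simplef_lin n P k f g : simplef n P f -> simplef n P g ->
  simplef n P (fun t => k * f t + g t).
Proof.
by move=> [a [a' sa]] [b [b' sb]]; eexists; eexists; exact: simple_lin sa sb.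
Qed.

Lemma simplef_sum n P (J : Type) (s : seq J) (Q : pred J) (c : J -> R[i])
  (F : J -> tup -> R[i]) : (forall j, Q j -> simplef n P (F j)) ->
  simplef n P (fun t => \sum_(j <- s | Q j) c j * F j t).
Proof.
move=> h; elim: s => [|j s ih].
  have -> : (fun t => \sum_(j <- [::] | Q j) c j * F j t) = (fun=> 0).
    by apply/funext => t; rewrite big_nil.
  exact: simplef_0.
have [Qj|nQj] := boolP (Q j).
  have -> : (fun t => \sum_(i <- j :: s | Q i) c i * F i t)
     = (fun t => c j * F j t + \sum_(i <- s | Q i) c i * F i t).
    by apply/funext => t; rewrite big_cons Qj.
  by apply: simplef_lin => //; exact: h.
have -> // : (fun t => \sum_(i <- j :: s | Q i) c i * F i t)
     = (fun t => \sum_(i <- s | Q i) c i * F i t).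
by apply/funext => t; rewrite big_cons (negPf nQj).
Qed.

Lemma simplef_boxes n P (c : q.-tuple 'I_(natoms n) -> R[i]) :
  simplef n P (fun t => \sum_(w : q.-tuple 'I_(natoms n) | uniq w && P (thead w))
    c w * box w t).
Proof.
apply: simplef_sum => w /andP[uw Pw]; exists (mon w), (mon (rev w)).
exact: simple_box.
Qed.

Lemma boxes_codes n (t : tup) : @cube R q n t ->
  exists w : q.-tuple 'I_(natoms n), boxset w t.
Proof.
move=> ct; have h i : (code B n (tnth t i) < natoms n)%N.
  by have /andP[t0 tn] := ct i; rewrite code_lt.
exists [tuple Ordinal (h i) | i < q] => i; rewrite tnth_mktuple.
by have /andP[t0 _] := ct i.
Qed.

Lemma boxset_inj n (w w' : q.-tuple 'I_(natoms n)) t :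
  boxset w t -> boxset w' t -> w = w'.
Proof.
move=> h h'; apply: eq_from_tnth => i; apply: val_inj.
by have [_ e1] := h i; have [_ e2] := h' i; rewrite /= -e1 -e2.
Qed.

(** A point lies in at most one box of a given level. *)
Lemma boxes_eval n (Q : pred (q.-tuple 'I_(natoms n))) (c : q.-tuple 'I_(natoms n) -> R[i])
  w t : boxset w t ->
  \sum_(v | Q v) c v * box v t = if Q w then c w else 0.
Proof.
move=> tw; have other v : v != w -> box v t = 0.
  by move=> vw; apply: box_eq0 => tv; case/eqP: vw; exact: boxset_inj tv tw.
case: ifPn => Qw.
  rewrite (bigD1 w) //= big1 ?addr0 ?box_eq1 ?mulr1 // => v /andP[_ vw].
  by rewrite other ?mulr0.
by apply: big1 => v Qv; rewrite other ?mulr0 //; apply: contra Qw => /eqP <-.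
Qed.

Lemma boxes_out n (Q : pred (q.-tuple 'I_(natoms n))) (c : q.-tuple 'I_(natoms n) -> R[i])
  t : ~ @cube R q n t -> \sum_(v | Q v) c v * box v t = 0.
Proof.
by move=> h; apply: big1 => v _; rewrite box_eq0 ?mulr0 // => /boxset_cube.
Qed.

(** An off-diagonal box splits into the boxes of the next level that lie in it,
and these are off-diagonal as well. *)
Lemma simple_refine n P f a a' : simple n P f a a' ->
  simple n.+1 (P \o coarser) f a a'.
Proof.
elim=> [|w uw Pw|k f1 g1 a1 a1' b1 b1' _ h1 _ h2]; [exact: simple_0| |exact: simple_lin].
apply: simplef_simple (simple_box uw Pw) _.
pose Q (v : q.-tuple 'I_(natoms n.+1)) := [forall i, coarser (tnth v i) == tnth w i].
have := @simplef_boxes n.+1 (P \o coarser) (fun v => (Q v)%:R).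
have -> // : (fun t => \sum_(v : q.-tuple 'I_(natoms n.+1) | uniq v && (P \o coarser) (thead v))
   (Q v)%:R * box v t) = box w.
apply/funext => t; have [ct|nct] := pselect (@cube R q n.+1 t); last first.
  rewrite boxes_out // box_eq0 // => /boxset_cube ct; apply: nct => i.
  have /andP[-> h] := ct i; rewrite (lt_le_trans h) // ler_nat.
  by [].
have [v tv] := boxes_codes ct; rewrite (boxes_eval _ _ tv).
have codes i : code B n (tnth t i) = coarser (tnth v i).
  by have [t0 tc] := tv i; rewrite -tc code_coarser.
have Qv : Q v -> boxset w t.
  by move=> /forallP h i; have [t0 _] := tv i; split=> //; rewrite codes; exact/eqP/h.
have vQ : boxset w t -> Q v.
  by move=> tw; apply/forallP => i; have [_ e] := tw i; apply/eqP; rewrite -e codes.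
have [Qv'|nQv] := boolP (Q v); last first.
  by rewrite box_eq0 ?if_same // => /vQ; exact/negP.
rewrite (box_eq1 (Qv Qv')); case: ifPn => //; rewrite negb_and => /orP[|].
  move/negP; case; apply/tuple_uniqP => i j e.
  have /tuple_uniqP := uw; apply; apply: val_inj.
  have /forallP h := Qv'; have /eqP e1 := h i; have /eqP e2 := h j.
  by rewrite /= -e1 -e2 e.
by have /forallP/(_ ord0)/eqP e := Qv'; rewrite /= /thead e Pw.
Qed.

Lemma simple_refineD n j P f a a' : simple n P f a a' ->
  simple (n + j) (P \o iter j coarser) f a a'.
Proof.
elim: j P n => [|j ih] P n s; first by rewrite addn0.
rewrite addnS.
have := simple_refine (ih _ _ s).
have -> // : (P \o iter j coarser) \o coarser = P \o iter j.+1 coarser.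
by apply/funext => k /=; rewrite -iterS iterSr.
Qed.

(** Multiplication by the indicator of an atom in the first variable keeps the
boxes whose first letter is that atom. *)
Lemma simple_slab n P f a a' k : simple n P f a a' ->
  simplef n (pred1 k) (fun t => \1_(atom B n k) (thead t) * f t).
Proof.
elim=> [|w uw Pw|l f1 g1 a1 a1' b1 b1' _ h1 _ h2].
- have -> : (fun t : tup => \1_(atom B n k) (thead t) * (0 : R[i])) = (fun=> 0).
    by apply/funext => t; rewrite mulr0.
  exact: simplef_0.
- have [wk|wk] := eqVneq (thead w : nat) k.
    have -> : (fun t : tup => \1_(atom B n k) (thead t) * box w t) = box w.
      apply/funext => t; have [tw|tw] := pselect (boxset w t); last by rewrite box_eq0 ?mulr0.
      by rewrite indicE -wk mem_set ?mul1r //; exact: tw.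
    by exists (mon w), (mon (rev w)); apply: simple_box => //; exact/eqP.
  have -> : (fun t : tup => \1_(atom B n k) (thead t) * box w t) = (fun=> 0).
    apply/funext => t; have [tw|tw] := pselect (boxset w t); last by rewrite box_eq0 ?mulr0.
    rewrite indicE memNset ?mul0r // => -[_ e]; have [_ e'] := tw ord0.
    by case/eqP: wk; rewrite /thead -e -e'.
  exact: simplef_0.
- have -> : (fun t : tup => \1_(atom B n k) (thead t) * (l * f1 t + g1 t)) =
    (fun t => l * (\1_(atom B n k) (thead t) * f1 t) + \1_(atom B n k) (thead t) * g1 t).
    by apply/funext => t; rewrite mulrDr mulrCA.
  exact: simplef_lin.
Qed.

(** The part of order q of the product of I_q(f) and N(B). *)
Definition lastB f : tup -> R[i] := fun t => \1_B (tnth t ord_max) * f t.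

Lemma lastB_box n (w : q.-tuple 'I_(natoms n)) :
  lastB (box w) = if odd (tnth w ord_max) then box w else (fun=> 0).
Proof.
apply/funext => t; rewrite /lastB.
have [tw|tw] := pselect (boxset w t); last first.
  by rewrite box_eq0 // mulr0; case: ifP => // _; rewrite box_eq0.
have [_ <-] := tw ord_max; rewrite odd_code indicE box_eq1 //.
by case: (_ \in B); rewrite ?mul1r ?mul0r ?box_eq1.
Qed.

Lemma lastB_L2 f : in_L2 f -> in_L2 (lastB f).
Proof.
move=> f2; have := in_L2_indic (measurable_coord ord_max (let: And3 h _ _ := fB in h)) f2.
by congr in_L2; apply/funext => t; rewrite /lastB !indicE.
Qed.

Lemma lastB_lin k f g :
  lastB (fun t => k * f t + g t) = fun t => k * lastB f t + lastB g t.
Proof. by apply/funext => t; rewrite /lastB mulrDr mulrCA. Qed.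

Lemma lastB_le f : in_L2 f -> nm (I (lastB f)) <= nm (I f).
Proof.
move=> f2; apply: (int_norm_le hI (lastB_L2 f2) f2) => t _.
rewrite /lastB normsqM indicE normsq_bool.
by case: (_ \in B); rewrite ?mul1r ?mul0r ?normsq_ge0.
Qed.

Lemma thead_differ n (v w : q.-tuple 'I_(natoms n)) :
  thead v != thead w -> heads_differ (v : seq _) w.
Proof. by case/tupleP: v => x v; case/tupleP: w => y w; rewrite !theadE. Qed.

Lemma simple_orth n P P' f a a' g c c' : (forall k, P k -> ~~ P' k) ->
  simple n P f a a' -> simple n P' g c c' -> '[emb a, emb c] = 0.
Proof.
move=> PP' sa sc; elim: sa => [|w uw Pw|k f1 g1 a1 a1' b1 b1' s1 h1 s2 h2].
- by rewrite emb_0 hdot0l.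
- elim: sc => [|v uv Pv|k f1 g1 a1 a1' b1 b1' s1 h1 s2 h2].
  + by rewrite emb_0 hdot0r.
  + rewrite (embdot L (mon_alg w) (mon_alg v) (mon_adj v)).
    rewrite (phi_monom2 (@aop_alg n) (@aop_free n) (@aop1 n) (@aop2 n)) ?uniq_reduced //.
    case: eqP => // /val_inj vw; subst v; by have := PP' _ Pw; rewrite Pv.
  + have [M1 _ _] := simple_alg s1; have [M2 _ _] := simple_alg s2.
    by rewrite emb_lin // hdotDr hdotZr h1 h2 mulr0 addr0.
- have [M1 _ _] := simple_alg s1; have [M2 _ _] := simple_alg s2.
  by rewrite emb_lin // hdotDl hdotZl h1 h2 mulr0 addr0.
Qed.

(** Multilinear form of [phi_monom4]: (I e)^* (I h) behaves as the tensor product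
of h and the conjugate of e when their first variables range over disjoint sets.
The condition on one side suffices. *)
Lemma simple_tensor n P P' Q Q' f a a' g b b' h c c' e d d' :
  (forall k, P k -> ~~ P' k) ->
  simple n Q f a a' -> simple n Q' g b b' ->
  simple n P h c c' -> simple n P' e d d' ->
  '[lact b' (emb a), lact d' (emb c)] = '[emb a, emb c] * '[emb d, emb b].
Proof.
move=> PP' sa sb sc sd.
have [_ Mb' _] := simple_alg sb; have [_ Md' _] := simple_alg sd.
elim: sa => [|u uu Pu|k f1 g1 a1 a1' b1 b1' s1 h1 s2 h2]; last 1 first.
- have [M1 _ _] := simple_alg s1; have [M2 _ _] := simple_alg s2.
  rewrite emb_lin // (bopP (lact_bounded L Mb')) !hdotDl !hdotZl h1 h2; ring.
- by rewrite emb_0 (bop0 (lact_bounded L Mb')) !hdot0l mul0r.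
elim: sc => [|w uw Pw|k f1 g1 a1 a1' b1 b1' s1 h1 s2 h2]; last 1 first.
- have [M1 _ _] := simple_alg s1; have [M2 _ _] := simple_alg s2.
  rewrite emb_lin // (bopP (lact_bounded L Md')) !hdotDr !hdotZr h1 h2; ring.
- by rewrite emb_0 (bop0 (lact_bounded L Md')) !hdot0r mul0r.
elim: sb {Mb'} => [|v uv Pv|k f1 g1 a1 a1' b1 b1' s1 h1 s2 h2]; last 1 first.
- have [M1 M1' _] := simple_alg s1; have [M2 M2' _] := simple_alg s2.
  rewrite emb_lin // lact_lin // !hdotDl !hdotDr !hdotZl !hdotZr h1 h2; ring.
- by rewrite emb_0 lact_0 !hdot0l !hdot0r mulr0.
elim: sd {Md'} => [|z uz Pz|k f1 g1 a1 a1' b1 b1' s1 h1 s2 h2]; last 1 first.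
- have [M1 M1' _] := simple_alg s1; have [M2 M2' _] := simple_alg s2.
  rewrite emb_lin // lact_lin // !hdotDl !hdotDr !hdotZl !hdotZr h1 h2 conjCK; ring.
- by rewrite emb_0 lact_0 !hdot0l !hdot0r mulr0.
rewrite !lact_emb //.
rewrite (embdot L (alg_comp (mon_alg _) (mon_alg _)) (alg_comp (mon_alg _) (mon_alg _))
  (is_adjoint_comp (is_adjointC (mon_adj z)) (mon_adj w))).
rewrite (embdot L (mon_alg u) (mon_alg w) (mon_adj w)).
rewrite (embdot L (mon_alg z) (mon_alg v) (mon_adj v)).
have two := phi_monom2 (@aop_alg n) (@aop_free n) (@aop1 n) (@aop2 n).
rewrite (two w u) ?uniq_reduced // (two v z) ?uniq_reduced //.
rewrite (phi_monom4 (q := q) (@aop_alg n) (@aop_free n) (@aop1 n) (@aop2 n)) //.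
- by congr (_ * _); rewrite eq_sym; case: eqP => // ->.
- by split; exact: uniq_reduced.
- by rewrite !size_tuple.
- apply: thead_differ; apply/eqP => wz; have := PP' _ Pw.
  by rewrite wz Pz.
Qed.

(** A product of two integrals of order q without contraction lies in the chaos of
order 2q, which is orthogonal to the chaos of order q. *)
Lemma simple_triple n P P' Q f a a' h c c' e d d' :
  (forall k, P k -> ~~ P' k) ->
  simple n Q f a a' -> simple n P h c c' -> simple n P' e d d' ->
  '[emb a, lact d' (emb c)] = 0.
Proof.
move=> PP' sa sc sd; have [_ Md' _] := simple_alg sd.
elim: sa => [|u uu Pu|k f1 g1 a1 a1' b1 b1' s1 h1 s2 h2]; last 1 first.
- have [M1 _ _] := simple_alg s1; have [M2 _ _] := simple_alg s2.
  by rewrite emb_lin // !hdotDl !hdotZl h1 h2 mulr0 addr0.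
- by rewrite emb_0 hdot0l.
elim: sc => [|w uw Pw|k f1 g1 a1 a1' b1 b1' s1 h1 s2 h2]; last 1 first.
- have [M1 _ _] := simple_alg s1; have [M2 _ _] := simple_alg s2.
  by rewrite emb_lin // (bopP (lact_bounded L Md')) !hdotDr !hdotZr h1 h2 mulr0 addr0.
- by rewrite emb_0 (bop0 (lact_bounded L Md')) !hdot0r.
elim: sd {Md'} => [|z uz Pz|k f1 g1 a1 a1' b1 b1' s1 h1 s2 h2]; last 1 first.
- have [M1 M1' _] := simple_alg s1; have [M2 M2' _] := simple_alg s2.
  by rewrite lact_lin // !hdotDr !hdotZr h1 h2 mulr0 addr0.
- by rewrite lact_0 !hdot0r.
rewrite hdotC lact_emb //.
rewrite (embdot L (alg_comp (mon_alg _) (mon_alg _)) (mon_alg u) (mon_adj u)).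
rewrite (phi_monom3 (@aop_alg n) (@aop_free n) (@aop1 n) (@aop2 n)) ?conjC0 //;
  rewrite ?uniq_reduced //.
- apply: thead_differ; apply/eqP => wz; have := PP' _ Pw.
  by rewrite -wz Pz.
- by rewrite !size_tuple; lia.
Qed.

Section LastFormula.
Variable n : nat.
Hypothesis Bn : B `<=` [set t | (t : R) < n%:R].

(** Additivity of N applies to it one atom at a time, and for the odd codes it
is B. *)
Definition unionat (s : seq 'I_(natoms n)) : set T :=
  [set t | 0 <= (t : R) /\ exists2 k : 'I_(natoms n), k \in s & code B n t = k].

(** The scalar 1 gives the sum the shape in which the state is linear. *)
Definition sumop (s : seq 'I_(natoms n)) : ncop A :=
  foldr (fun k b => (1 \*: aop k) \+ b) (fun=> 0) s.

Lemma sumop_alg s : M (sumop s).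
Proof. by elim: s => [|k s ih] /=; [exact: alg_0|exact: alg_lin]. Qed.

Lemma unionat_sum s : uniq s -> finite_borel (unionat s) /\ N (unionat s) = sumop s.
Proof.
elim: s => [_|k s ih /= /andP[ks us]].
  have -> : unionat [::] = set0 by apply/seteqP; split=> // t [_ [k]].
  have f0 : finite_borel (set0 : set T) by split=> //; rewrite ?measure0.
  by split=> //; case: hN => _ _ h _ _; rewrite h // measure0.
have [[m1 m2 m3] e] := ih us; have fa := atom_finite fB n k.
have [a1 a2 a3] := fa.
have -> : unionat (k :: s) = atom B n k `|` unionat s.
  apply/seteqP; split=> t.
    move=> [t0 [l]]; rewrite inE => /orP[/eqP->|ls] e1; first by left.
    by right; split=> //; exists l.
  move=> [[t0 e1]|[t0 [l ls e1]]]; split=> //; [exists k|exists l] => //.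
    by rewrite inE eqxx.
  by rewrite inE ls orbT.
have disj : atom B n k `&` unionat s = set0.
  apply/eqP; apply: contraT => /set0P[t [[_ e1] [_ [l ls e2]]]].
  by case/negP: ks; rewrite (_ : k = l) //; apply: val_inj; rewrite /= -e1 -e2.
split.
  split; [exact: measurableU|by move=> t [/a2|/m2]|].
  rewrite measureU //; exact: lte_add_pinfty.
case: hN => _ _ _ _ h; rewrite h // e; apply/funext => u /=.
by rewrite scale1r.
Qed.

Definition odd_atoms : seq 'I_(natoms n) :=
  [seq k : 'I_(natoms n) <- enum 'I_(natoms n) | odd k].

Lemma N_lastB : N B = sumop odd_atoms.
Proof.
have us : uniq odd_atoms by rewrite filter_uniq ?enum_uniq.
have [_ <-] := unionat_sum us; congr N; apply/seteqP; split=> t.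
  move=> tB; have t0 : 0 <= (t : R) by case: fB => _ + _; apply.
  have ct : (code B n t < natoms n)%N by rewrite code_lt //; exact: Bn.
  split=> //; exists (Ordinal ct) => //.
  by rewrite mem_filter mem_enum andbT /= odd_code mem_set.
move=> [t0 [k]]; rewrite mem_filter => /andP[+ _] e; rewrite -e odd_code.
by move/set_mem.
Qed.

Lemma phi_sumop s x : M x -> phi (sumop s \o x) = \sum_(k <- s) phi (aop k \o x).
Proof.
move=> Mx; elim: s => [|k s ih] /=; first by rewrite big_nil; exact: phi_0.
rewrite big_cons -ih.
have -> : ((1 \*: aop k) \+ sumop s) \o x = (1 \*: (aop k \o x)) \+ (sumop s \o x).
  by [].
by rewrite phi_lin ?mul1r //; apply: alg_comp => //; exact: sumop_alg.
Qed.

(** N(B) is a sum of words of one letter, orthogonal to words of length q > 1. *)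
Lemma simple_first_chaos P f a a' : (1 <= p)%N -> simple n P f a a' ->
  '[emb a, emb (N B)] = 0.
Proof.
move=> p1; have MB := fpm_alg hN fB; have sB := fpm_sa hN fB.
elim=> [|w uw Pw|k f1 g1 a1 a1' b1 b1' s1 h1 s2 h2].
- by rewrite emb_0 hdot0l.
- rewrite (embdot L (mon_alg w) MB sB) N_lastB phi_sumop // big1 // => k _.
  have /= -> := phi_monom2 (@aop_alg n) (@aop_free n) (@aop1 n) (@aop2 n)
    (u := [:: k]) (v := w) isT (uniq_reduced uw).
  case: eqP => // e; exfalso; move: p1.
  by have := size_tuple w; rewrite -e /= => -[<-].
- have [M1 _ _] := simple_alg s1; have [M2 _ _] := simple_alg s2.
  by rewrite emb_lin // hdotDl hdotZl h1 h2 mulr0 addr0.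
Qed.

(** Right multiplication by N(B) followed by compression to the chaos of order q
is the restriction of the last variable to B: expand N(B) over the atoms of odd
code and use [phi_monom_last]. *)
Lemma simple_last Q Q' f a a' g c c' : simple n Q f a a' -> simple n Q' g c c' ->
  '[emb a, ract (N B) (emb c)] = '[I f, I (lastB g)].
Proof.
have MB := fpm_alg hN fB; have sB := fpm_sa hN fB.
move=> sa sc; elim: sa => [|u uu Pu|k f1 g1 a1 a1' b1 b1' s1 h1 s2 h2].
- by rewrite emb_0 (int_0 hI) !hdot0l.
- elim: sc => [|v uv Pv|k f1 g1 a1 a1' b1 b1' s1 h1 s2 h2].
  + have -> : lastB (fun=> 0) = (fun=> 0).
      by apply/funext => t; rewrite /lastB mulr0.
    by rewrite emb_0 (bop0 (ract_bounded L MB)) (int_0 hI) !hdot0r.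
  + rewrite lastB_box ract_emb //.
    rewrite (embdot L (mon_alg u) (alg_comp (mon_alg v) MB) (is_adjoint_comp (mon_adj v) sB)).
    have -> : (N B \o mon (rev v)) \o mon u = N B \o (mon (rev v) \o mon u) by [].
    have Mvu := alg_comp (mon_alg (rev v)) (mon_alg u).
    rewrite N_lastB phi_sumop //.
    pose X := \prod_(l <- v) amass l.
    have -> : \sum_(k <- odd_atoms) phi (aop k \o (mon (rev v) \o mon u))
      = \sum_(k <- odd_atoms)
           if ((v : seq _) == u) && (tnth v ord_max == k) then X else 0.
      apply: eq_bigr => k _.
      rewrite (phi_monom_last (q := q) (@aop_alg n) (@aop_free n) (@aop1 n) (@aop2 n) (@aop3 n));
        rewrite ?uniq_reduced ?size_tuple //.
      by rewrite (tnth_nth k) -nth_last size_tuple.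
    rewrite -big_mkcondr /odd_atoms big_filter_cond big_enum_cond /=.
    have simpl_uv : '[I (box u), I (box v)] = if (v : seq _) == u then X else 0.
      rewrite (simple_emb (simple_box uu (P := predT) isT)) (simple_emb (simple_box uv (P := predT) isT)).
      rewrite (embdot L (mon_alg u) (mon_alg v) (mon_adj v)).
      by rewrite (phi_monom2 (@aop_alg n) (@aop_free n) (@aop1 n) (@aop2 n)) ?uniq_reduced.
    case: ifP => ov; last first.
      rewrite (int_0 hI) hdot0r big_pred0 // => k.
      apply/negP => /andP[ok /andP[_ /eqP e]]; by rewrite -e ov in ok.
    rewrite simpl_uv; case: eqP => e; last by rewrite big_pred0 // => k; rewrite andbF.
    rewrite (big_pred1 (tnth v ord_max)) // => k /=.
    by rewrite eq_sym; case: eqP => [->|]; rewrite ?ov ?andbF.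
  + have [M1 _ _] := simple_alg s1; have [M2 _ _] := simple_alg s2.
    have L1 := lastB_L2 (simple_L2 s1); have L2 := lastB_L2 (simple_L2 s2).
    rewrite emb_lin // (bopP (ract_bounded L MB)) !hdotDr !hdotZr h1 h2.
    by rewrite lastB_lin (int_lin hI) // hdotDr hdotZr.
- have [M1 _ _] := simple_alg s1; have [M2 _ _] := simple_alg s2.
  have L1 := simple_L2 s1; have L2 := simple_L2 s2.
  by rewrite emb_lin // (int_lin hI) // !hdotDl !hdotZl h1 h2.
Qed.
End LastFormula.

(** A slab lies over an atom of measure at most 2^-m in a fixed cube. *)
Lemma slab_small n P f a a' : simple n P f a a' ->
  exists2 K : R, 0 <= K & forall m k,
    nm (I (fun t => \1_(atom B m k) (thead t) * f t)) ^+ 2 <= K / 2 ^+ m.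
Proof.
move=> sf; have [C C0 hC] := simple_bound sf; have [mf f2] := simple_L2 sf.
exists (C * n%:R ^+ p) => [|m k]; first by rewrite mulr_ge0 ?exprn_ge0.
have ma := atom_measurable fB m k.
pose S : set tup := [set t | atom B m k (thead t) /\ @cube R p n [tuple of behead t]].
have mS : measurable S.
  rewrite (_ : S = [set t | atom B m k (tnth t ord0)] `&`
     ((fun t : tup => [tuple of behead t]) @^-1` @cube R p n)) //.
  apply: measurableI; first exact: measurable_coord.
  rewrite -[X in measurable X]setTI; apply: measurable_behead => //.
  exact: cube_measurable.
pose g := fun t : tup => \1_(atom B m k) (thead t) * f t : R[i].
have gE : g = fun t => \1_[set t : tup | atom B m k (tnth t ord0)] t * f t.
  by apply/funext => t; rewrite /g !indicE.
have g2 : in_L2 g by rewrite gE; apply: in_L2_indic (simple_L2 sf); exact: measurable_coord.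
rewrite -lee_fin -/g (int_norm hI g2) norm2sqE.
have mD := @orthant_measurable R q.
apply: (@le_trans _ _ (\int[lebesgue_pow R q]_(t in @orthant R q) (C%:E * (\1_S t)%:E))%E).
  apply: ge0_le_integral => //.
  - by move=> t _; rewrite lee_fin normsq_ge0.
  - exact: measurable_normsq g2.1.
  - apply: emeasurable_funM => //; apply/measurable_EFinP; exact: measurable_indic.
  move=> t Dt; rewrite -EFinM lee_fin /g normsqM indicE normsq_bool.
  case: (boolP (thead t \in atom B m k)) => [ta|]; last first.
    by rewrite mul0r mulr_ge0.
  rewrite mul1r (le_trans (hC t)) // ler_wpM2l // !indicE.
  case: (boolP (t \in @cube R q n)) => // /set_mem ct.
  rewrite mem_set //; split; first exact: set_mem.
  by move: ct; rewrite cube_consE => -[].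
rewrite ge0_integralZl //; last first.
  by apply/measurable_EFinP; exact: measurable_indic.
rewrite integral_indic //.
apply: (@le_trans _ _ (C%:E * lebesgue_pow R q S)%E).
  by rewrite lee_wpmul2l ?lee_fin // le_measure ?inE //; exact: measurableI.
rewrite lebesgue_pow_slab // -mulrA EFinM lee_wpmul2l ?lee_fin // EFinM.
by rewrite lee_wpmul2l ?lee_fin ?exprn_ge0 // atom_le.
Qed.

End Simple.

(** * Density of the simple functions *)

Section Density.
Context {R : realType} {A : tracialWspace R} {L : L2space A}.
Local Notation T := (measurableTypeR R).
Local Notation nm := (hnorm (@hdot R (L2hilbert L))).
Variables (N : set T -> ncop A) (hN : free_poisson_measure L N).
Variables (p : nat) (I : (p.+1.-tuple T -> R[i]) -> L) (hI : multiple_integral N I).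
Variables (B : set T) (fB : finite_borel B).
Local Notation q := p.+1.
Local Notation tup := (q.-tuple T).
Local Notation Dq := (@orthant R q).
Local Notation muq := (@lebesgue_pow R q).
Local Notation simple n P f a a' := (@simple R A N p B n P f a a').
Local Notation simplef n P f := (@simplef R A N p B n P f).
Implicit Types (f g : tup -> R[i]).

Lemma near_pow2_ge (d : R) : 0 < d -> \forall n \near \oo, 1 <= 2 ^+ n * d.
Proof.
move=> d0; exists (Num.trunc d^-1).+1 => // n /= hn.
rewrite -ler_pdivrMr // mul1r.
have := truncnS_gt d^-1; move/ltW/le_trans; apply.
apply: le_trans (_ : n%:R <= _); first by rewrite ler_nat.
by rewrite -natrX ler_nat ltnW // ltn_expl.
Qed.

(** Membership of f in the closure of the simple functions, read through the
isometry I. *)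
Definition approx f : Prop := in_L2 f /\ forall e : R, 0 < e ->
  exists n g, simplef n predT g /\ nm (I f - I g) < e.

Lemma simplef_L2 n P g : simplef n P g -> in_L2 g.
Proof. by move=> [a [a' s]]; exact: simple_L2 s. Qed.

Lemma simplef_le n m g : (n <= m)%N -> simplef n predT g -> simplef m predT g.
Proof.
move=> nm [a [a' s]]; exists a, a'.
by have := simple_refineD hN hI fB (m - n) s; rewrite subnKC.
Qed.

Lemma approx_simple n g : simplef n predT g -> approx g.
Proof.
move=> s; split; first exact: simplef_L2 s.
by move=> e e0; exists n, g; split=> //; rewrite subrr hnorm0.
Qed.

Lemma approx_lin k f g : approx f -> approx g -> approx (fun t => k * f t + g t).
Proof.
move=> [f2 hf] [g2 hg]; split; first exact: in_L2_lin.
move=> e e0; have e2 : 0 < e / 2 by rewrite divr_gt0.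
pose K := Re `|k| + 1.
have K0 : 0 < K by rewrite ltr_wpDl // normc_def /= sqrtr_ge0.
have eK : 0 < e / 2 / K by rewrite divr_gt0.
have [n1 [f1 [s1 h1]]] := hf _ eK; have [n2 [g1 [s2 h2]]] := hg _ e2.
exists (maxn n1 n2), (fun t => k * f1 t + g1 t); split.
  by apply: simplef_lin; [exact: simplef_le (leq_maxl _ _) s1
    |exact: simplef_le (leq_maxr _ _) s2].
have L1 := simplef_L2 s1; have L2 := simplef_L2 s2.
rewrite !(int_lin hI) // opprD addrACA -scalerBr.
apply: (le_lt_trans (hnormD _ _)); rewrite [ltRHS](splitr e); apply: ler_ltD => //.
rewrite hnormZ (@le_trans _ _ (K * nm (I f - I f1))) //.
  by rewrite ler_wpM2r ?hnorm_ge0 // lerDl.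
by rewrite mulrC -ler_pdivlMr // ltW.
Qed.

Lemma approx_0 : approx (fun=> 0).
Proof. by apply: (@approx_simple 0%N); exact: simplef_0. Qed.

Lemma approx_sum (k : nat -> R[i]) (F : nat -> tup -> R[i]) m :
  (forall j, approx (F j)) -> approx (fun t => \sum_(j < m) k j * F j t).
Proof.
move=> h; elim: m => [|m ih].
  have -> : (fun t => \sum_(j < 0) k j * F j t) = (fun=> 0).
    by apply/funext => t; rewrite big_ord0.
  exact: approx_0.
have -> : (fun t => \sum_(j < m.+1) k j * F j t)
   = (fun t => k m * F m t + \sum_(j < m) k j * F j t).
  by apply/funext => t; rewrite big_ord_recr /= addrC.
exact: approx_lin.
Qed.

(** Dominated convergence of the squared distances; the rate 1/(n+1) in the
pointwise hypothesis is one that every use below provides directly. *)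
Lemma approx_dominated (f_ : nat -> tup -> R[i]) f (G : tup -> R) :
  (forall n, approx (f_ n)) -> in_L2 f ->
  muq.-integrable Dq (EFin \o G) ->
  (forall n t, Dq t -> normsq (f t - f_ n t) <= G t) ->
  {ae muq, forall t, Dq t -> exists n0 : nat, forall n, (n0 <= n)%N ->
     normsq (f t - f_ n t) <= n.+1%:R^-1} ->
  approx f.
Proof.
move=> af f2 iG dG cv; split=> // e e0.
have mD := @orthant_measurable R q.
have f_2 n : in_L2 (f_ n) by case: (af n).
have fB2 n : in_L2 (fun t => f t - f_ n t) by exact: in_L2_B.
have [] := @dominated_convergence _ _ _ muq Dq mD
  (fun n t => (normsq (f t - f_ n t))%:E) (fun=> 0%E) (EFin \o G).
- by move=> n; apply: measurable_normsq; exact: (fB2 n).1.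
- exact: measurable_cst.
- apply: filterS cv => t h Dt; have [n0 hn] := h Dt.
  apply/fine_cvgP; split; first by near=> n.
  apply/cvgrPdist_lt => d d0; near=> n.
  rewrite /= sub0r normrN ger0_norm ?normsq_ge0 //.
  apply: (@le_lt_trans _ _ n.+1%:R^-1); first by apply: hn; near: n; exact: nbhs_infty_ge.
  by near: n; exact: near_infty_natSinv_lt (PosNum d0).
- by [].
- apply: aeW => t n Dt /=; rewrite lee_fin ger0_norm ?normsq_ge0 //; exact: dG.
move=> _ _; rewrite integral0_eq // => cvI.
have e2 : 0 < (e / 2) ^+ 2 by rewrite exprn_gt0 // divr_gt0.
have [n hn] : exists n, (norm2sq (fun t => f t - f_ n t)%R < ((e / 2) ^+ 2)%:E)%E.
  have /fine_cvgP[fin /cvgrPdist_lt/(_ _ e2)[n0 _ h]] := cvI.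
  case: fin => n1 _ fin; exists (maxn n0 n1).
  have := h _ (leq_maxl n0 n1); have := fin _ (leq_maxr n0 n1); rewrite /= -norm2sqE.
  case: norm2sq => // r _; rewrite sub0r normrN lte_fin => h1.
  exact: le_lt_trans (ler_norm r) h1.
have [_ /(_ (e / 2))] := af n.
rewrite divr_gt0 // => /(_ isT) [m [g [s h]]]; exists m, g; split=> //.
apply: (le_lt_trans (hnorm_triangle (I (f_ n)) _ _)).
rewrite [ltRHS](splitr e) ltrD //.
rewrite -(int_B hI) // -ltr_sqr ?nnegrE ?hnorm_ge0 ?divr_ge0 ?ltW //.
by rewrite -lte_fin (int_norm hI).
Unshelve. all: end_near.
Qed.

Lemma cube_integrable (C : R) n : muq.-integrable Dq (EFin \o (fun t => C * \1_(@cube R q n) t)).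
Proof.
have mD := @orthant_measurable R q; have mc := @cube_measurable R q n.
have -> : EFin \o (fun t => C * \1_(@cube R q n) t) =
   (fun t => C%:E * (\1_(@cube R q n) t)%:E)%E by [].
apply: integrableZl => //; apply/integrableP; split.
  by apply/measurable_EFinP; exact: measurable_indic.
under eq_integral do rewrite /= ger0_norm //.
rewrite integral_indic //; apply: (@le_lt_trans _ _ (muq (@cube R q n))).
  by apply: le_measure; rewrite ?inE //; exact: measurableI.
by rewrite lebesgue_pow_cube ltry.
Qed.

(** Sum the off-diagonal boxes of level n that lie in the corner.  A point with
distinct coordinates is eventually separated by the grids, and its cell shrinks
to it, so it is eventually covered; the other points form a null set. *)
Lemma approx_corner (y : 'I_q -> R) (K : nat) : (forall i, y i <= K%:R) ->
  approx (fun t => \1_[set t : tup | forall i, 0 <= (tnth t i : R) < y i] t).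
Proof.
move=> yK; set S := [set t : tup | _].
have mS : measurable S.
  apply: (@measurable_tuple_forall _ _ (fun i => [set x | 0 <= (x : R) < y i])) => i.
  have -> : [set x : T | 0 <= (x : R) < y i] = `[0, y i[%classic.
    by apply/seteqP; split=> x /=; rewrite in_itv.
  exact: measurable_itv.
have SK : S `<=` @cube R q K.
  by move=> t tS i; have /andP[-> h] := tS i; exact: lt_le_trans h (yK i).
pose below n (w : q.-tuple 'I_(natoms n)) :=
  [forall i, (tnth w i)./2.+1%:R <= 2 ^+ n * y i].
pose f_ n t : R[i] := \sum_(w : q.-tuple 'I_(natoms n) | uniq w && predT (thead w))
  (below n w)%:R * box B w t.
have inS : in_L2 (\1_S : tup -> R[i]) by exact: in_L2_indicator SK.
have f01 n t : exists b : bool, f_ n t = b%:R /\ (b -> S t).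
  have [ct|ct] := pselect (@cube R q n t); last by exists false; rewrite /f_ boxes_out.
  have [w tw] := boxes_codes B ct; rewrite /f_ (boxes_eval _ _ tw).
  case: ifP => _; last by exists false.
  exists (below n w); split=> // /forallP h i; have [t0 tc] := tw i; rewrite t0 /=.
  have := h i; rewrite -tc half_code => h'.
  have p2 : 0 < 2 ^+ n :> R by rewrite exprn_gt0.
  by rewrite -(ltr_pM2l p2) (lt_le_trans _ h') // truncnS_gt.
apply: (@approx_dominated f_ _ (fun t => 1 * \1_(@cube R q K) t)) => //.
- by move=> n; apply: approx_simple; exact: simplef_boxes.
- exact: cube_integrable.
- move=> n t Dt; have [b [-> bS]] := f01 n t; rewrite mul1r !indicE.
  case: (boolP (t \in S)) => [/set_mem/SK tK|tS].
    by rewrite mem_set //; case: b {bS}; rewrite /normsq /=; lra.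
  case: b bS => [/(_ isT) bS|_]; first by rewrite mem_set in tS.
  by rewrite subr0 normsq_bool /= ler0n.
exists (~` [set t : tup | uniq t]); split.
- by apply: measurableC; exact: uniq_measurable.
- exact: lebesgue_pow_not_uniq.
move=> t /= h ut; apply: h => Dt.
have [tS|tS] := pselect (S t); last first.
  exists 0%N => n _; have [b [-> bS]] := f01 n t; rewrite indicE memNset //.
  by case: b bS => [/(_ isT)//|_]; rewrite subr0 normsq_bool invr_ge0.
(* beyond some level the grid isolates the coordinates of t and their cells lie
   below y *)
have ev : \forall n \near \oo, (forall i, 1 <= 2 ^+ n * (y i - tnth t i)) /\
    (forall i j, i != j -> 1 <= 2 ^+ n * `|(tnth t i : R) - tnth t j|).
  apply: filterI.
    apply: (@filter_forall nat _ (fun (i : 'I_q) n => 1 <= 2 ^+ n * (y i - tnth t i)) (nbhs \oo)) => i.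
    apply: near_pow2_ge.
    by have /andP[_ h] := tS i; rewrite subr_gt0.
  apply: (@filter_forall nat _ (fun (i : 'I_q) n => forall j, i != j ->
    1 <= 2 ^+ n * `|(tnth t i : R) - tnth t j|) (nbhs \oo)) => i.
  apply: (@filter_forall nat _ (fun (j : 'I_q) n => i != j ->
    1 <= 2 ^+ n * `|(tnth t i : R) - tnth t j|) (nbhs \oo)) => j.
  have [_|ij] := eqVneq i j; first by apply: nearW.
  have : \forall n \near \oo, 1 <= 2 ^+ n * `|(tnth t i : R) - tnth t j|.
    apply: near_pow2_ge; rewrite normr_gt0 subr_eq0.
    by apply: contra ij => /eqP e; apply/eqP; move/tuple_uniqP: ut; exact.
  by apply: filterS.
case: ev => n1 _ hn1; exists (maxn n1 K) => n nn.
have {hn1} [hy hd] := hn1 n (leq_trans (leq_maxl _ _) nn).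
have Kn : (K <= n)%N := leq_trans (leq_maxr _ _) nn.
have ct : @cube R q n t.
  move=> i; have /andP[-> h] := SK _ tS i; rewrite (lt_le_trans h) //.
  by rewrite ler_nat.
have [w tw] := boxes_codes B ct.
have codes i : (tnth w i)./2%:R <= 2 ^+ n * (tnth t i : R) < (tnth w i)./2.+1%:R.
  have [t0 tc] := tw i; rewrite -tc half_code.
  by apply: truncn_itv; rewrite mulr_ge0 ?exprn_ge0.
have uw : uniq w.
  apply/tuple_uniqP => i j e; apply/eqP; apply: contraT => ij.
  have := hd _ _ ij; rewrite leNgt => /negP; case.
  have /andP[a1 a2] := codes i; have /andP[b1 b2] := codes j.
  have -> : 2 ^+ n * `|(tnth t i : R) - tnth t j|
      = `|2 ^+ n * (tnth t i : R) - 2 ^+ n * tnth t j|.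
    by rewrite -mulrBr normrM ger0_norm ?exprn_ge0.
  move: a1 a2; rewrite e -natr1 => a1 a2; move: b1 b2; rewrite -natr1 => b1 b2.
  by rewrite ltr_norml; apply/andP; split; lra.
have bw : below n w.
  apply/forallP => i; have /andP[a1 a2] := codes i; have := hy i.
  rewrite -natr1 mulrBr; lra.
rewrite /f_ (boxes_eval _ _ tw) uw bw /= indicE mem_set // subrr.
by rewrite /normsq /= expr0n addr0 invr_ge0.
Qed.

Definition corner : set (set tup) :=
  [set X | exists x : 'I_q -> R, X = [set t | forall i, (tnth t i : R) < x i]].

Lemma corner_setI : setI_closed corner.
Proof.
move=> X Y [x ->] [y ->]; exists (fun i => Num.min (x i) (y i)).
apply/seteqP; split=> t /=.
  by move=> [h1 h2] i; rewrite lt_min h1 h2.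
by move=> h; split=> i; have := h i; rewrite lt_min => /andP[].
Qed.

Lemma corner_measurable X : corner X -> measurable X.
Proof.
move=> [x ->].
apply: (@measurable_tuple_forall _ _ (fun i => [set s : T | (s : R) < x i])) => i.
have -> : [set s : T | (s : R) < x i] = `]-oo, x i[%classic.
  by apply/seteqP; split=> s /=; rewrite in_itv.
exact: measurable_itv.
Qed.

(** Corners form a pi-system that generates the product sigma-algebra: bounding
the other coordinates by a large integer recovers each coordinate. *)
Lemma measurable_corner : (@measurable _ tup) = <<s corner >>.
Proof.
apply/seteqP; split; last first.
  apply: smallest_sub; last by move=> X /corner_measurable.
  exact: sigma_algebra_measurable.
have coord i : measurable_fun (setT : set (g_sigma_algebraType corner))
    (fun t => tnth (t : tup) i : T).
  apply: (measurability _ (RGenInftyO.measurableE R)) => _ [_ [x ->] <-].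
  rewrite setTI.
  have -> : (fun t : tup => tnth t i : T) @^-1` `]-oo, x[%classic =
      \bigcup_n [set t : tup | forall j, (tnth t j : R) < if j == i then x else n%:R].
    apply/seteqP; split=> t /=.
      rewrite in_itv /= => tx.
      pose m := \max_(j < q) (Num.trunc (tnth t j : R)).+1.
      exists m => // j; case: eqP => [->//|_].
      apply: lt_le_trans (truncnS_gt _) _; rewrite ler_nat.
      exact: (leq_bigmax j).
    by move=> [n _ /(_ i)]; rewrite eqxx in_itv.
  apply: bigcup_measurable => n _; apply: sub_sigma_algebra.
  by exists (fun j => if j == i then x else n%:R).
move=> X mX.
have mid : measurable_fun (setT : set (g_sigma_algebraType corner)) (id : _ -> tup).
  by apply/measurable_fun_tnthP => i; exact: coord.
by have := mid measurableT X mX; rewrite setTI.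
Qed.

(** Dynkin's pi-lambda theorem, inside a fixed cube. *)
Lemma approx_measurable (K : nat) (X : set tup) : measurable X ->
  approx (\1_(X `&` @cube R q K) : tup -> R[i]).
Proof.
rewrite measurable_corner => sX; have mc := @cube_measurable R q K.
have cornerK (y : 'I_q -> R) : approx (\1_([set t | forall i, (tnth t i : R) < y i]
    `&` @cube R q K) : tup -> R[i]).
  have := @approx_corner (fun i => Num.min (y i) K%:R) K.
  have -> : [set t : tup | forall i, 0 <= (tnth t i : R) < Num.min (y i) K%:R]
    = [set t | forall i, (tnth t i : R) < y i] `&` @cube R q K.
    apply/seteqP; split=> t /=.
      move=> h; split=> i; have := h i; rewrite lt_min.
        by case/and3P.
      by case/and3P => -> _ ->.
    by move=> [h1 h2] i; have /andP[-> h] := h2 i; rewrite lt_min h1 h.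
  by apply=> i; rewrite ge_min lexx orbT.
have cubeK : approx (\1_(@cube R q K) : tup -> R[i]).
  have := cornerK (fun=> K%:R).
  have -> // : [set t : tup | forall i, (tnth t i : R) < K%:R] `&` @cube R q K
     = @cube R q K.
  by apply: setIidr => t h i; have /andP[] := h i.
apply: (dynkin_induction (P := fun X => approx (\1_(X `&` @cube R q K) : tup -> R[i]))
  measurable_corner corner_setI _ _ _ _ sX).
- by rewrite setTI.
- by move=> Y [y ->]; exact: cornerK.
- move=> Y mY aY.
  have -> : \1_(~` Y `&` @cube R q K) =
     (fun t => -1 * \1_(Y `&` @cube R q K) t + \1_(@cube R q K) t) :> (tup -> R[i]).
    apply/funext => t; rewrite !indicE !in_setI in_setC.
    by case: (t \in Y); case: (t \in @cube R q K); rewrite /= ?mulr0 ?mulr1 ?addNr ?add0r.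
  exact: approx_lin.
move=> F mF tF aF.
have mU : measurable (\bigcup_k F k) by exact: bigcup_measurable.
have mUK := measurableI _ _ mU mc.
have U2 : in_L2 (\1_(\bigcup_k F k `&` @cube R q K) : tup -> R[i]).
  have := in_L2_indic mU (cubeK.1); congr in_L2; apply/funext => t.
  by rewrite !indicE in_setI -natrM mulnb.
pose s n (t : tup) : R[i] := \sum_(j < n) 1 * \1_(F j `&` @cube R q K) t.
have sE t : (exists k, [/\ (\bigcup_k F k `&` @cube R q K) t
      & forall n, s n t = (k < n)%:R]) \/
    (~ (\bigcup_k F k `&` @cube R q K) t /\ forall n, s n t = 0).
  have [[[k _ Fk] ct]|nt] := pselect ((\bigcup_k F k `&` @cube R q K) t).
    left; exists k; split=> [|n]; first by split=> //; exists k.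
    have other j : j != k -> \1_(F j `&` @cube R q K) t = 0 :> R[i].
      move=> jk; rewrite indicE memNset // => -[Fj _].
      by case/eqP: jk; exact: (tF j k Logic.I Logic.I (ex_intro _ t (conj Fj Fk))).
    rewrite /s; case: ltnP => kn.
      rewrite (bigD1 (Ordinal kn)) //= big1 ?addr0.
        by rewrite mul1r indicE mem_set.
      by move=> j jk; rewrite other ?mulr0.
    apply: big1 => j _; rewrite other ?mulr0 // ltn_eqF //.
    exact: leq_trans (ltn_ord j) kn.
  right; split=> // n; apply: big1 => j _; rewrite indicE memNset ?mulr0 //.
  by move=> [Fj ct]; apply: nt; split=> //; exists (nat_of_ord j).
apply: (@approx_dominated s _ (fun t => 1 * \1_(@cube R q K) t)) => //.
- by move=> n; apply: (@approx_sum (fun=> 1) (fun j => \1_(F j `&` @cube R q K))).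
- exact: cube_integrable.
- move=> n t Dt; have [[k [Ut ->]]|[nU ->]] := sE t.
    rewrite !indicE mem_set // (mem_set Ut.2) mul1r.
    by case: (k < n)%N; rewrite /normsq /=; lra.
  by rewrite subr0 indicE memNset // mul1r /normsq /= expr0n addr0.
apply: aeW => t Dt; have [[k [Ut sk]]|[nU s0]] := sE t.
  exists k.+1 => n kn; rewrite sk kn indicE mem_set // subrr.
  by rewrite /normsq /= expr0n addr0 invr_ge0.
exists 0%N => n _; rewrite s0 subr0 indicE memNset //.
by rewrite /normsq /= expr0n addr0 invr_ge0.
Qed.

Lemma sum_ltn m k : (\sum_(j < m) (j < k) = minn m k)%N.
Proof.
elim: m => [|m ih]; first by rewrite big_ord0 min0n.
by rewrite big_ord_recr /= ih; case: ltnP; lia.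
Qed.

(** The functions floor((n+1) u) / (n+1) tend to u uniformly, and each of them is
a finite sum of indicators of level sets of u (layer cake). *)
Lemma approx_bounded (u : tup -> R) (C K : nat) : measurable_fun Dq u ->
  (forall t, Dq t -> 0 <= u t <= C%:R * \1_(@cube R q K) t) ->
  approx (fun t => (u t)%:C).
Proof.
move=> mu uC; have mD := @orthant_measurable R q.
pose X n j : set tup := Dq `&` [set t | j.+1%:R <= n.+1%:R * u t].
have mX n j : measurable (X n j).
  have mf : measurable_fun Dq (fun t => n.+1%:R * u t) by exact: measurable_funM.
  have -> : X n j = Dq `&` (fun t => n.+1%:R * u t) @^-1` `[j.+1%:R, +oo[%classic.
    by apply/seteqP; split=> t /= [Dt h]; split=> //; move: h; rewrite /= in_itv /= andbT.
  exact: (mf mD _ (measurable_itv _)).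
pose s n (t : tup) : R[i] :=
  \sum_(j < C * n.+1) (n.+1%:R^-1)%:C * \1_(X n j `&` @cube R q K) t.
have sE n t : Dq t -> s n t = ((Num.trunc (n.+1%:R * u t))%:R / n.+1%:R)%:C.
  move=> Dt; have /andP[u0 uK] := uC t Dt.
  have [ct|nct] := pselect (@cube R q K t); last first.
    have -> : u t = 0.
      by apply/eqP; rewrite eq_le u0 andbT; move: uK; rewrite indicE memNset // mulr0.
    rewrite mulr0 truncn0 mul0r; apply: big1 => j _.
    by rewrite indicE memNset ?mulr0 // => -[].
  have x0 : 0 <= n.+1%:R * u t by rewrite mulr_ge0.
  have tC : (Num.trunc (n.+1%:R * u t) <= C * n.+1)%N.
    rewrite -(natrK (R := R) (C * n.+1)); apply: le_truncn.
    rewrite natrM mulrC ler_wpM2r //.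
    by move: uK; rewrite indicE mem_set // mulr1.
  rewrite /s -mulr_sumr [in RHS]mulrC rmorphM /=; congr (_ * _).
  transitivity ((\sum_(j < C * n.+1) (j < Num.trunc (n.+1%:R * u t)))%N%:R : R[i]).
    rewrite natr_sum; apply: eq_bigr => j _; rewrite indicE in_setI (mem_set ct) andbT.
    congr (nat_of_bool _)%:R; rewrite truncn_ge_nat //.
    by apply/idP/idP => [/set_mem[]//|h]; apply: mem_set.
  by rewrite sum_ltn (minn_idPr tC) rmorph_nat.
have u2 : in_L2 (fun t => (u t)%:C).
  have mu' : measurable_complex (fun t => (u t)%:C).
    by split=> //; exact: measurable_cst.
  split=> //; apply: (@norm2sq_cube _ _ _ (C%:R ^+ 2) K) => [//||t Dt].
    by rewrite exprn_ge0.
  rewrite /normsq /= expr0n addr0; have /andP[u0 uK] := uC t Dt.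
  apply: (@le_trans _ _ ((C%:R * \1_(@cube R q K) t) ^+ 2)).
    by rewrite lerXn2r ?nnegrE ?mulr_ge0.
  rewrite exprMn ler_wpM2l ?exprn_ge0 // indicE.
  by case: (_ \in _); rewrite ?expr1n ?expr0n.
have bound n t : Dq t -> normsq ((u t)%:C - s n t) <= n.+1%:R^-1 ^+ 2 * \1_(@cube R q K) t.
  move=> Dt; have /andP[u0 uK] := uC t Dt; rewrite sE // -rmorphB /normsq /= expr0n addr0.
  have [ct|nct] := pselect (@cube R q K t); last first.
    have -> : u t = 0.
      by apply/eqP; rewrite eq_le u0 andbT; move: uK; rewrite indicE memNset // mulr0.
    by rewrite mulr0 truncn0 mul0r subrr expr0n indicE memNset // mulr0.
  have x0 : 0 <= n.+1%:R * u t by rewrite mulr_ge0.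
  have /andP[h1 h2] := truncn_itv x0; set m := Num.trunc _ in h1 h2 *.
  have n0 : 0 < n.+1%:R :> R by [].
  rewrite indicE mem_set // mulr1 -ler_sqrt ?exprn_ge0 // !sqrtr_sqr.
  have -> : u t - m%:R / n.+1%:R = (n.+1%:R * u t - m%:R) / n.+1%:R by field.
  rewrite normrM ler_piMl // ger0_norm ?subr_ge0 // lerBlDr.
  by rewrite addrC natr1 ltW.
apply: (@approx_dominated s _ (fun t => 1 * \1_(@cube R q K) t)) => //.
- move=> n; apply: (@approx_sum (fun=> (n.+1%:R^-1)%:C) (fun j => \1_(X n j `&` @cube R q K))).
  by move=> j; exact: approx_measurable.
- exact: cube_integrable.
- move=> n t Dt; apply: (le_trans (bound n t Dt)); rewrite ler_wpM2r //.
  by rewrite exprn_ile1 // invf_le1 // ler1n.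
apply: aeW => t Dt; exists 0%N => n _; apply: (le_trans (bound n t Dt)).
have n1 : n.+1%:R^-1 <= 1 :> R by rewrite invf_le1 // ler1n.
rewrite expr2 -mulrA ler_piMr ?invr_ge0 // (@le_trans _ _ n.+1%:R^-1) //.
rewrite ler_piMr ?invr_ge0 // indicE; exact: lern1.
Qed.

(** Truncate u at height n and to the cube of side n. *)
Lemma approx_ge0 (u : tup -> R) : measurable_fun Dq u -> (forall t, 0 <= u t) ->
  in_L2 (fun t => (u t)%:C) -> approx (fun t => (u t)%:C).
Proof.
move=> mu u0 u2; have mD := @orthant_measurable R q.
pose X n : set tup := Dq `&` [set t | u t <= n%:R].
have mX n : measurable (X n).
  have -> : X n = Dq `&` u @^-1` `]-oo, n%:R]%classic.
    by apply/seteqP; split=> t /= [Dt h]; split=> //; move: h; rewrite /= in_itv.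
  exact: (mu mD _ (measurable_itv _)).
pose v n t : R := \1_(X n `&` @cube R q n) t * u t.
have vE n t : v n t = (t \in X n `&` @cube R q n)%:R * u t by rewrite /v indicE.
have a_v n : approx (fun t => (v n t)%:C).
  apply: (@approx_bounded _ n n).
    apply: measurable_funM => //; apply: measurable_indic.
    by apply: measurableI => //; exact: cube_measurable.
  move=> t Dt; rewrite vE mulr_ge0 //= indicE in_setI.
  case: (boolP (t \in X n)) => [/set_mem[_ h]|_]; last by rewrite mul0r mulr_ge0.
  by case: (t \in @cube R q n); rewrite ?mul1r ?mul0r ?mulr1 ?mulr0.
have fin := u2.2.
have iu : muq.-integrable Dq (EFin \o (fun t => normsq (u t)%:C)).
  apply/integrableP; split; first exact: measurable_normsq u2.1.
  under eq_integral do rewrite /= ger0_norm ?normsq_ge0 //.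
  exact: fin.
apply: (@approx_dominated (fun n t => (v n t)%:C) _ (fun t => normsq (u t)%:C)) => //.
  move=> n t Dt; rewrite vE -rmorphB /normsq /= !expr0n !addr0.
  by case: (_ \in _); rewrite ?mul1r ?mul0r ?subrr ?subr0 ?expr0n ?sqr_ge0.
apply: aeW => t Dt.
pose m := (\max_(i < q) (Num.trunc (tnth t i : R)).+1 + (Num.trunc (u t)).+1)%N.
exists m => n mn; rewrite vE mem_set ?mul1r ?subrr.
  by rewrite /normsq /= expr0n addr0 invr_ge0.
split.
  split=> //=; apply: le_trans (ltW (truncnS_gt _)) _.
  by rewrite ler_nat (leq_trans _ mn) // leq_addl.
move=> i; rewrite Dt /=; apply: lt_le_trans (truncnS_gt _) _.
rewrite ler_nat (leq_trans _ mn) // (leq_trans _ (leq_addr _ _)) //.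
exact: (leq_bigmax i).
Qed.

(** Density for all of L^2: split into real and imaginary, positive and negative
parts. *)
Theorem approx_L2 f : in_L2 f -> approx f.
Proof.
move=> f2; have [[mr mi] _] := f2.
have part (u : tup -> R) : measurable_fun Dq u ->
    (forall t, u t ^+ 2 <= normsq (f t)) -> approx (fun t => (u t)%:C).
  move=> mu uf.
  have pos (w : tup -> R) : measurable_fun Dq w -> (forall t, 0 <= w t) ->
      (forall t, w t ^+ 2 <= normsq (f t)) -> approx (fun t => (w t)%:C).
    move=> mw w0 wf; apply: approx_ge0 => //; apply: (in_L2_le _ f2).
      by split=> //; exact: measurable_cst.
    by move=> t _; rewrite /normsq /= expr0n addr0; exact: wf.
  have -> : (fun t => (u t)%:C) =
      (fun t => -1 * (Num.max (- u t) 0)%:C + (Num.max (u t) 0)%:C).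
    apply/funext => t; rewrite mulN1r -rmorphN -rmorphD /=; congr (_%:C).
    by rewrite /Num.max; case: ifPn; case: ifPn; rewrite -?leNgt; lra.
  apply: approx_lin; apply: pos.
  - by apply: measurable_maxr => //; exact: measurableT_comp.
  - by move=> t; rewrite le_max lexx orbT.
  - move=> t; apply: le_trans (uf t); rewrite /Num.max; case: ifP => _.
      by rewrite expr0n sqr_ge0.
    by rewrite sqrrN.
  - exact: measurable_maxr.
  - by move=> t; rewrite le_max lexx orbT.
  - move=> t; apply: le_trans (uf t); rewrite /Num.max; case: ifP => // _.
    by rewrite expr0n sqr_ge0.
have -> : f = (fun t => 'i%C * (Im (f t))%:C + (Re (f t))%:C).
  by apply/funext => t; rewrite addrC [LHS]complexE.
apply: approx_lin; apply: part => // t; rewrite /normsq.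
  by rewrite lerDr sqr_ge0.
by rewrite lerDl sqr_ge0.
Qed.
End Density.

(** * The square of a multiple integral with a free Poisson law *)

Section HilbertBessel.
Context {R : realType} {H : hilbertSpace R}.
Local Notation "''[' u , v ]" := (hdot H u v).
Local Notation nm := (hnorm (@hdot R H)).

Lemma hlip_scale (k : R[i]) (g : H -> R[i]) : hlip g -> hlip (fun u => k * g u).
Proof.
move=> [C hC]; exists (Re `|k| * C) => u v; rewrite -mulrBr normrM.
have -> : `|k| = (Re `|k|)%:C by rewrite normc_def.
have k0 : 0 <= (Re `|k|)%:C by rewrite ler0c normc_def sqrtr_ge0.
by rewrite -mulrA rmorphM ler_wpM2l.
Qed.

Lemma hlip_cst (k : R[i]) : hlip (fun _ : H => k).
Proof. by exists 0 => u v; rewrite subrr normr0 mul0r. Qed.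

(** Bessel's inequality for orthogonal vectors that are not normalized: Cauchy's
inequality for u and the combination of the e_i with the coefficients of u. *)
Lemma bessel n (e : 'I_n -> H) (u : H) (d : R) : 0 <= d ->
  (forall i j, i != j -> '[e i, e j] = 0) -> (forall i, nm (e i) ^+ 2 <= d) ->
  \sum_i normsq '[u, e i] <= d * nm u ^+ 2.
Proof.
move=> d0 oe de; set S := \sum_i _.
have S0 : 0 <= S by apply: sumr_ge0 => i _; exact: normsq_ge0.
pose X := \sum_i '[u, e i] *: e i.
have uX : Re '[u, X] = S.
  rewrite hdot_sumr raddf_sum /=; apply: eq_bigr => i _.
  by rewrite hdotZr mulrC Re_mul_conj.
have X2 : nm X ^+ 2 <= d * S.
  rewrite hnorm_sqr hdot_suml raddf_sum /= mulr_sumr; apply: ler_sum => i _.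
  rewrite hdot_sumr (bigD1 i) //= big1 ?addr0; last first.
    by move=> j ji; rewrite hdotZl hdotZr oe ?mulr0 // eq_sym.
  rewrite hdotZl hdotZr mulrA hdot_norm.
  have -> : Re ('[u, e i] * '[u, e i]^* * (nm (e i) ^+ 2)%:C)
      = normsq '[u, e i] * nm (e i) ^+ 2.
    by rewrite -Re_mul_conj; case: ('[u, e i]) => x y /=; ring.
  by rewrite mulrC ler_wpM2r ?normsq_ge0.
have [->|Sn0] := eqVneq S 0; first by rewrite mulr_ge0 ?sqr_ge0.
have Sp : 0 < S by rewrite lt_def Sn0.
have h : S <= nm u * nm X.
  by rewrite -uX; apply: le_trans (Re_hdot_le _ _); exact: ler_norm.
have h2 : S ^+ 2 <= (nm u * nm X) ^+ 2.
  by rewrite lerXn2r ?nnegrE ?mulr_ge0 ?hnorm_ge0.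
rewrite -(ler_pM2r Sp) -expr2 (le_trans h2) // exprMn.
by rewrite (mulrC d) -[leRHS]mulrA ler_wpM2l ?sqr_ge0.
Qed.

Lemma pythagoras n (e : 'I_n -> H) : (forall i j, i != j -> '[e i, e j] = 0) ->
  nm (\sum_i e i) ^+ 2 = \sum_i nm (e i) ^+ 2.
Proof.
move=> oe; rewrite hnorm_sqr hdot_suml raddf_sum /=; apply: eq_bigr => i _.
rewrite hdot_sumr (bigD1 i) //= big1 ?addr0 ?hnorm_sqr // => j ji.
by rewrite oe // eq_sym.
Qed.

(** The components of v along om and b take lam^2 and a positive amount eta away
from |v|^2 = 2 lam^2; the vectors orthogonal to both see only what remains. *)
Lemma remaining_norm (v om b : H) (lam : R) :
  nm om = 1 -> '[b, om] = 0 -> nm v ^+ 2 = 2 * lam ^+ 2 -> '[v, om] = lam%:C ->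
  '[v, b] != 0 ->
  exists eta : R, [/\ 0 < eta, eta <= lam ^+ 2 & forall Y : H,
    '[Y, om] = 0 -> '[Y, b] = 0 -> (Re '[v, Y]) ^+ 2 <= (lam ^+ 2 - eta) * nm Y ^+ 2].
Proof.
move=> om1 bom v2 vom vb.
have b0 : b != 0 by apply: contra vb => /eqP ->; rewrite hdot0r.
have bp : 0 < nm b ^+ 2.
  rewrite exprn_gt0 // lt_def hnorm_ge0 andbT.
  by apply: contra b0 => /eqP/hnorm0_eq0 ->.
have nb0 : nm b != 0 by move: bp; rewrite lt_def sqrf_eq0 => /andP[].
have omb : '[om, b] = 0 by rewrite hdotC bom conjC0.
pose k := '[v, b] * ((nm b ^+ 2)^-1)%:C.
have kc : k^* = '[v, b]^* * ((nm b ^+ 2)^-1)%:C by rewrite /k rmorphM /=; congr (_ * _); rewrite conjCr.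
pose v0 := v - (lam%:C *: om + k *: b).
pose eta := normsq '[v, b] / nm b ^+ 2.
have v02 : nm v0 ^+ 2 = lam ^+ 2 - eta.
  rewrite hnormB_sqr v2 hdotDr !hdotZr vom conjCr.
  have -> : nm (lam%:C *: om + k *: b) ^+ 2 = lam ^+ 2 + eta.
    have h0 : Re '[lam%:C *: om, k *: b] = 0 by rewrite hdotZl hdotZr omb !mulr0.
    rewrite hnormD_sqr h0 mulr0 addr0.
    rewrite hnormZr exprMn om1 expr1n mulr1 real_normK ?num_real //; congr (_ + _).
    rewrite hnorm_sqr hdotZl hdotZr mulrA hdot_norm kc /k /eta.
    case: ('[v, b]) => x y /=.
    by rewrite /normsq /=; field.
  have -> : Re (lam%:C * lam%:C + k^* * '[v, b]) = lam ^+ 2 + eta.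
    rewrite kc /eta; case: ('[v, b]) => x y /=.
    by rewrite /normsq /=; field.
  ring.
exists eta; split.
- by rewrite divr_gt0 // lt_def normsq_ge0 andbT normsq_eq0.
- by rewrite -subr_ge0 -v02 sqr_ge0.
move=> Y Yom Yb; rewrite -v02.
have -> : '[v, Y] = '[v0, Y].
  rewrite /v0 hdotBl hdotDl !hdotZl (hdotC om) (hdotC b) Yom Yb conjC0.
  by rewrite !mulr0 addr0 subr0.
rewrite -exprMn -[leLHS]real_normK ?num_real //.
by rewrite lerXn2r ?nnegrE ?mulr_ge0 ?hnorm_ge0 // Re_hdot_le.
Qed.

(** At the limit G = F the inequality would read |F|^4 <= rho |F|^2, which
contradicts the assumption on rho.  The proof fixes a tolerance t for which the
strict inequality survives. *)
Lemma approx_contradiction (F : H) (rho : R) : 0 <= rho -> rho < nm F ^+ 2 ->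
  ~ (forall e : R, 0 < e -> exists2 G : H, nm (F - G) < e &
       normsq '[F, G] <= rho * nm G ^+ 2).
Proof.
move=> r0 rF h; set x := nm F in rF.
have x0 : 0 < x.
  rewrite lt_def hnorm_ge0 andbT; apply/eqP => e; move: rF; rewrite e expr0n.
  by rewrite ltNge r0.
pose c := rho / x ^+ 2.
have xx : 0 < x ^+ 2 by rewrite exprn_gt0.
have c0 : 0 <= c by rewrite divr_ge0 // ltW.
have c1 : c < 1 by rewrite ltr_pdivrMr // mul1r.
(* the estimate below is 1 - 2 t <= c + 3 t, so any divisor above 5 will do *)
pose t := (1 - c) / 8.
have t0 : 0 < t by rewrite divr_gt0 // subr_gt0.
have t1 : t <= 1 by rewrite /t; lra.
have [G FG FGr] := h (t * x) (mulr_gt0 t0 x0).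
have Gx : nm G <= x * (1 + t).
  have := hnormB F (F - G); rewrite opprB addrC subrK -/x => hG.
  by apply: (le_trans hG); rewrite mulrDr mulr1 lerD // mulrC ltW.
have reFG : x ^+ 2 * (1 - t) <= Re '[F, G].
  have -> : '[F, G] = '[F, F] - '[F, F - G] by rewrite hdotBr; ring.
  rewrite raddfB /= -hnorm_sqr -/x mulrBr mulr1 lerB //.
  apply: le_trans (ler_norm _) _; apply: le_trans (Re_hdot_le _ _) _.
  by rewrite expr2 -mulrA ler_wpM2l ?hnorm_ge0 // mulrC ltW.
have h1 : (x ^+ 2 * (1 - t)) ^+ 2 <= rho * (x * (1 + t)) ^+ 2.
  apply: le_trans (_ : normsq '[F, G] <= _).
    apply: le_trans (_ : Re '[F, G] ^+ 2 <= _).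
      have p0 : 0 <= x ^+ 2 * (1 - t) by rewrite mulr_ge0 ?subr_ge0 ?sqr_ge0.
      by apply: lerXn2r => //; rewrite nnegrE // (le_trans p0).
    by rewrite /normsq lerDl sqr_ge0.
  apply: le_trans FGr _; rewrite ler_wpM2l // lerXn2r ?nnegrE ?hnorm_ge0 //.
  by rewrite mulr_ge0 ?addr_ge0 ?hnorm_ge0 // ltW.
have rE : rho = c * x ^+ 2 by rewrite /c mulfVK // lt0r_neq0.
have h2 : (1 - t) ^+ 2 <= c * (1 + t) ^+ 2.
  have x4 : 0 < x ^+ 4 by rewrite exprn_gt0.
  rewrite -(ler_pM2l x4).
  have -> : x ^+ 4 * (1 - t) ^+ 2 = (x ^+ 2 * (1 - t)) ^+ 2 by ring.
  have -> // : x ^+ 4 * (c * (1 + t) ^+ 2) = rho * (x * (1 + t)) ^+ 2.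
  by rewrite rE; ring.
have h3 : c * (1 + t) ^+ 2 <= c + 3 * t.
  have : t ^+ 2 <= t by rewrite expr2 ler_piMr // ltW.
  have : c * t <= t by rewrite ler_piMl // ltW.
  move=> ct tt; have : c * t ^+ 2 <= t.
    by rewrite (le_trans _ tt) // ler_piMl ?sqr_ge0 // ltW.
  by move=> ctt; rewrite sqrrD expr1n mul1r !mulrDr mulr1 -mulr_natr; lra.
have h4 : 1 - 2 * t <= (1 - t) ^+ 2 by rewrite sqrrB expr1n mul1r; have := sqr_ge0 t; lra.
have := le_trans h4 (le_trans h2 h3).
have -> : c = 1 - 8 * t by rewrite /t; field.
lra.
Qed.
End HilbertBessel.

Section Core.
Context {R : realType} {A : tracialWspace R} {L : L2space A}.
Local Notation T := (measurableTypeR R).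
Local Notation M := (@nc_alg R A).
Local Notation "''[' u , v ]" := (hdot (L2hilbert L) u v).
Local Notation nm := (hnorm (@hdot R (L2hilbert L))).
Local Notation emb := (emb L).
Variables (N : set T -> ncop A) (hN : free_poisson_measure L N).
Variables (p : nat) (I : (p.+1.-tuple T -> R[i]) -> L) (hI : multiple_integral N I).
Variables (B : set T) (fB : finite_borel B) (nB : nat).
Hypothesis B_bounded : B `<=` [set t | (t : R) < nB%:R].
Local Notation q := p.+1.
Local Notation tup := (q.-tuple T).
Local Notation simple n P f a a' := (@simple R A N p B n P f a a').
Local Notation simplef n P f := (@simplef R A N p B n P f).
Local Notation lastB := (@lastB R p B).
Implicit Types (f g : tup -> R[i]).

Let MB : M (N B) := fpm_alg hN fB.

(** The parity of a code records membership in B, so this restriction keeps or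
drops whole boxes. *)
Lemma simple_lastB n P f a a' : simple n P f a a' -> simplef n P (lastB f).
Proof.
elim=> [|w uw Pw|k f1 g1 a1 a1' b1 b1' _ h1 _ h2].
- have -> : lastB (fun=> 0) = (fun=> 0).
    by apply/funext => t; rewrite /lastB mulr0.
  exact: simplef_0.
- rewrite lastB_box; case: ifP => _; last exact: simplef_0.
  by eexists; eexists; exact: simple_box.
- by rewrite lastB_lin; exact: simplef_lin.
Qed.

(** Only fine levels are kept: the trace formulas compare functions of the same
level, at which B must moreover be covered by the atoms. *)
Definition simple_elt n0 : set L :=
  [set u | exists n f a a', [/\ (n0 <= n)%N, simple n predT f a a' & u = emb a]].

Lemma simple_up n m P f a a' : (n <= m)%N -> simple n P f a a' ->
  simple m (P \o iter (m - n) coarser) f a a'.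
Proof. by move=> nm /(simple_refineD hN hI fB (m - n)); rewrite subnKC. Qed.

Lemma int_adherent n0 f : in_L2 f -> hadherent (simple_elt n0) (I f).
Proof.
move=> f2 e e0; have [_ h] := approx_L2 hN hI fB f2.
have [n [g [[a [a' s]] fg]]] := h e e0.
exists (I g) => //; exists (maxn n n0), g, a, a'; split; first exact: leq_maxr.
  exact: simple_up (leq_maxl _ _) s.
exact: simple_emb s.
Qed.

(** [simple_last], extended by continuity in each argument. *)
Lemma int_last f : in_L2 f -> '[I f, ract (N B) (I f)] = '[I f, I (lastB f)].
Proof.
move=> f2; have bR := ract_bounded L MB; have [C C0 hC] := bounded_opP bR.
have lB2 := lastB_L2 fB f2.
have half n c g c' : simple n predT g c c' ->
    '[I f, ract (N B) (emb c)] = '[I f, I (lastB g)].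
  move=> sc; apply: (hlip_eq_adherent (int_adherent (maxn n nB) f2)
    (hlip_dotl _) (hlip_dotl _)) => _ [m [g1 [a [a' [nm sa ->]]]]].
  have nm1 := leq_trans (leq_maxl _ _) nm.
  rewrite (simple_last hN hI fB _ sa (simple_up nm1 sc)); last first.
    apply: (subset_trans B_bounded) => t /= /lt_le_trans; apply.
    by rewrite ler_nat (leq_trans (leq_maxr _ _) nm).
  by rewrite (simple_emb hN hI fB sa).
apply/eqP; rewrite -subr_eq0; apply/eqP.
apply: (@complex_small _ _ (nm (I f) * C + nm (I f))) => e e0.
have [_ h] := approx_L2 hN hI fB f2.
have [n [g [[c [c' sc]] fg]]] := h e e0.
have g2 := simplef_L2 fB (ex_intro _ c (ex_intro _ c' sc)).
have -> : '[I f, ract (N B) (I f)] - '[I f, I (lastB f)] =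
   '[I f, ract (N B) (I f - I g)] - '[I f, I (lastB f) - I (lastB g)].
  rewrite (bopB bR) !hdotBr (simple_emb hN hI fB sc) (half _ _ _ _ sc); ring.
have lBg : I (lastB f) - I (lastB g) = I (lastB (fun t => f t - g t)).
  rewrite -(int_B hI) //; last exact: lastB_L2.
  by congr I; apply/funext => t; rewrite /lastB mulrBr.
apply: le_trans (ler_normB _ _) _; rewrite mulrDl rmorphD lerD //.
  apply: le_trans (cauchy_schwarz _ _) _; rewrite lecR -mulrA ler_wpM2l ?hnorm_ge0 //.
  by apply: le_trans (hC _) _; rewrite ler_wpM2l // ltW.
apply: le_trans (cauchy_schwarz _ _) _; rewrite lecR ler_wpM2l ?hnorm_ge0 // lBg.
apply: le_trans (lastB_le hI fB _) _; first exact: in_L2_B.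
by rewrite (int_B hI) // ltW.
Qed.

(** The product (I e)^* (I h) is orthogonal to F, Omega and N(B), and its pairing
with the square of F factorizes. *)
Section Tensor.
Variables (n : nat) (P P' : pred nat) (h e : tup -> R[i]) (c c' d d' : ncop A).
Hypotheses (PP' : forall k, P k -> ~~ P' k)
  (sc : simple n P h c c') (sd : simple n P' e d d').

Let Mc : M c. Proof. by case: (simple_alg hN fB sc). Qed.
Let Mc' : M c'. Proof. by case: (simple_alg hN fB sc). Qed.
Let cc' : is_adjoint c c'. Proof. by case: (simple_alg hN fB sc). Qed.
Let Md : M d. Proof. by case: (simple_alg hN fB sd). Qed.
Let Md' : M d'. Proof. by case: (simple_alg hN fB sd). Qed.
Let dd' : is_adjoint d d'. Proof. by case: (simple_alg hN fB sd). Qed.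

Let PP'_up m k : (P \o iter m coarser) k -> ~~ (P' \o iter m coarser) k.
Proof. exact: PP'. Qed.

Lemma tensor_ract f : in_L2 f ->
  '[I f, ract (d' \o c) (I f)] = '[I f, emb c] * '[emb d, I f].
Proof.
move=> f2; have My := alg_comp Md' Mc; have bR := ract_bounded L My.
have half m g a a' : simple m predT g a a' ->
    '[I f, ract (d' \o c) (emb a)] = '[I f, emb c] * '[emb d, emb a].
  move=> sa; have lr : hlip (fun u : L => '[u, emb c] * '[emb d, emb a]).
    have := hlip_scale ('[emb d, emb a]) (hlip_dotl (emb c)).
    by congr hlip; apply/funext => u; rewrite mulrC.
  apply: (hlip_eq_adherent (int_adherent (maxn n m) f2) (hlip_dotl _) lr).
  move=> _ [l [g1 [b [b' [nl sb ->]]]]].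
  have nl1 := leq_trans (leq_maxl _ _) nl; have nl2 := leq_trans (leq_maxr _ _) nl.
  have [Ma Ma' aa'] := simple_alg hN fB sa; have [Mb _ _] := simple_alg hN fB sb.
  have := simple_tensor hN fB (@PP'_up (l - n)) sb (simple_up nl2 sa)
    (simple_up nl1 sc) (simple_up nl1 sd) => <-.
  rewrite ract_emb // !lact_emb //.
  rewrite (embdot L Mb (alg_comp Ma My)
    (is_adjoint_comp aa' (is_adjoint_comp (is_adjointC dd') cc'))).
  by rewrite (embdot L (alg_comp Ma' Mb) My (is_adjoint_comp (is_adjointC dd') cc')).
apply: (hlip_eq_adherent (int_adherent 0 f2) (hlip_opr bR _)
  (hlip_scale _ (hlip_dotr _))) => _ [m [g [a [a' [_ sa ->]]]]].
exact: half sa.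
Qed.

Lemma tensor_orth f : in_L2 f -> '[I f, emb (d' \o c)] = 0.
Proof.
move=> f2; apply: (hlip_eq_adherent (int_adherent n f2) (hlip_dotl _) (@hlip_cst _ _ 0)).
move=> _ [l [g1 [b [b' [nl sb ->]]]]].
have := simple_triple hN fB (@PP'_up (l - n)) sb (simple_up nl sc) (simple_up nl sd).
by rewrite lact_emb.
Qed.

Lemma tensor_om : '[emb (d' \o c), emb id] = 0.
Proof.
rewrite (embdot L (alg_comp Md' Mc) (@alg_id R A) (@is_adjoint_id _ _)).
have := simple_orth hN fB PP' sc sd; rewrite (embdot L Mc Md dd'); exact.
Qed.

Lemma tensor_NB : (nB <= n)%N -> '[emb (d' \o c), emb (N B)] = 0.
Proof.
move=> nBn; have sB := fpm_sa hN fB.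
rewrite (embdot L (alg_comp Md' Mc) MB sB).
have Bn : B `<=` [set t | (t : R) < n%:R].
  apply: (subset_trans B_bounded) => t /= /lt_le_trans; apply; by rewrite ler_nat.
have := simple_last hN hI fB Bn sc sd; rewrite ract_emb //.
rewrite (embdot L Mc (alg_comp Md MB) (is_adjoint_comp dd' sB)) => ->.
have [b [b' sb]] := simple_lastB sd.
rewrite (simple_emb hN hI fB sc) (simple_emb hN hI fB sb).
exact: simple_orth PP' sc sb.
Qed.
End Tensor.

Lemma int_sum n (F : nat -> tup -> R[i]) : (forall k, in_L2 (F k)) ->
  in_L2 (fun t => \sum_(k < n) 1 * F k t) /\
  I (fun t => \sum_(k < n) 1 * F k t) = \sum_(k < n) I (F k).
Proof.
move=> F2; elim: n => [|n [ih1 ih2]].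
  have -> : (fun t => \sum_(k < 0) 1 * F k t) = (fun=> 0).
    by apply/funext => t; rewrite big_ord0.
  by rewrite big_ord0 (int_0 hI); split=> //; exact: in_L2_0.
have -> : (fun t => \sum_(k < n.+1) 1 * F k t) =
    (fun t => 1 * F n t + \sum_(k < n) 1 * F k t).
  by apply/funext => t; rewrite big_ord_recr addrC.
rewrite big_ord_recr /= (int_lin hI) // ih2 scale1r addrC; split=> //.
exact: in_L2_lin.
Qed.

Section Main.
Variables (f : tup -> R[i]) (lambda : R) (w : L).
Hypotheses (f2 : in_L2 f) (l0 : 0 < lambda)
  (hw : forall y, M y -> '[w, emb y] = '[I f, ract y (I f)])
  (F2 : nm (I f) ^+ 2 = lambda) (Fom : '[I f, emb id] = 0)
  (wF : nm (w - I f) ^+ 2 = 2 * lambda ^+ 2).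
Let F := I f.

(** Lower bound for the part of v = w - F of order 2q.  Here Y is the sum over
k <> l of (I g_l)^* (I g_k); the excluded terms k = l, where contractions would
occur, contribute at most e once the grid is fine. *)
Lemma top_chaos_bound (rho : R) n0 g a a' : simple n0 predT g a a' ->
  (forall Y : L, '[Y, emb id] = 0 -> '[Y, emb (N B)] = 0 ->
     (Re '[w - F, Y]) ^+ 2 <= rho * nm Y ^+ 2) -> 0 <= rho ->
  normsq '[F, emb a] <= Num.sqrt rho * nm (emb a) ^+ 2.
Proof.
move=> sg hY r0; have [K K0 hK] := slab_small hI fB sg.
apply/ler_addgt0Pl => e e0.
(* a grid so fine that every slab of g has small norm *)
have [m [mn mB me]] : exists m, [/\ (n0 <= m)%N, (nB <= m)%N & K / 2 ^+ m * lambda <= e].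
  have [m1 _ h1] : \forall m \near \oo, 1 <= 2 ^+ m * (e / (K * lambda + 1)).
    by apply: near_pow2_ge; rewrite divr_gt0 // ltr_wpDl // mulr_ge0 // ltW.
  exists (maxn m1 (maxn n0 nB)); split; rewrite ?leq_max ?leqnn ?orbT //.
  have := h1 _ (leq_maxl m1 (maxn n0 nB)); set j := maxn _ _ => /= h2.
  have p2 : 0 < 2 ^+ j :> R by rewrite exprn_gt0.
  have kl : 0 < K * lambda + 1 by rewrite ltr_wpDl // mulr_ge0 // ltW.
  rewrite mulrAC ler_pdivrMr //; move: h2; rewrite mulrA ler_pdivlMr // mul1r.
  by move=> h2; rewrite (mulrC e); apply: le_trans h2; rewrite lerDl.
have sgm := simple_up mn sg.
pose gk (k : nat) (t : tup) : R[i] := \1_(atom B m k) (thead t) * g t.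
have slab k : {cc : ncop A * ncop A | simple m (pred1 k) (gk k) cc.1 cc.2}.
  apply: cid; have [c [c' s]] := simple_slab k sgm; by exists (c, c').
pose c k := (sval (slab k)).1; pose c' k := (sval (slab k)).2.
have sc k : simple m (pred1 k) (gk k) (c k) (c' k) by exact: svalP (slab k).
have ne (k l : nat) : k != l -> forall j : nat, pred1 k j -> ~~ pred1 l j.
  by move=> kl j /= /eqP ->.
have Mc k : M (c k) by case: (simple_alg hN fB (sc k)).
have Mc' k : M (c' k) by case: (simple_alg hN fB (sc k)).
pose e_ (k : 'I_(natoms m)) : L := emb (c k).
have eI (k : 'I_(natoms m)) : e_ k = I (gk k) by rewrite (simple_emb hN hI fB (sc k)).
have orth (i j : 'I_(natoms m)) : i != j -> '[e_ i, e_ j] = 0.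
  by move=> ij; have := simple_orth hN fB (ne i j ij) (sc i) (sc j).
have sume : emb a = \sum_k e_ k.
  rewrite -(simple_emb hN hI fB sg).
  have -> : g = (fun t => \sum_(k < natoms m) 1 * gk k t).
    apply/funext => t; have [C C0 hC] := simple_bound sgm.
    have [ct|nct] := pselect (@cube R q m t); last first.
      have gt : g t = 0.
        apply/eqP; rewrite -normsq_eq0 eq_le normsq_ge0 andbT.
        by have := hC t; rewrite indicE memNset // mulr0.
      by rewrite gt; apply/esym/big1 => k _; rewrite /gk gt !mulr0.
    have /andP[t0 tm] := ct ord0.
    have tk : (code B m (thead t) < natoms m)%N by rewrite code_lt.
    rewrite (bigD1 (Ordinal tk)) //= big1 ?addr0.
      by rewrite mul1r /gk indicE mem_set ?mul1r //; split.
    move=> k kt; rewrite mul1r /gk indicE memNset ?mul0r // => -[_ h].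
    by case/eqP: kt; apply: val_inj; rewrite /= h.
  have gk2 k : in_L2 (gk k) by apply: (simplef_L2 fB (ex_intro _ _ (ex_intro _ _ (sc k)))).
  have [_ ->] := int_sum (natoms m) gk2.
  by apply: eq_bigr => k _; rewrite eI.
pose s k := nm (e_ k) ^+ 2.
have s0 k : 0 <= s k by exact: sqr_ge0.
have sK k : s k <= K / 2 ^+ m by rewrite /s eI; exact: hK.
have sum_s : \sum_k s k = nm (emb a) ^+ 2 by rewrite sume pythagoras.
pose z k := '[F, e_ k].
pose D (k l : 'I_(natoms m)) : L := emb (c' l \o c k).
pose Y : L := \sum_k \sum_(l | l != k) D k l.
have Yom : '[Y, emb id] = 0.
  rewrite hdot_suml big1 // => k _; rewrite hdot_suml big1 // => l lk.
  by apply: (tensor_om (ne k l _) (sc k) (sc l)); rewrite eq_sym.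
have YNB : '[Y, emb (N B)] = 0.
  rewrite hdot_suml big1 // => k _; rewrite hdot_suml big1 // => l lk.
  by apply: (tensor_NB (ne k l _) (sc k) (sc l) mB); rewrite eq_sym.
have vY : Re '[w - F, Y] = normsq (\sum_k z k) - \sum_k normsq (z k).
  have -> : '[w - F, Y] = \sum_k \sum_(l | l != k) z k * (z l)^*.
    rewrite hdot_sumr; apply: eq_bigr => k _; rewrite hdot_sumr.
    apply: eq_bigr => l lk; rewrite eq_sym in lk.
    rewrite hdotBl (tensor_orth (ne k l lk) (sc k) (sc l) f2) subr0.
    rewrite hw; last exact: alg_comp.
    by rewrite (tensor_ract (ne k l lk) (sc k) (sc l) f2) -(hdotC (e_ l)).
  have -> : \sum_k \sum_(l | l != k) z k * (z l)^*
      = (\sum_k z k) * (\sum_k z k)^* - \sum_k z k * (z k)^*.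
    rewrite mulr_suml -sumrB; apply: eq_bigr => k _.
    by rewrite rmorph_sum mulr_sumr [in RHS](bigD1 k) //= addrAC subrr add0r.
  rewrite raddfB /= Re_mul_conj raddf_sum; congr (_ - _).
  by apply: eq_bigr => k _; exact: Re_mul_conj.
have Y2 : nm Y ^+ 2 <= (nm (emb a) ^+ 2) ^+ 2.
  have -> : nm Y ^+ 2 = \sum_k \sum_(l | l != k) s k * s l.
    rewrite hnorm_sqr hdot_suml raddf_sum; apply: eq_bigr => k _ /=.
    rewrite hdot_suml raddf_sum; apply: eq_bigr => l lk /=.
    have DD (i j : 'I_(natoms m)) : j != i ->
        '[D k l, D i j] = '[e_ k, e_ i] * '[e_ j, e_ l].
      move=> ji; rewrite eq_sym in ji.
      have := simple_tensor hN fB (ne i j ji) (sc k) (sc l) (sc i) (sc j).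
      by rewrite !lact_emb.
    have -> : '[D k l, Y] = '[D k l, D k l].
      rewrite /Y hdot_sumr [LHS](bigD1 k) //= [X in _ + X]big1 ?addr0.
        rewrite hdot_sumr [LHS](bigD1 l) //= [X in _ + X]big1 ?addr0 //.
        by move=> j /andP[jk jl]; rewrite DD // [X in _ * X]orth ?mulr0.
      move=> i ik; rewrite hdot_sumr big1 // => j ji.
      by rewrite DD // orth ?mul0r // eq_sym.
    by rewrite DD // !hdot_norm -rmorphM /= /s.
  rewrite -sum_s expr2 mulr_suml; apply: ler_sum => k _.
  by rewrite mulr_sumr [leRHS](bigD1 k) //= lerDr mulr_ge0.
have Kz : \sum_k normsq (z k) <= e.
  apply: le_trans me; rewrite -F2; apply: bessel => //.
  by rewrite divr_ge0 ?exprn_ge0.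
have zs : \sum_k z k = '[F, emb a].
  by rewrite sume hdot_sumr.
have h : Re '[w - F, Y] <= Num.sqrt rho * nm (emb a) ^+ 2.
  apply: le_trans (ler_norm _) _.
  rewrite -ler_sqr ?nnegrE ?mulr_ge0 ?sqrtr_ge0 ?sqr_ge0 // exprMn sqr_sqrtr //.
  rewrite real_normK ?num_real //.
  by apply: le_trans (hY Y Yom YNB) _; rewrite ler_wpM2l.
move: h; rewrite vY zs => h.
move: Kz h; lra.
Qed.

(** If v had a component along N(B), the remaining square norm would be below
lambda^2, and letting g tend to f in [top_chaos_bound] would give
lambda^2 <= lambda sqrt(lambda^2 - eta). *)
Lemma law_Z_last : '[F, emb (N B)] = '[F, I (lastB f)].
Proof.
rewrite -(int_last f2) -hw; last exact: MB.
apply/eqP; rewrite eq_sym -subr_eq0 -hdotBl; apply: contraT => vb.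
have Mid := @alg_id R A.
have om1 : nm (emb id : L) = 1 by exact: hnorm_emb_id.
have NBom : '[emb (N B), emb id] = 0.
  rewrite (embdot L MB Mid (@is_adjoint_id _ _)).
  by case: (fpm_moments hN fB).
have vom : '[w - F, emb id] = lambda%:C.
  by rewrite hdotBl Fom subr0 hw // ract_id hdot_norm F2.
have [eta [eta0 etal hY]] := remaining_norm om1 NBom wF vom vb.
have r0 : 0 <= lambda ^+ 2 - eta by rewrite subr_ge0.
exfalso; apply: (@approx_contradiction _ _ F (Num.sqrt (lambda ^+ 2 - eta))).
- exact: sqrtr_ge0.
- rewrite F2 -[ltRHS](ger0_norm (ltW l0)) -sqrtr_sqr ltr_sqrt ?exprn_gt0 //.
  by rewrite ltrBlDr ltrDl.
move=> e e0; have [_ h] := approx_L2 hN hI fB f2.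
have [n [g [[a [a' sg]] fg]]] := h e e0.
rewrite (simple_emb hN hI fB sg) in fg; exists (emb a) => //.
exact: top_chaos_bound sg hY r0.
Qed.
End Main.
End Core.

(** * Chaoses of order at least two and of order one *)

Section Consequences.
Context {R : realType} {A : tracialWspace R} {L : L2space A}.
Local Notation T := (measurableTypeR R).
Local Notation "''[' u , v ]" := (hdot (L2hilbert L) u v).
Local Notation nm := (hnorm (@hdot R (L2hilbert L))).
Local Notation emb := (emb L).
Variables (N : set T -> ncop A) (hN : free_poisson_measure L N).

Lemma side_finite (K : nat) : finite_borel [set x : T | 0 <= (x : R) < K%:R].
Proof.
split; first exact: side_measurable; first by move=> x /= /andP[].
by rewrite lebesgue_side ltry.
Qed.

Section AnyOrder.
Variables (p : nat) (I : (p.+1.-tuple T -> R[i]) -> L) (hI : multiple_integral N I).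
Local Notation q := p.+1.
Local Notation tup := (q.-tuple T).
Implicit Types (f g : tup -> R[i]) (B : set T).

(** Orthogonality of the chaoses of order one and of order q >= 2. *)
Lemma int_NB B f (nB : nat) : (1 <= p)%N -> finite_borel B ->
  B `<=` [set t | (t : R) < nB%:R] -> in_L2 f -> '[I f, emb (N B)] = 0.
Proof.
move=> p1 fB Bn f2.
apply: (hlip_eq_adherent (int_adherent hN hI fB nB f2) (hlip_dotl _) (@hlip_cst _ _ 0)).
move=> _ [m [g [a [a' [nm sa ->]]]]]; apply: (simple_first_chaos hN fB _ p1 sa).
by apply: (subset_trans Bn) => t /= /lt_le_trans; apply; rewrite ler_nat.
Qed.

Lemma int_lastB_norm B f : finite_borel B -> in_L2 f ->
  Re '[I f, I (lastB B f)] = nm (I (lastB B f)) ^+ 2.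
Proof.
move=> fB f2; have l2 := lastB_L2 fB f2.
rewrite hnorm_sqr !(int_dot hI) //=; apply: eq_Rintegral => t _; congr Re.
rewrite /lastB indicE; case: (_ \in B); rewrite ?mul1r // !mul0r conjC0 mulr0.
by [].
Qed.

(** A simple function close to f vanishes when its last variable is large, so it
is close to zero with f restricted in that variable. *)
Lemma lastB_all_0 f : in_L2 f ->
  (forall K : nat, I (lastB [set x : T | 0 <= (x : R) < K%:R] f) = 0) -> I f = 0.
Proof.
move=> f2 h; apply: hnorm0_eq0; apply/eqP; rewrite eq_le hnorm_ge0 andbT.
apply/ler_addgt0Pl => e e0; rewrite addr0.
have e2 : 0 < e / 2 by rewrite divr_gt0.
have fS := side_finite 0.
have [_ /(_ _ e2) [n [g [[a [a' sg]] fg]]]] := approx_L2 hN hI fS f2.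
have g2 := simplef_L2 fS (ex_intro _ _ (ex_intro _ _ sg)).
have fB := side_finite n.
have gE : lastB [set x : T | 0 <= (x : R) < n%:R] g = g.
  apply/funext => t; rewrite /lastB indicE; have [C C0 hC] := simple_bound sg.
  have [tn|tn] := pselect (0 <= (tnth t ord_max : R) < n%:R); first by rewrite mem_set ?mul1r.
  have := hC t; rewrite indicE memNset; last by move=> /(_ ord_max).
  rewrite mulr0 => g0; have /eqP -> : g t == 0 by rewrite -normsq_eq0 eq_le g0 normsq_ge0.
  by rewrite mulr0.
have gle : nm (I g) <= e / 2.
  apply: le_trans (ltW fg); rewrite hnormB_sym -[X in nm X <= _]subr0 -(h n) -{1}gE.
  have lg2 := lastB_L2 fB g2; have lf2 := lastB_L2 fB f2.
  rewrite -!(int_B hI) //.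
  have -> : (fun t => lastB [set x : T | 0 <= (x : R) < n%:R] g t -
      lastB [set x : T | 0 <= (x : R) < n%:R] f t) =
      lastB [set x : T | 0 <= (x : R) < n%:R] (fun t => g t - f t).
    by apply/funext => t; rewrite /lastB mulrBr.
  exact: (lastB_le hI fB (in_L2_B g2 f2)).
have := hnormD (I f - I g) (I g); rewrite subrK => hf.
by apply: (le_trans hf); rewrite [leRHS](splitr e) lerD // ltW.
Qed.

Lemma law_Z_int_last f (lambda : R) B (nB : nat) : in_L2 f -> 0 < lambda ->
  has_law_Z (I f) lambda -> finite_borel B -> B `<=` [set t | (t : R) < nB%:R] ->
  '[I f, emb (N B)] = '[I f, I (lastB B f)].
Proof.
move=> f2 l0 law fB Bn; have [w [hw F2 Fom _ wF]] := law_Z_square law.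
exact: (law_Z_last hN hI fB Bn f2 l0 hw F2 Fom wF).
Qed.

(** Here <F, N(B)> = 0, so the integral of |f|^2 over {t_q in B} vanishes for
every bounded interval B = [0, K[. *)
Lemma higher_chaos_not_Z f (lambda : R) : (1 <= p)%N -> in_L2 f -> 0 < lambda ->
  I f <> 0 -> ~ has_law_Z (I f) lambda.
Proof.
move=> p1 f2 l0 F0 law; apply: F0; apply: lastB_all_0 => // K.
have fB := side_finite K; apply: hnorm0_eq0; apply/eqP; rewrite -sqrf_eq0.
have KB : [set x : T | 0 <= (x : R) < K%:R] `<=` [set t | (t : R) < K%:R].
  by move=> t /= /andP[].
rewrite -(int_lastB_norm fB f2) -(law_Z_int_last f2 l0 law fB KB).
by rewrite (int_NB p1 fB KB f2).
Qed.
End AnyOrder.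

Section FirstChaos.
Variables (I : (1.-tuple T -> R[i]) -> L) (hI : multiple_integral N I).
Local Notation tup := (1.-tuple T).
Local Notation Dq := (@orthant R 1).
Local Notation muq := (@lebesgue_pow R 1).
Implicit Types (f g : tup -> R[i]).

Lemma tuple1E (t : tup) : t = [tuple tnth t ord0].
Proof. by apply: eq_from_tnth => i; rewrite (ord1 i). Qed.

Lemma measurable_tuple1 : measurable_fun setT (fun x : T => [tuple x]).
Proof.
apply/measurable_fun_tnthP => i; rewrite (ord1 i).
by have -> : @tnth 1 T ^~ ord0 \o (fun x => [tuple x]) = id by apply/funext.
Qed.

Definition side_of (E : set tup) : set T := [set x | E [tuple x]].

Lemma side_of_measurable E : measurable E -> measurable (side_of E).
Proof.
by move=> mE; rewrite -[X in measurable X]setTI; exact: measurable_tuple1.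
Qed.

Lemma indic_side_of (E : set tup) (t : tup) i : \1_(side_of E) (tnth t i) = \1_E t :> R[i].
Proof.
rewrite (ord1 i) !indicE; congr (nat_of_bool _)%:R.
by rewrite [in RHS](tuple1E t); apply/idP/idP => /set_mem h; apply/mem_set.
Qed.

Lemma lebesgue_side_of E : measurable E ->
  lebesgue_pow R 1 E = lebesgue_measure (side_of E).
Proof.
move=> mE; have := lebesgue_pow_cons (side_of_measurable mE) (@measurableT _ (0.-tuple T)).
have -> : [set t : tup | side_of E (thead t) /\ [set: 0.-tuple T] [tuple of behead t]] = E.
  by apply/seteqP; split=> t; rewrite /side_of /= /thead -tuple1E //; case.
by rewrite /= diracT mul1e.
Qed.

Lemma int_side_of E : finite_borel (side_of E) -> I (\1_E) = emb (N (side_of E)).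
Proof.
move=> fB; case: (hI) => _ h _.
have := h (fun=> side_of E) (fun=> fB).
have -> : (fun t : tup => \prod_(i < 1) \1_(side_of E) (tnth t i) : R[i]) = \1_E.
  by apply/funext => t; rewrite big_ord_recl big_ord0 mulr1 indic_side_of.
move=> -> //; last by move=> i j; rewrite (ord1 i) (ord1 j) eqxx.
congr emb; have : size (enum 'I_1) = 1%N by rewrite size_enum_ord.
by case: (enum 'I_1) => [|x [|y s]].
Qed.

Lemma cube_le_integrable f K (u : tup -> R) : in_L2 f -> measurable_fun Dq u ->
  (forall t, `|u t| <= 1 + normsq (f t)) -> muq.-integrable (@cube R 1 K) (EFin \o u).
Proof.
move=> f2 mu uf; have mD := @orthant_measurable R 1; have mc := @cube_measurable R 1 K.
have cD : @cube R 1 K `<=` Dq by move=> t h i; have /andP[] := h i.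
have i1 : muq.-integrable (@cube R 1 K) (EFin \o (fun t => normsq (f t))).
  apply: (integrableS mD mc cD); apply/integrableP; split.
    exact: measurable_normsq f2.1.
  under eq_integral do rewrite /= ger0_norm ?normsq_ge0 //.
  exact: f2.2.
have i2 : muq.-integrable (@cube R 1 K) (EFin \o (fun=> 1 : R)).
  apply/integrableP; split; first exact: measurable_cst.
  under eq_integral do rewrite /= normr1.
  by rewrite integral_cst // mul1e lebesgue_pow_cube ltry.
have := integrableD mc i2 i1; apply: le_integrable => //.
  by apply/measurable_EFinP; exact: measurable_funS mu.
move=> t _ /=; rewrite lee_fin (le_trans (uf t)) // ler_norm //.
Qed.

(** The identity <F, N(B)> = int_B |f|^2 has left side int_B f.  Since B is
arbitrary, f = |f|^2 almost everywhere: f is real and f^2 = f. *)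
Lemma law_Z_first_chaos f (lambda : R) : in_L2 f -> 0 < lambda ->
  has_law_Z (I f) lambda ->
  {ae muq, forall t, Dq t -> f t = 0 \/ f t = 1}.
Proof.
move=> f2 l0 law; have mD := @orthant_measurable R 1; have [mr mi] := f2.1.
have cD K : @cube R 1 K `<=` Dq by move=> t h i; have /andP[] := h i.
have sq (x y : R) : `|x| <= 1 + (x ^+ 2 + y ^+ 2).
  have := sqr_ge0 (1 - `|x|); rewrite sqrrB expr1n mul1r real_normK ?num_real //.
  by have := sqr_ge0 y; have := sqr_ge0 x; lra.
(* the identity against the indicators of the subsets of a cube *)
have key K E : measurable E -> E `<=` @cube R 1 K ->
    (\int[muq]_(t in E) Re (f t) = \int[muq]_(t in E) normsq (f t)) /\
    (\int[muq]_(t in E) Im (f t) = 0).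
  move=> mE EK; have mB := side_of_measurable mE.
  have BK : side_of E `<=` [set x | 0 <= (x : R) < K%:R].
    by move=> x /EK /(_ ord0).
  have fB : finite_borel (side_of E).
    split=> // [x /BK /andP[]//|].
    apply: (@le_lt_trans _ _ (lebesgue_measure [set x : T | 0 <= (x : R) < K%:R])).
      by apply: le_measure; rewrite ?inE //; exact: side_measurable.
    by rewrite lebesgue_side ltry.
  have Bn : side_of E `<=` [set t | (t : R) < K%:R] by move=> x /BK /andP[].
  have := law_Z_int_last hI f2 l0 law fB Bn.
  rewrite -int_side_of //; have E2 := in_L2_indicator mE EK.
  have lE : lastB (side_of E) f = (fun t => \1_E t * f t).
    by apply/funext => t; rewrite /lastB indic_side_of.
  rewrite lE !(int_dot hI) //; last exact: in_L2_indic.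
  have DE : Dq `&` E = E by apply: setIidr; exact: subset_trans EK (cD K).
  move=> [hr him]; split.
    have := hr.
    have -> : \int[muq]_(t in Dq) Re (f t * (\1_E t)^*) = \int[muq]_(t in E) Re (f t).
      rewrite -[in RHS]DE Rintegral_mkcondr; apply: eq_Rintegral => t _.
      rewrite patchE indicE; case: (t \in E); first by rewrite conjC1 mulr1.
      by rewrite conjC0 mulr0.
    have -> // : \int[muq]_(t in Dq) Re (f t * (\1_E t * f t)^*) = \int[muq]_(t in E) normsq (f t).
    rewrite -[in RHS]DE Rintegral_mkcondr; apply: eq_Rintegral => t _.
    rewrite patchE indicE; case: (t \in E); first by rewrite mul1r Re_mul_conj.
    by rewrite mul0r conjC0 mulr0.
  have := him.
  have -> : \int[muq]_(t in Dq) Im (f t * (\1_E t)^*) = \int[muq]_(t in E) Im (f t).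
    rewrite -[in RHS]DE Rintegral_mkcondr; apply: eq_Rintegral => t _.
    rewrite patchE indicE; case: (t \in E); first by rewrite conjC1 mulr1.
    by rewrite conjC0 mulr0.
  move=> ->.
  have -> : \int[muq]_(t in Dq) Im (f t * (\1_E t * f t)^*) = \int[muq]_(t in Dq) (fun=> 0) t.
    apply: eq_Rintegral => t _; rewrite indicE; case: (t \in E).
      by rewrite mul1r; case: (f t) => x y /=; ring.
    by rewrite mul0r conjC0 mulr0.
  by rewrite /Rintegral integral0_eq.
have aeK K : {ae muq, forall t, @cube R 1 K t -> Re (f t) = normsq (f t) /\ Im (f t) = 0}.
  have mc := @cube_measurable R 1 K.
  have ir : muq.-integrable (@cube R 1 K) (EFin \o (fun t => Re (f t))).
    by apply: (cube_le_integrable K f2 mr) => t; exact: sq.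
  have ii : muq.-integrable (@cube R 1 K) (EFin \o (fun t => Im (f t))).
    by apply: (cube_le_integrable K f2 mi) => t; rewrite /normsq addrC [_ + _ ^+ 2]addrC addrC; exact: sq.
  have iN : muq.-integrable (@cube R 1 K) (EFin \o (fun t => normsq (f t))).
    apply: (cube_le_integrable K f2).
      by apply/measurable_EFinP; exact: measurable_normsq f2.1.
    by move=> t; rewrite ger0_norm ?normsq_ge0 // lerDr.
  have toE (u : tup -> R) E : muq.-integrable (@cube R 1 K) (EFin \o u) ->
      measurable E -> E `<=` @cube R 1 K ->
      (\int[muq]_(t in E) (u t)%:E)%E = (\int[muq]_(t in E) u t)%:E.
    move=> iu mE EK; rewrite /Rintegral fineK //.
    by apply: integrable_fin_num => //; exact: integrableS iu.
  have a1 : ae_eq muq (@cube R 1 K) (EFin \o (fun t => Re (f t))) (EFin \o (fun t => normsq (f t))).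
    apply: (integral_ae_eq mc ir) => [|E EK mE]; first by case/integrableP: iN.
    rewrite [LHS](toE _ _ ir mE EK) [RHS](toE _ _ iN mE EK).
    by have [-> _] := key K E mE EK.
  have a2 : ae_eq muq (@cube R 1 K) (EFin \o (fun t => Im (f t))) (EFin \o (fun=> 0)).
    apply: (integral_ae_eq mc ii) => [|E EK mE]; first exact: measurable_cst.
    rewrite [LHS](toE _ _ ii mE EK).
    by have [_ ->] := key K E mE EK; rewrite integral0_eq.
  near=> t => ct; split.
    have : @cube R 1 K t -> (EFin \o (fun t => Re (f t))) t = (EFin \o (fun t => normsq (f t))) t.
      by near: t; exact: a1.
    by move=> /(_ ct) [].
  have : @cube R 1 K t -> (EFin \o (fun t => Im (f t))) t = (EFin \o (fun=> 0 : R)) t.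
    by near: t; exact: a2.
  by move=> /(_ ct) [].
have := ae_foralln aeK.
apply: filterS => t h Dt.
have /h[] : @cube R 1 (Num.trunc (tnth t ord0 : R)).+1 t.
  by move=> i; rewrite (ord1 i) truncnS_gt andbT; exact: Dt.
rewrite /normsq; case: (f t) => x y /= xE y0; rewrite y0 in xE *.
have /eqP : x * (x - 1) = 0 by rewrite mulrBr mulr1 [X in _ - X]xE; ring.
rewrite mulf_eq0 subr_eq0 => /orP[/eqP -> |/eqP ->]; by [left|right].
Unshelve. all: end_near.
Qed.

(** The integral of the indicator of B is N(B), and mu(B) = |f|^2 = lambda. *)
Lemma indicator_law_Z f (lambda : R) : in_L2 f -> 0 < lambda ->
  norm2sq f = lambda%:E -> {ae muq, forall t, Dq t -> f t = 0 \/ f t = 1} ->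
  has_law_Z (I f) lambda.
Proof.
move=> f2 l0 fl f01; have mD := @orthant_measurable R 1; have [mr mi] := f2.1.
pose E : set tup := Dq `&` [set t | f t = 1].
have mE : measurable E.
  have -> : E = (Dq `&` (fun t => Re (f t)) @^-1` [set 1])
     `&` (Dq `&` (fun t => Im (f t)) @^-1` [set 0]).
    apply/seteqP; split=> t /=; first by move=> [Dt ->].
    move=> [[Dt h1] [_ h2]]; split=> //.
    by move: h1 h2; rewrite /=; case: (f t) => x y /= -> ->.
  by apply: measurableI; [apply: mr|apply: mi] => //; exact: measurable_set1.
have ED : E `<=` Dq by move=> t [].
have ae0 : {ae muq, forall t, Dq t -> f t = \1_E t}.
  apply: filterS f01 => t h Dt; rewrite indicE; case: (h Dt) => ft.
    by rewrite memNset // => -[_]; rewrite /= ft => /eqP; rewrite eq_sym oner_eq0.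
  by rewrite mem_set.
have m1 := measurable_complex_indicator mE.
have nE : norm2sq (\1_E : tup -> R[i]) = lambda%:E.
  rewrite -fl !norm2sqE; apply: ge0_ae_eq_integral => //.
  - exact: measurable_normsq.
  - exact: measurable_normsq f2.1.
  - by move=> t _; rewrite lee_fin normsq_ge0.
  - by move=> t _; rewrite lee_fin normsq_ge0.
  by apply: filterS ae0 => t h Dt; rewrite h.
have muE : lebesgue_measure (side_of E) = lambda%:E.
  rewrite -lebesgue_side_of // -nE norm2sqE.
  under eq_integral do rewrite indicE normsq_bool -indicE.
  by rewrite integral_indic // (setIidl ED).
have fB : finite_borel (side_of E).
  split; first exact: side_of_measurable.
    by move=> x [/(_ ord0)].
  by rewrite muE ltry.
have E2 : in_L2 (\1_E : tup -> R[i]) by split=> //; rewrite nE ltry.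
have -> : I f = emb (N (side_of E)).
  rewrite -int_side_of //; apply/eqP; rewrite -subr_eq0; apply/eqP/hnorm0_eq0/eqP.
  rewrite -sqrf_eq0 -eqe -(int_B hI) // (int_norm hI); last exact: in_L2_B.
  rewrite norm2sqE; apply/eqP.
  transitivity (\int[muq]_(t in Dq) (cst 0%E t))%E; last by rewrite integral0_eq.
  apply: ge0_ae_eq_integral => //.
  - by apply: measurable_normsq; apply: (in_L2_B f2 E2).1.
  - by move=> t _; rewrite lee_fin normsq_ge0.
  apply: filterS ae0 => t h Dt; rewrite h // subrr.
  by rewrite /normsq /= expr0n addr0.
have := (let: And5 _ h _ _ _ := hN in h) _ fB.
by rewrite muE lte_fin; apply.
Qed.
End FirstChaos.
End Consequences.

Theorem corollary1p6 (R : realType) (A : tracialWspace R) (L : L2space A)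
    (N : set (measurableTypeR R) -> ncop A)
    (I : forall q : nat, (q.-tuple (measurableTypeR R) -> R[i]) -> L)
    (hN : free_poisson_measure L N)
    (hI : forall q : nat, (1 <= q)%N -> multiple_integral N (I q)) :
  (forall q : nat, (2 <= q)%N ->
    forall F : L, free_poisson_chaos (I q) F -> F <> 0 ->
      ~ (exists lambda : R, 0 < lambda /\ has_law_Z F lambda)) /\
  (forall (f : 1.-tuple (measurableTypeR R) -> R[i]) (lambda : R),
    in_L2 f -> 0 < lambda -> norm2sq f = lambda%:E ->
    (has_law_Z (I 1%N f) lambda <->
     {ae lebesgue_pow R 1, forall t, orthant t -> f t = 0 \/ f t = 1})).
Proof.
split=> [q q2 F [f [f2 _ _ ->]] F0 [lambda [l0 law]]|f lambda f2 l0 fl].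
  case: q q2 => [//|[//|p]] _ in f f2 F0 law *.
  by move: law; apply: (higher_chaos_not_Z hN (hI p.+2 isT)).
split; first exact: (law_Z_first_chaos hN (hI 1%N isT)).
exact: (indicator_law_Z hN (hI 1%N isT)).
Qed.
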